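(* Let $x_0>0$, $y_0>0$, $a>0$, $b\ge0$, $\sigma>0$ with $2a\ge\sigma^2$, and let $X$ and $Y$ be the unique non-negative strong solutions of $$X_t = x_0 + \int_0^t (a - b X_s)\,ds + \sigma \int_0^t \sqrt{X_s}\,dW_s,\qquad Y_t = y_0 + a t + \sigma \int_0^t \sqrt{Y_s}\,dW_s,\qquad t\ge0.$$ Let $N>0$ be an arbitrary constant. (i) The CIR process $X$ satisfies $$\lim_{t\to +\infty} \frac{1}{t} \int_0^t \mathbf P\{X_s < N\}\, ds = \frac{\gamma\left(\frac{2a}{\sigma^2}, \frac{2bN}{\sigma^2}\right)}{\Gamma\left(\frac{2a}{\sigma^2}\right)},$$ where $\gamma(\alpha,x) = \int_0^x u^{\alpha-1} e^{-u}\,du$ is the lower incomplete Gamma function and $\Gamma$ is the Gamma function. (ii) The squared Bessel process $Y$ is stochastically unstable, i.e. $$\lim_{t\to +\infty} \frac{1}{t} \int_0^t \mathbf P\{Y_s < N\}\, ds = 0.$$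
   Context: $W=\{W_t,t\ge0\}$ is a Wiener process on a probability space $(\Omega,\mathcal F,\mathbf P)$. A stochastic process $\xi$ is called stochastically unstable if $\lim_{t\to+\infty}\frac1t\int_0^t\mathbf P\{|\xi_s|<N\}\,ds=0$ for any constant $N>0$. *)

(* Defs.v *)
From HB Require Import structures.
From mathcomp Require Import all_boot all_order all_algebra.
From mathcomp Require Import all_classical all_reals all_analysis.

Set Implicit Arguments.
Unset Strict Implicit.
Unset Printing Implicit Defensive.

Import Order.TTheory GRing.Theory Num.Theory.
Import numFieldNormedType.Exports.

Local Open Scope classical_set_scope.
Local Open Scope ring_scope.

Section gamma_functions.
Context {R : realType}.
Implicit Types alpha x : R.

Definition gamma_integrand alpha (u : R) : R := u `^ (alpha - 1) * expR (- u).

Definition Gamma alpha : R :=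
  \int[lebesgue_measure]_(u in `[0, +oo[) gamma_integrand alpha u.

Definition lower_gamma alpha x : R :=
  \int[lebesgue_measure]_(u in `[0, x]) gamma_integrand alpha u.

End gamma_functions.

(* A process is indexed by all of R, but only its values at times t >= 0 are
   ever constrained or used. *)
Section processes.
Context {d : measure_display} {T : measurableType d} {R : realType}.
Variable P : probability T R.
Implicit Types W X I : R -> {RV P >-> R}.

Definition ae_continuous X : Prop :=
  {ae P, forall w, {within `[0, +oo[, continuous (fun t => X t w)}}.

Definition independent_increments X : Prop :=
  forall (n : nat) (t : nat -> R) (B : nat -> set R),
    0 <= t 0%N -> {homo t : i j / (i <= j)%N >-> i <= j} ->
    (forall i, measurable (B i)) ->
    let A i := [set w | X (t i.+1) w - X (t i) w \in B i] in
    P (\bigcap_(i < n) A i) = (\prod_(i < n) P (A i))%E.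

Definition gaussian_increments X : Prop :=
  forall (s t : R) (B : set R), 0 <= s -> s < t -> measurable B ->
    P [set w | X t w - X s w \in B] = normal_prob 0 (Num.sqrt (t - s)) B.

Definition wiener_process W : Prop :=
  [/\ {ae P, forall w, W 0 w = 0}, independent_increments W,
      gaussian_increments W & ae_continuous W].

(* The natural filtration of W, augmented by the P-null events. *)
Definition augmented_filtration W (t : R) : set (set T) :=
  <<s [set A | (exists s (B : set R),
                  [/\ 0 <= s, s <= t, measurable B & A = W s @^-1` B]) \/
               (measurable A /\ P A = 0%E)] >>.

Definition measurable_wrt (G : set (set T)) (xi : T -> R) : Prop :=
  forall B : set R, measurable B -> G (xi @^-1` B).

Definition adapted (F : R -> set (set T)) (H : R -> T -> R) : Prop :=
  forall t, 0 <= t -> measurable_wrt (F t) (H t).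

(* The process equal to [sp_val i] on the time interval
   ]sp_time i, sp_time i.+1] for i < sp_size, and to 0 elsewhere. *)
Record simple_process (F : R -> set (set T)) := SimpleProcess {
  sp_size : nat ;
  sp_time : nat -> R ;
  sp_val : nat -> T -> R ;
  sp_time_ge0 : 0 <= sp_time 0%N ;
  sp_time_nd : {homo sp_time : i j / (i <= j)%N >-> i <= j} ;
  sp_adapted : forall i, measurable_wrt (F (sp_time i)) (sp_val i) ;
  sp_bounded : exists M : R, forall i w, `|sp_val i w| <= M }.

Definition simple_fun F (K : simple_process F) (s : R) (w : T) : R :=
  \sum_(i < sp_size K)
    sp_val K i w * \1_(`]sp_time K i, sp_time K i.+1]%classic : set R) s.

Definition simple_integral W F (K : simple_process F) (t : R) (w : T) : R :=
  \sum_(i < sp_size K) sp_val K i w *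
    (W (Num.min (sp_time K i.+1) t) w - W (Num.min (sp_time K i) t) w).

(* Convergence to 0 in probability of nonnegative quantities. The outer measure
   agrees with P on events; it is needed because quantities that are defined
   through almost surely regular paths are measurable only up to a negligible
   set, and P is not assumed to be complete. *)
Definition cvg0_in_probability (Z : nat -> T -> \bar R) : Prop :=
  forall e : R, 0 < e ->
    (P^*)%mu [set w | (e%:E <= Z n w)%E] @[n --> \oo] --> 0%E.

(* [ito_integral W H I]: the continuous process I is (a version of) the Ito
   integral of H with respect to W. *)
Definition ito_integral W (H : R -> T -> R) I : Prop :=
  [/\ adapted (augmented_filtration W) H,
      {ae P, forall w, forall t : R, 0 <= t ->
         measurable_fun (`[0, t]%classic : set R) (fun s => H s w) /\
         (\int[lebesgue_measure]_(s in `[0%R, t]) ((H s w) ^+ 2)%:E < +oo)%E},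
      ae_continuous I &
      exists K : nat -> simple_process (augmented_filtration W),
        forall t, 0 <= t ->
          cvg0_in_probability (fun n w =>
            (\int[lebesgue_measure]_(s in `[0%R, t])
               ((simple_fun (K n) s w - H s w) ^+ 2)%:E)%E) /\
          cvg0_in_probability (fun n w =>
            `|simple_integral W (K n) t w - I t w|%:E)].

(* X is a nonnegative strong solution of
     X_t = A_t + sigma * \int_0^t sqrt(X_s) dW_s,   t >= 0. *)
Definition nonneg_strong_solution W (sigma : R) (A : R -> T -> R) X : Prop :=
  [/\ adapted (augmented_filtration W) (fun t => X t),
      ae_continuous X,
      {ae P, forall w, forall t : R, 0 <= t -> 0 <= X t w} &
      exists I, ito_integral W (fun s w => Num.sqrt (X s w)) I /\
        {ae P, forall w, forall t : R, 0 <= t -> X t w = A t w + sigma * I t w}].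

Definition cir_process W (x0 a b sigma : R) X : Prop :=
  nonneg_strong_solution W sigma
    (fun t w => x0 + \int[lebesgue_measure]_(s in `[0, t]) (a - b * X s w)) X.

Definition squared_bessel_process W (y0 a sigma : R) Y : Prop :=
  nonneg_strong_solution W sigma (fun t _ => y0 + a * t) Y.

Definition time_average_prob (E : R -> set T) (t : R) : R :=
  t^-1 * \int[lebesgue_measure]_(s in `[0, t]) fine (P (E s)).

Definition stochastically_unstable X : Prop :=
  forall N : R, 0 < N ->
    time_average_prob (fun s => [set w | `|X s w| < N]) t @[t --> +oo] --> 0.

End processes.

(* Main.v *)
(* Let c = sigma^2 / 2 and let psi solve psi' = - b psi - c psi^2, psi(0) = l.
   Approximate sqrt X by simple processes K on a grid of mesh t / m. Outside an
   event of small probability, the increments of psi(t - s) X_s along the grid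
   add up, with a small error, to the logarithm of the exponential martingale of
   - sigma psi(t - s) K_s, and this logarithm only involves increments of W. The
   martingale is stopped when X or its quadratic variation becomes large; its
   expectation is then exactly 1, and its second moment is bounded by a constant
   that is fixed before the exceptional event, which is therefore negligible by
   Cauchy-Schwarz. No Ito formula is needed to conclude that
     E exp(- l X_t) = exp(- psi(t) x0 - (a / c) ln D(t)),   c psi = (ln D)'.
   If b > 0, this tends to (1 + l c / b)^(- a / c), the Laplace transform of a
   Gamma law. Polynomials in exp(- beta x) sandwich the indicator of {x < N}, so
   P(X_t < N) converges, and its time averages have the same limit. If b = 0,
   which covers Y, then D(t) = 1 + l c t and Markov's inequality applied to
   exp(- X_t) gives P(X_t < N) -> 0. *)
From HB Require Import structures.
Require Import Defs.
From mathcomp Require Import all_boot all_order all_algebra.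
From mathcomp Require Import all_classical all_reals all_analysis measurable_realfun.
From mathcomp Require Import ring lra.
Import Order.TTheory GRing.Theory Num.Theory.
Import numFieldNormedType.Exports.
Local Open Scope classical_set_scope.
Local Open Scope ring_scope.

Set Implicit Arguments.
Unset Strict Implicit.
Unset Printing Implicit Defensive.

(** * Independence of the Wiener increments from the past *)

Section independence.
Context {d : measure_display} {T : measurableType d} {R : realType}.
Variable P : probability T R.

(** The stochastic integral is given only as a limit in probability of simple integrals. So
    expectations are computed only for exponentials of finitely many increments of [W], and X enters
    through a pathwise comparison off an exceptional event. The obstacle is the order of choices.
    The second moment of the exponential martingale is at most exp(C), where C bounds the quadratic
    variation and so involves a bound k on X; but the exceptional event depends on the mesh and on
    K, chosen last. So k is taken from a first event B1, then C is fixed, and only then the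
    probability allowed to a second event B2. On B1 no second moment is needed. The integrand is
    switched off at the first grid point where X exceeds k, and the exponent telescopes, up to e, to
    L - U, where L is minus the logarithm of the target and U = psi X + (a / c) ln D >= 0 at that
    point: the martingale stays below exp(L + e). The condition 2 a >= sigma^2 makes the shape a / c
    of the Gamma law at least 1, so that its density is bounded; it also gives D^(- a / c) <= D^-1
    when b = 0. *)

Definition independent_of (E A : set T) : Prop :=
  measurable A /\ P (A `&` E) = (P A * P E)%E.

Lemma dynkin_independent_of (E : set T) :
  measurable E -> dynkin (independent_of E).
Proof.
move=> mE; split.
- by split=> //; rewrite setTI probability_setT mul1e.
- move=> A [mA AE]; split; first exact: measurableC.
  have -> : ~` A `&` E = E `\` (A `&` E).
    rewrite setDIr setDv setU0; apply/seteqP; split=> w /=; first by case.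
    by case=> ? ?; split.
  have -> : P (E `\` (A `&` E)) = (P E - P (A `&` E))%E.
    rewrite measureD//; last 2 first.
    + exact: measurableI.
    + by rewrite ltey_eq fin_num_measure.
    by rewrite setICA setIid.
  rewrite AE (probability_setC P mA) muleBl ?mul1e ?fin_num_measure//.
- move=> F tF FE; split; first by apply: bigcupT_measurable => i; case: (FE i).
  rewrite setI_bigcupl measure_semi_bigcup//; last 3 first.
  + by move=> i; apply: measurableI => //; case: (FE i).
  + exact: trivIset_setIr.
  + by apply: bigcupT_measurable => i; apply: measurableI => //; case: (FE i).
  rewrite measure_semi_bigcup//; last 2 first.
  + by move=> i; case: (FE i).
  + by apply: bigcupT_measurable => i; case: (FE i).
  rewrite muleC -(fineK (fin_num_measure P _ mE)) -nneseriesZl//.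
  apply: eq_eseriesr => i _; rewrite (fineK (fin_num_measure P _ mE)) muleC.
  by case: (FE i).
Qed.

(** The pi-lambda theorem, applied to the Dynkin system of the events independent of [E]. *)
Lemma independent_of_sigma (E : set T) (G : set (set T)) :
  measurable E -> setI_closed G -> G `<=` independent_of E ->
  <<s G >> `<=` independent_of E.
Proof.
move=> mE GI GE; rewrite -setI_closed_g_dynkin_g_sigma_algebra//.
by apply: smallest_sub => //; exact: dynkin_independent_of.
Qed.

(** [W 0] vanishes only almost surely and the filtration contains all null events, so events of the
    past are recovered from increments only up to a null set. Measurability of [A] is asked
    separately, where [P A] occurs. *)
Definition ae_member (S : set (set T)) (A : set T) : Prop :=
  exists D N, [/\ S D, measurable N, P N = 0%E &
    forall w, ~ N w -> (A w <-> D w)].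

Lemma sigma_algebra_ae_member (S : set (set T)) :
  sigma_algebra setT S -> sigma_algebra setT (ae_member S).
Proof.
case=> S0 SC SU; split.
- by exists set0, set0; split.
- move=> A [D [N [SD mN N0 AD]]]; exists (setT `\` D), N; split=> //.
    exact: SC.
  by move=> w Nw; rewrite /= (AD w Nw).
- move=> F FS.
  have {FS}[D /= FD] := choice FS.
  have {FD}[N FN] := choice FD.
  exists (\bigcup_i D i), (\bigcup_i N i); split.
  + by apply: SU => i; case: (FN i).
  + by apply: bigcupT_measurable => i; case: (FN i).
  + apply: measure_negligible.
      by apply: bigcupT_measurable => i; case: (FN i).
    apply: negligible_bigcup => i; have [_ mN N0 _] := FN i.
    exact/(negligibleP P mN).
  + move=> w Nw; split=> -[i _ wi]; exists i => //.
    * have [_ _ _ /(_ w) FD] := FN i.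
      by apply/FD => // Niw; apply: Nw; exists i.
    * have [_ _ _ /(_ w) FD] := FN i.
      by apply/FD => // Niw; apply: Nw; exists i.
Qed.

Lemma ae_member_independent_of (S : set (set T)) (E A : set T) :
  measurable E -> measurable A -> S `<=` independent_of E -> ae_member S A ->
  independent_of E A.
Proof.
move=> mE mA SE [D [N [SD mN N0 AD]]]; split=> //.
have [mD DE] := SE _ SD.
have aeq (B C : set T) : measurable B -> measurable C ->
    (forall w, ~ N w -> (B w <-> C w)) -> P B = P C.
  move=> mB mC BC; apply/eqP; rewrite eq_le.
  have sub (X Y : set T) : measurable X -> measurable Y ->
      (forall w, ~ N w -> X w -> Y w) -> (P X <= P Y)%E.
    move=> mX mY XY; apply: (@le_trans _ _ (P (Y `|` N))).
      apply: le_measure; rewrite ?inE//; first exact: measurableU.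
      by move=> w Xw; have [Nw|Nw] := pselect (N w); [right|left; exact: XY].
    apply: (le_trans (measureU2 _ mY mN)).
    by rewrite [X in (_ + X)%E]N0 adde0.
  by apply/andP; split; apply: sub => // w Nw /(BC w Nw).
rewrite (aeq A D)// -DE; apply: aeq; try exact: measurableI.
by move=> w Nw; rewrite /= (AD w Nw).
Qed.

End independence.

Section filtration.
Context {d : measure_display} {T : measurableType d} {R : realType}.
Variables (P : probability T R) (W : R -> {RV P >-> R}).
Local Notation F := (augmented_filtration W).

Lemma sigma_algebra_filtration t : sigma_algebra setT (F t).
Proof. exact: smallest_sigma_algebra. Qed.

Lemma filtration_measurable t A : F t A -> measurable A.
Proof.
apply; split; first exact: sigma_algebra_measurable.
move=> _ [[s [B [_ _ mB ->]]]|[]//].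
by rewrite -[X in measurable X]setTI; exact: measurable_funP.
Qed.

Lemma filtration_mono s t : s <= t -> F s `<=` F t.
Proof.
move=> st; apply: smallest_sub; first exact: sigma_algebra_filtration.
move=> A [[u [B [u0 us mB AE]]]|AE]; apply: sub_sigma_algebra; last by right.
by left; exists u, B; split=> //; exact: le_trans st.
Qed.

Lemma measurable_wrt_mono s t (f : T -> R) :
  s <= t -> measurable_wrt (F s) f -> measurable_wrt (F t) f.
Proof. by move=> st mf B mB; apply: filtration_mono st _ _; exact: mf. Qed.

Lemma measurable_wrt_W s t : 0 <= s -> s <= t -> measurable_wrt (F t) (W s).
Proof.
by move=> s0 st B mB; apply: sub_sigma_algebra; left; exists s, B; split.
Qed.

(* [measurable_wrt] is ordinary measurability for the sigma-algebra seen as the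
   structure of a [measurableType]. *)
Lemma measurable_wrtP t (f : T -> R) :
  measurable_wrt (F t) f <->
  measurable_fun setT (f : g_sigma_algebraType (F t) -> R).
Proof.
have FE : <<s F t >> = F t.
  by apply: sigma_algebra_id; exact: sigma_algebra_filtration.
split=> mf.
  by move=> _ B mB; rewrite setTI; apply: sub_sigma_algebra; exact: mf.
move=> B mB; rewrite -FE.
by have := mf measurableT B mB; rewrite setTI.
Qed.

Lemma measurable_wrt_measurable t (f : T -> R) :
  measurable_wrt (F t) f -> measurable_fun setT f.
Proof.
by move=> mf _ B mB; rewrite setTI; apply: filtration_measurable (mf B mB).
Qed.

Hypothesis hW : wiener_process W.

Section increments.
Variables (n : nat) (t : nat -> R).
Hypotheses (t0 : 0 <= t 0%N) (tnd : {homo t : i j / (i <= j)%N >-> i <= j}).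

Let incr i w := W (t i.+1) w - W (t i) w.

Definition increment_rectangle (A : set T) : Prop :=
  exists2 B : nat -> set R, (forall i, measurable (B i)) &
    A = \bigcap_(i < n) [set w | incr i w \in B i].

Let mincr i : measurable_fun setT (incr i).
Proof. exact: measurable_funB. Qed.

Lemma setI_closed_increment_rectangle : setI_closed increment_rectangle.
Proof.
move=> _ _ [B mB ->] [C mC ->]; exists (fun i => B i `&` C i).
  by move=> i; exact: measurableI.
rewrite -bigcapI; apply: eq_bigcapr => i _.
by apply/seteqP; split=> w /=; rewrite in_setI => /andP.
Qed.

(** Independence is used for [n.+1] and for [n] increments: the former, with [B] as last factor,
    gives the probability of the intersection; the latter identifies the product of the other
    factors with the probability of the rectangle. *)
Lemma increment_rectangle_independent (B : set R) : measurable B ->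
  <<s increment_rectangle >> `<=`
    independent_of P [set w | incr n w \in B].
Proof.
move=> mB; have mE C i : measurable C -> measurable [set w | incr i w \in C].
  move=> mC; rewrite [X in measurable X](_ : _ = setT `&` incr i @^-1` C).
    exact: mincr.
  by rewrite setTI; apply/seteqP; split=> w /=; rewrite inE.
apply: independent_of_sigma.
- exact: mE.
- exact: setI_closed_increment_rectangle.
move=> _ [C mC ->]; split.
  by apply: bigcap_measurableType => i _; exact: mE.
case: hW => _ indep _ _.
pose D i := if (i < n)%N then C i else B.
have mD i : measurable (D i) by rewrite /D; case: ifP.
have := indep n.+1 t D t0 tnd mD.
rewrite /= big_ord_recr/= /D ltnn.
under eq_bigr do rewrite ltn_ord.
have := indep n t C t0 tnd mC => /= <- <-.
congr (P _); apply/seteqP; split=> w /=.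
  move=> [Cw Bw] i /=; rewrite ltnS leq_eqVlt => /orP[/eqP ->|i_n].
    by rewrite ltnn.
  by rewrite i_n; exact: Cw.
move=> Dw; split; last by have := Dw n (ltnSn n); rewrite ltnn.
by move=> i /= i_n; have := Dw i (ltnW i_n); rewrite i_n.
Qed.

(** Off the null event where [W 0] is not 0, [W (t k)] is the telescoping sum of the first [k]
    increments. *)
Lemma ae_member_W k (B : set R) : t 0%N = 0 -> (k <= n)%N -> measurable B ->
  ae_member P <<s increment_rectangle >> (W (t k) @^-1` B).
Proof.
move=> t00 kn mB; case: hW => [[N [mN N0 WN]] _ _ _].
pose f : g_sigma_algebraType increment_rectangle -> R :=
  fun w => \sum_(i < k) incr i w.
exists (f @^-1` B), N; split => //.
  have mf : measurable_fun setT f.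
    apply: measurable_sum => i _ C mC; rewrite setTI.
    apply: sub_sigma_algebra; exists (fun j : nat => if j == i :> nat then C else setT).
      by move=> j; case: ifP.
    apply/seteqP; split=> w /=.
      by move=> Cw j /= jn; case: eqP => [->|_]; rewrite inE.
    move=> /(_ i); rewrite /= eqxx inE; apply.
    by rewrite (leq_trans (ltn_ord i)).
  by have := mf measurableT B mB; rewrite setTI.
move=> w Nw; rewrite /preimage/=.
have W0 : W 0 w = 0 by apply: contrapT => W0; apply: Nw; apply: WN.
suff -> : f w = W (t k) w by [].
rewrite /f -(big_mkord xpredT (fun i => incr i w)) /incr.
by rewrite telescope_sumr// t00 W0 subr0.
Qed.

End increments.

(* Finite-dimensional events up to time s, modulo null sets: a pi-system that
   generates the filtration. *)
Definition cylinder (s : R) (A : set T) : Prop :=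
  measurable A /\ exists2 S : seq R, (forall u, u \in S -> 0 <= u <= s) &
    ae_member P <<s [set C | exists u B,
      [/\ u \in S, measurable B & C = W u @^-1` B] ] >> A.

Lemma cylinder_independent (s t : R) (B : set R) : 0 <= s -> s <= t ->
  measurable B -> cylinder s `<=`
    independent_of P [set w | W t w - W s w \in B].
Proof.
move=> s0 st mB A [mA [S S0s AS]].
(* Adding 0 and [s] to the times and sorting gives [u 0 = 0] and [u n = s]; the default value [t] of
   [nth] gives [u n.+1 = t], so that the increment from [s] to [t] is the one numbered [n]. *)
pose L := sort <=%R [:: 0, s & S].
pose u i := nth t L i; pose n := (size S).+1.
have sizeL : size L = n.+1 by rewrite size_sort.
have Ls v : v \in L -> 0 <= v <= s.
  rewrite mem_sort !inE => /or3P[/eqP ->|/eqP ->|/S0s//].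
  - by rewrite lexx s0.
  - by rewrite s0 lexx.
have sL : sorted <=%R L by apply: sort_sorted; exact: le_total.
have und : {homo u : i j / (i <= j)%N >-> i <= j}.
  move=> i j ij; rewrite /u; have [jL|Lj] := ltnP j (size L).
    apply: (sorted_leq_nth le_trans le_refl) => //; rewrite inE//.
    exact: leq_ltn_trans jL.
  rewrite [leRHS]nth_default//; have [iL|Li] := ltnP i (size L).
    by have /Ls/andP[_ /le_trans] := mem_nth t iL; exact.
  by rewrite nth_default.
have Lu v : v \in L -> exists2 i, (i <= n)%N & v = u i.
  move=> vL; exists (index v L); last by rewrite /u nth_index.
  by rewrite -ltnS -sizeL index_mem.
have u_ge0 i : 0 <= u i.
  rewrite /u; have [iL|Li] := ltnP i (size L).
    by have /Ls/andP[] := mem_nth t iL.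
  by rewrite nth_default// (le_trans s0).
have u0 : u 0%N = 0.
  apply/eqP; rewrite eq_le u_ge0 andbT.
  have [|i _ ->] := Lu 0; last exact: und.
  by rewrite mem_sort !inE eqxx.
have un : u n = s.
  apply/eqP; rewrite eq_le; apply/andP; split.
    have : u n \in L by apply: mem_nth; rewrite sizeL.
    by move=> /Ls/andP[].
  have [|i i_n ->] := Lu s; last exact: und.
  by rewrite mem_sort !inE eqxx orbT.
have unS : u n.+1 = t by rewrite /u nth_default// sizeL.
have mE : measurable [set w | W t w - W s w \in B].
  rewrite [X in measurable X](_ : _ = setT `&` (W t \- W s) @^-1` B).
    exact: measurable_funB.
  by rewrite setTI; apply/seteqP; split=> w /=; rewrite inE.
have indep := @increment_rectangle_independent n u (u_ge0 0%N) und B mB.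
rewrite un unS in indep.
apply: (ae_member_independent_of mE mA indep).
have [D [N [SD mN N0 AD]]] := AS.
have : ae_member P <<s increment_rectangle n u >> D.
  apply: SD; split.
    by apply: sigma_algebra_ae_member; exact: smallest_sigma_algebra.
  move=> _ [v [C [vS mC ->]]]; have [|i i_n ->] := Lu v.
    by rewrite mem_sort !inE vS !orbT.
  exact: ae_member_W.
move=> [D' [N' [SD' mN' N'0 DD']]]; exists D', (N `|` N'); split => //.
- exact: measurableU.
- apply/(negligibleP P); first exact: measurableU.
  by apply: negligibleU; [exact/(negligibleP P mN)|exact/(negligibleP P mN')].
- by move=> w /not_orP[Nw N'w]; rewrite (AD w Nw) (DD' w N'w).
Qed.

Lemma setI_closed_cylinder (s : R) : setI_closed (cylinder s).
Proof.
move=> A A' [mA [S S0s [D [N [SD mN N0 AD]]]]].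
move=> [mA' [S' S'0s [D' [N' [SD' mN' N'0 AD']]]]].
split; first exact: measurableI.
exists (S ++ S') => [u|].
  by rewrite mem_cat => /orP[/S0s|/S'0s].
exists (D `&` D'), (N `|` N'); split => //.
- apply: (@measurableI _ (g_sigma_algebraType [set C | exists u B,
      [/\ u \in S ++ S', measurable B & C = W u @^-1` B] ])).
  + apply: sub_sigma_algebra2 SD => _ [u [B [uS mB ->]]]; exists u, B.
    by rewrite mem_cat uS.
  + apply: sub_sigma_algebra2 SD' => _ [u [B [uS mB ->]]]; exists u, B.
    by rewrite mem_cat uS orbT.
- exact: measurableU.
- apply/(negligibleP P); first exact: measurableU.
  by apply: negligibleU; [exact/(negligibleP P mN)|exact/(negligibleP P mN')].
- by move=> w /not_orP[Nw N'w]; rewrite /= (AD w Nw) (AD' w N'w).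
Qed.

Lemma filtration_independent (s t : R) (B : set R) : 0 <= s -> s <= t ->
  measurable B -> F s `<=` independent_of P [set w | W t w - W s w \in B].
Proof.
move=> s0 st mB A FA.
have mE : measurable [set w | W t w - W s w \in B].
  rewrite [X in measurable X](_ : _ = setT `&` (W t \- W s) @^-1` B).
    exact: measurable_funB.
  by rewrite setTI; apply/seteqP; split=> w /=; rewrite inE.
suff : F s `<=` <<s cylinder s >>.
  move=> /(_ _ FA); apply: independent_of_sigma => //.
    exact: setI_closed_cylinder.
  exact: cylinder_independent.
apply: smallest_sub; first exact: smallest_sigma_algebra.
move=> C [[u [D [u0 us mD ->]]]|[mC C0]]; apply: sub_sigma_algebra.
  split; first by rewrite -[X in measurable X]setTI; exact: measurable_funP.
  exists [:: u]; first by move=> v; rewrite inE => /eqP ->; rewrite u0.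
  exists (W u @^-1` D), set0; split => //.
  by apply: sub_sigma_algebra; exists u, D; rewrite inE eqxx.
(* A null event of the augmentation is a cylinder over no time at all: off itself it agrees with the
   empty set. *)
split=> //; exists [::] => //; exists set0, C; split => //.
by have [] := @smallest_sigma_algebra _ setT [set C0 | exists u B,
      [/\ u \in [::], measurable B & C0 = W u @^-1` B] ].
Qed.

End filtration.

(** * Exponential martingales *)

Section gaussian.
Context {R : realType}.
Local Notation mu := (@lebesgue_measure R).

(** The Radon-Nikodym derivative of the normal law is determined only almost everywhere; comparing
    integrals over measurable sets identifies it with [normal_pdf]. *)
Lemma ge0_integral_normal_prob (m s : R) (f : R -> \bar R) :
  measurable_fun setT f -> (forall x, (0 <= f x)%E) ->
  (\int[normal_prob m s]_x f x = \int[mu]_x (f x * (normal_pdf m s x)%:E))%E.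
Proof.
move=> mf f0; have dom := @normal_prob_dominates R m s.
rewrite -(Radon_Nikodym_SigmaFinite.change_of_variables dom f0)//.
have fi := Radon_Nikodym_SigmaFinite.f_integrable dom.
have mpdf : measurable_fun setT (fun x => (normal_pdf m s x)%:E).
  by apply/measurable_EFinP; exact: measurable_normal_pdf.
apply: ae_eq_integral => //.
- by apply: emeasurable_funM => //; exact: measurable_int fi.
- exact: emeasurable_funM.
- apply: ae_eqe_mul2l => /=; apply: integral_ae_eq => //.
  by move=> E _ mE; rewrite -Radon_Nikodym_SigmaFinite.f_integral.
Qed.

(** Completing the square turns the integrand into the normal density of mean [g * s ^+ 2], whose
    total mass is 1. *)
Lemma normal_exponential_moment (s g : R) : 0 < s ->
  (\int[normal_prob 0 s]_x (expR (g * x - g ^+ 2 / 2 * s ^+ 2))%:E = 1)%E.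
Proof.
move=> s0; have s_neq0 : s != 0 by rewrite gt_eqF.
rewrite ge0_integral_normal_prob; last 2 first.
- apply/measurable_EFinP/measurableT_comp => //.
  by apply: measurable_funB => //; exact: measurable_funM.
- by move=> x; rewrite lee_fin expR_ge0.
rewrite -(integral_normal_pdf (g * s ^+ 2) s).
apply: eq_integral => x _; rewrite -EFinM; congr EFin.
rewrite !normal_pdfE// mulrCA; congr (_ * _).
rewrite /normal_fun -expRD; congr expR.
by field.
Qed.

End gaussian.

(** The law of the pair agrees on rectangles with the product of the law of [X] and [N], hence
    everywhere, and Tonelli's theorem applies. This is how past values are frozen in the next
    section. *)
Lemma ge0_integral_independent d d1 d2 (T : measurableType d)
    (T1 : measurableType d1) (T2 : measurableType d2) (R : realType)
    (P : probability T R) (N : probability T2 R) (X : T -> T1) (Y : T -> T2)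
    (h : T1 * T2 -> \bar R) :
  measurable_fun setT X -> measurable_fun setT Y ->
  (forall A B, measurable A -> measurable B ->
    P (X @^-1` A `&` Y @^-1` B) = (P (X @^-1` A) * N B)%E) ->
  measurable_fun setT h -> (forall z, (0 <= h z)%E) ->
  (\int[P]_w h (X w, Y w) = \int[P]_w \int[N]_y h (X w, y))%E.
Proof.
move=> mX mY XYN mh h0.
pose X' : {RV P >-> T1} := HB.pack X (isMeasurableFun.Build _ _ _ _ X mX).
have mXY : measurable_fun setT (fun w => (X w, Y w)).
  exact: measurable_fun_pair.
pose XY : {RV P >-> (T1 * T2)%type} :=
  HB.pack (fun w => (X w, Y w)) (isMeasurableFun.Build _ _ _ _ _ mXY).
have -> : (\int[P]_w h (X w, Y w) = \int[distribution P XY]_z h z)%E.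
  by rewrite ge0_integral_distribution.
have XYE A : measurable A -> A `<=` setT ->
    distribution P XY A = (distribution P X' \x N)%E A.
  move=> mA _; apply/esym.
  apply: (product_measure_unique (m' := distribution P XY)) => //.
rewrite (eq_measure_integral _ XYE).
rewrite fubini_tonelli1// ge0_integral_distribution//.
- exact: measurable_fun_fubini_tonelli_F.
- by move=> x; apply: integral_ge0.
Qed.

Section exponential_martingale.
Context {d : measure_display} {T : measurableType d} {R : realType}.
Variables (P : probability T R) (W : R -> {RV P >-> R}).
Hypothesis hW : wiener_process W.
Local Notation F := (augmented_filtration W).

(** Given the past up to [s], [V] and [g] are constants and the increment is a centred Gaussian
    variable of variance [t - s]. The factor [V] carries the earlier part of the martingale in the
    induction below. *)
Lemma exponential_increment (s t : R) (V g : T -> R) : 0 <= s -> s <= t ->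
  (forall w, 0 <= V w) -> measurable_wrt (F s) V -> measurable_wrt (F s) g ->
  (\int[P]_w (V w * expR (g w * (W t w - W s w)
                          - g w ^+ 2 / 2 * (t - s)))%:E =
   \int[P]_w (V w)%:E)%E.
Proof.
move=> s0 st V0 mV mg.
have [<-|] := eqVneq s t.
  by apply: eq_integral => w _; rewrite !subrr !mulr0 subrr expR0 mulr1.
move=> s_neq_t; have {}st : s < t by rewrite lt_neqAle s_neq_t.
have st0 : 0 < Num.sqrt (t - s) by rewrite sqrtr_gt0 subr_gt0.
have mVT := measurable_wrt_measurable mV.
have mgT := measurable_wrt_measurable mg.
pose D w := W t w - W s w.
have mD : measurable_fun setT D by exact: measurable_funB.
have mVg : measurable_fun setT (fun w => (V w, g w)).
  exact: measurable_fun_pair.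
(* The absolute value makes [h] nonnegative on the whole space, as Tonelli's theorem requires, and
   does not affect the values of [V]. *)
pose h (z : R * R * measurableTypeR R) :=
  (`|z.1.1| * expR (z.1.2 * z.2 - z.1.2 ^+ 2 / 2 * (t - s)))%:E.
have mh : measurable_fun setT h.
  have m1 : measurable_fun setT (fun z : R * R * measurableTypeR R => z.1.1).
    exact: measurableT_comp.
  have m2 : measurable_fun setT (fun z : R * R * measurableTypeR R => z.1.2).
    exact: measurableT_comp.
  apply/measurable_EFinP; apply: measurable_funM.
    exact: measurableT_comp.
  apply: measurableT_comp => //; apply: measurable_funB.
    exact: measurable_funM.
  apply: measurable_funM => //; apply: measurable_funM => //.
  exact: measurable_funX.
have h0 z : (0 <= h z)%E by rewrite lee_fin mulr_ge0// expR_ge0.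
transitivity (\int[P]_w h ((V w, g w), D w))%E.
  by apply: eq_integral => w _; rewrite /h/= ger0_norm.
rewrite (ge0_integral_independent (N := normal_prob 0 (Num.sqrt (t - s))))//.
  apply: eq_integral => w _; rewrite /h/=.
  under eq_integral do rewrite EFinM.
  rewrite ge0_integralZl//; last first.
    apply/measurable_EFinP/measurableT_comp => //.
    by apply: measurable_funB => //; exact: measurable_funM.
  have := normal_exponential_moment (g w) st0.
  rewrite sqr_sqrtr ?subr_ge0 ?ltW// => ->.
  by rewrite mule1 ger0_norm.
move=> A B mA mB.
have FA : F s ((fun w => (V w, g w)) @^-1` A).
  have mVgF : measurable_fun setT
      ((fun w => (V w, g w)) : g_sigma_algebraType (F s) -> (R * R)%type).
    by apply: measurable_fun_pair; exact/measurable_wrtP.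
  rewrite -(sigma_algebra_id (sigma_algebra_filtration W s)).
  by have := mVgF measurableT A mA; rewrite setTI.
have [_] := filtration_independent hW s0 (ltW st) mB FA.
have [_ _ gauss _] := hW; rewrite (gauss _ _ _ s0 st mB) => <-.
congr (P (_ `&` _)).
by apply/seteqP; split=> w /=; rewrite inE.
Qed.

Section ordered_intervals.
Variables (lo hi : nat -> R).
Hypotheses (lo0 : 0 <= lo 0%N) (lohi : forall k, lo k <= hi k).
Hypothesis hilo : forall k, hi k <= lo k.+1.

Let lo_nd : {homo lo : i j / (i <= j)%N >-> i <= j}.
Proof.
apply: homo_leq => //; first by move=> x y z; exact: le_trans.
by move=> k; exact: le_trans (hilo k).
Qed.

Let lo_ge0 k : 0 <= lo k. Proof. exact: le_trans (lo_nd (leq0n k)). Qed.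

(** The logarithm of the Doleans exponential of the integrand equal to [G k] between [lo k] and
    [hi k]. Gaps are allowed, since the times of a simple process need not fill a grid cell. *)
Definition log_exp_mart (G : nat -> T -> R) n w :=
  \sum_(k < n) (G k w * (W (hi k) w - W (lo k) w)
                - G k w ^+ 2 / 2 * (hi k - lo k)).

Lemma measurable_wrt_log_exp_mart G n :
  (forall k, measurable_wrt (F (lo k)) (G k)) ->
  measurable_wrt (F (lo n)) (log_exp_mart G n).
Proof.
move=> mG; apply/measurable_wrtP; apply: measurable_sum => k.
have mGk : measurable_fun setT (G k : g_sigma_algebraType (F (lo n)) -> R).
  apply/measurable_wrtP; apply: measurable_wrt_mono (mG k).
  exact/lo_nd/ltnW.
have mW u : 0 <= u -> u <= lo n ->
    measurable_fun setT (W u : g_sigma_algebraType (F (lo n)) -> R).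
  by move=> u0 un; apply/measurable_wrtP; exact: measurable_wrt_W.
have hin : hi k <= lo n by apply: le_trans (hilo k) _; exact: lo_nd.
apply: measurable_funB.
  apply: measurable_funM => //; apply: measurable_funB; apply: mW => //.
  - exact: le_trans (lohi k).
  - exact/lo_nd/ltnW.
apply: measurable_funM => //; apply: measurable_funM => //.
exact: measurable_funX.
Qed.

Lemma measurable_log_exp_mart G n :
  (forall k, measurable_wrt (F (lo k)) (G k)) ->
  measurable_fun setT (log_exp_mart G n).
Proof.
move=> mG; apply: (@measurable_wrt_measurable _ _ _ P W (lo n)).
exact: measurable_wrt_log_exp_mart.
Qed.

Lemma expectation_exp_mart G n :
  (forall k, measurable_wrt (F (lo k)) (G k)) ->
  (\int[P]_w (expR (log_exp_mart G n w))%:E = 1)%E.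
Proof.
move=> mG; elim: n => [|n IHn].
  under eq_integral do rewrite /log_exp_mart big_ord0 expR0.
  by rewrite integral_cst//= mul1e; exact: probability_setT.
under eq_integral do rewrite /log_exp_mart big_ord_recr/= expRD.
rewrite exponential_increment//.
apply/measurable_wrtP/measurableT_comp => //.
by apply/measurable_wrtP; exact: measurable_wrt_log_exp_mart.
Qed.

(** The square of the exponential of [G] is the exponential of [2 G], of expectation 1, times the
    exponential of the quadratic variation of [G], which is at most exp(C). *)
Lemma second_moment_exp_mart G n C :
  (forall k, measurable_wrt (F (lo k)) (G k)) ->
  (forall w, \sum_(k < n) G k w ^+ 2 * (hi k - lo k) <= C) ->
  (\int[P]_w (expR (log_exp_mart G n w) ^+ 2)%:E <= (expR C)%:E)%E.
Proof.
move=> mG GC; pose G2 k w := 2 * G k w.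
have mG2 k : measurable_wrt (F (lo k)) (G2 k).
  by apply/measurable_wrtP; apply: measurable_funM => //; exact/measurable_wrtP.
have mL H : (forall k, measurable_wrt (F (lo k)) (H k)) ->
    measurable_fun setT (fun w => expR (log_exp_mart H n w)).
  by move=> mH; apply: measurableT_comp => //; exact: measurable_log_exp_mart.
have EG2 : (\int[P]_w ((expR C)%:E * (expR (log_exp_mart G2 n w))%:E) =
    (expR C)%:E)%E.
  rewrite ge0_integralZl//; first by rewrite expectation_exp_mart// mule1.
  by apply/measurable_EFinP; exact: mL.
rewrite -EG2.
apply: ge0_le_integral => //.
- apply/measurable_EFinP; apply: measurable_funX; exact: mL.
- apply/measurable_EFinP; apply: measurable_funM => //; exact: mL.
move=> w _; rewrite -EFinM lee_fin -expRD -expRM_natl ler_expR.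
apply: le_trans (lerD (GC w) (lexx _)).
rewrite /log_exp_mart -big_split/= mulr_sumr; apply: ler_sum => k _.
by rewrite /G2 le_eqVlt; apply/orP; left; apply/eqP; field.
Qed.

End ordered_intervals.

End exponential_martingale.

(** * Paths and grids *)

Section paths.
Context {R : realType}.
Implicit Types f : R -> R.

Lemma within_continuousP (A : set R) f : {within A, continuous f} <->
  forall x, A x -> forall e, 0 < e -> exists2 h, 0 < h &
    forall y, A y -> `|y - x| < h -> `|f y - f x| < e.
Proof.
rewrite subspace_continuousP; split=> cf x Ax.
  move=> e e0; have /cvgrPdist_lt/(_ e e0) := cf x Ax.
  rewrite near_withinE => /nbhs_ballP[h /= h0 xh]; exists h => // y Ay yx.
  by rewrite distrC; apply: xh => //; rewrite /ball/= distrC.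
apply/cvgrPdist_lt => e e0; rewrite near_withinE.
have [h h0 xh] := cf x Ax e e0; apply/nbhs_ballP; exists h => //= y.
by rewrite /ball/= => yx Ay; rewrite distrC; apply: xh => //; rewrite distrC.
Qed.

(** Heine's theorem, with moduli [k.+1%:R^-1], so that irregular paths can be described by a
    decreasing sequence of events. *)
Lemma segment_uniform_continuity f (a b e : R) :
  {within `[a, b], continuous f} -> 0 < e ->
  \forall k \near \oo, forall u v, a <= u <= b -> a <= v <= b ->
    `|u - v| < k.+1%:R^-1 -> `|f u - f v| < e.
Proof.
move=> /within_continuousP cf e0.
have /compact_near_coveringP/near_covering_withinP cov := @segment_compact R a b.
have : \forall k \near \oo, `[a, b] `<=` (fun u => forall v, a <= v <= b ->
    `|u - v| < k.+1%:R^-1 -> `|f u - f v| < e).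
  apply: cov => x abx.
  have e20 : 0 < e / 2 by rewrite divr_gt0.
  have [h h0 xh] := cf x abx _ e20.
  have h20 : 0 < h / 2 by rewrite divr_gt0.
  have near_x : \forall u \near x, `|u - x| < h / 2.
    by apply/nbhs_ballP; exists (h / 2) => //= u; rewrite /ball/= distrC.
  have near_k : \forall k \near \oo, k.+1%:R^-1 < h / 2.
    exact: (near_infty_natSinv_lt (PosNum h20)).
  near=> u k.
  have ux : `|u - x| < h / 2 by near: u.
  have kh : k.+1%:R^-1 < h / 2 by near: k.
  move=> abu v abv uvk.
  have vx : `|v - x| < h.
    rewrite (le_lt_trans (ler_distD u v x))// (splitr h) ltrD//.
    by rewrite distrC (lt_trans uvk).
  rewrite (le_lt_trans (ler_distD (f x) _ _))// (splitr e) ltrD//.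
    by apply: xh => //; rewrite (lt_trans ux)// ltr_pdivrMr// ltr_pMr// ltr1n.
  by rewrite distrC; apply: xh => //=; rewrite in_itv.
apply: filterS => k kP u v abu; apply: kP; rewrite /= in_itv/=.
exact: abu.
Unshelve. all: by end_near.
Qed.

Lemma rat_dense_segment (t u e : R) : 0 < t -> 0 <= u <= t -> 0 < e ->
  exists2 q : rat, 0 <= (ratr q : R) <= t & `|ratr q - u| < e.
Proof.
move=> t0 /andP[u0 ut] e0.
have [|q] := @rat_in_itvoo R (Num.max 0 (u - e)) (Num.min t (u + e)).
  by rewrite lt_min !gt_max t0; apply/andP; split; apply/andP; split; lra.
rewrite in_itv/= lt_min gt_max => /andP[/andP[q0 uq] /andP[qt qu]].
exists q; first by rewrite !ltW.
by rewrite ltr_norml; apply/andP; split; lra.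
Qed.

End paths.

Section path_regularity.
Context {d : measure_display} {T : measurableType d} {R : realType}.
Variable P : probability T R.

(** Failure of the two bounds is tested at rational times only, so that it is an event. These events
    decrease in [k], and every continuous path, bounded and uniformly continuous on [0, t],
    eventually leaves them; so their intersection is null and [P (B k)] tends to 0. Continuity
    extends the bounds to real times. *)
Lemma path_regularity (X : R -> {RV P >-> R}) (t e eta : R) :
  ae_continuous X -> 0 < t -> 0 < e -> 0 < eta ->
  exists (k : nat) (B : set T), [/\ measurable B, (P B <= e%:E)%E &
    forall w, ~ B w ->
      (forall u, 0 <= u <= t -> `|X u w| <= k%:R) /\
      (forall u v, 0 <= u <= t -> 0 <= v <= t -> `|u - v| < k.+1%:R^-1 ->
         `|X u w - X v w| <= eta)].
Proof.
move=> [N [mN N0 XN]] t0 e0 eta0.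
have cX w : ~ N w -> {within `[0, t], continuous (fun u => X u w)}.
  move=> Nw; have : {within `[0, +oo[, continuous (fun u => X u w)}.
    by apply: contrapT => Xw; apply: Nw; apply: XN.
  by apply: continuous_subspaceW => u /=; rewrite !in_itv/= => /andP[->].
pose bad k (p q : R) := [set w | 0 <= p <= t /\ 0 <= q <= t /\
  (k%:R < `|X p w| \/ (`|p - q| < k.+1%:R^-1 /\ eta < `|X p w - X q w|))].
have mbad k p q : measurable (bad k p q).
  rewrite /bad; have [p0|np] := boolP (0 <= p <= t); last first.
    by rewrite (_ : [set _ | _] = set0)// -subset0 => w [].
  have [q0|nq] := boolP (0 <= q <= t); last first.
    by rewrite (_ : [set _ | _] = set0)// -subset0 => w [_ []].
  have gt_measurable c (f : T -> R) :
      measurable_fun setT f -> measurable [set w | c < f w].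
    move=> mf; rewrite (_ : [set _ | _] = setT `&` f @^-1` `]c, +oo[).
      exact: mf.
    by rewrite setTI; apply/seteqP; split=> w /=; rewrite in_itv/= andbT.
  rewrite (_ : [set _ | _] = [set w | k%:R < `|X p w|] `|`
    ([set _ | `|p - q| < k.+1%:R^-1] `&`
     [set w | eta < `|X p w - X q w|])).
    apply: measurableU.
      by apply: gt_measurable; exact: measurableT_comp.
    apply: measurableI.
      have [pq|pq] := pselect (`|p - q| < k.+1%:R^-1).
        by rewrite (_ : [set _ | _] = setT)//; apply/seteqP; split=> w /=.
      by rewrite (_ : [set _ | _] = set0)//; apply/seteqP; split=> w /=.
    apply: gt_measurable; apply: measurableT_comp => //.
    exact: measurable_funB.
  by apply/seteqP; split=> w /=; [case=> _ []|move=> ?; do 2 split=> //].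
pose B k := N `|` \bigcup_(p : rat) \bigcup_(q : rat) bad k (ratr p) (ratr q).
have mB k : measurable (B k).
  apply: measurableU => //.
  by do 2 apply: bigcupT_measurable_rat => ?; exact: mbad.
have BE w k : ~ N w ->
    (forall u, 0 <= u <= t -> `|X u w| <= k%:R) ->
    (forall u v, 0 <= u <= t -> 0 <= v <= t -> `|u - v| < k.+1%:R^-1 ->
       `|X u w - X v w| < eta) -> ~ B k w.
  move=> Nw Xk Xeta [//|[p _ [q _ [p0 [q0 [|[]]]]]]].
    by rewrite ltNge Xk.
  by move=> pq; rewrite ltNge ltW// Xeta.
have Bcap : P (\bigcap_k B k) = 0%E.
  apply/(negligibleP P); first exact: bigcapT_measurable.
  exists N; split=> // w Bw; apply: contrapT => Nw.
  have [M _ XM] : exists2 M : nat, True &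
      forall u, 0 <= u <= t -> `|X u w| <= M%:R.
    have cnX : {within `[0, t], continuous (fun u => `|X u w|)}.
      by move=> u; apply: continuous_comp; [exact: cX|exact: norm_continuous].
    have [c _ cmax] := EVT_max (ltW t0) cnX.
    exists (Num.trunc `|X c w|).+1 => // u u0t.
    by rewrite (le_trans (cmax u _)) ?in_itv// ltW// truncnS_gt.
  have [K _ KP] := segment_uniform_continuity (cX w Nw) eta0.
  apply: (BE w (maxn M K) Nw _ _ (Bw _ I)) => [u u0t|].
    by rewrite (le_trans (XM u u0t))// ler_nat leq_maxl.
  by apply: KP; rewrite /= leq_maxr.
have Bcvg : P (B k) @[k --> \oo] --> 0%E.
  rewrite -Bcap; apply: nonincreasing_cvg_mu => //.
  - by rewrite (le_lt_trans (probability_le1 _ _))// ltry.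
  - exact: bigcapT_measurable.
  move=> i j ij; apply/subsetPset; apply: setUS => w.
  move=> [p _ [q _ [p0 [q0 pq]]]]; exists p => //; exists q => //.
  split=> //; split=> //; case: pq => [Xj|[pq Xeta]]; [left|right; split=> //].
    by rewrite (le_lt_trans _ Xj)// ler_nat.
  rewrite (lt_le_trans pq)// lef_pV2 ?posrE// ler_nat.
  by rewrite ltnS.
have /fine_cvgP[_ /cvgrPdist_lt/(_ e e0)[k _ /(_ _ (leqnn k))]] := Bcvg.
rewrite /= sub0r normrN => kB.
exists k, (B k); split => //.
  rewrite -(fineK (fin_num_measure P _ (mB k))) lee_fin.
  by rewrite (le_trans (ler_norm _))// ltW.
move=> w Bw; have Nw : ~ N w by move=> Nw; apply: Bw; left.
have /within_continuousP cXw := cX w Nw.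
have rat_bad p q : 0 <= (ratr p : R) <= t -> 0 <= (ratr q : R) <= t ->
    `|X (ratr p) w| <= k%:R /\ (`|ratr p - ratr q : R| < k.+1%:R^-1 ->
      `|X (ratr p) w - X (ratr q) w| <= eta).
  move=> p0 q0; split.
    rewrite leNgt; apply/negP => pk; apply: Bw; right.
    by exists p => //; exists q => //; split=> //; split=> //; left.
  move=> pq; rewrite leNgt; apply/negP => pk; apply: Bw; right.
  by exists p => //; exists q => //; split=> //; split=> //; right.
have approx (u c : R) : 0 <= u <= t -> 0 < c -> exists p : rat,
    [/\ 0 <= (ratr p : R) <= t, `|ratr p - u| < c & `|X (ratr p) w - X u w| < c].
  move=> u0t c0; have [|h h0 uh] := cXw u _ c c0; first by rewrite /= in_itv.
  have ch : 0 < Num.min c h by rewrite lt_min c0.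
  have [p p0t] := rat_dense_segment t0 u0t ch.
  rewrite lt_min => /andP[pc ph]; exists p; split=> //.
  by apply: uh => //; rewrite /= in_itv.
split=> [u u0t|u v u0t v0t uvk].
  apply/ler_addgt0Pr => c c0; have [p [p0t _ pu]] := approx u c u0t c0.
  have [Xp _] := rat_bad p p p0t p0t.
  rewrite -[X u w](subrK (X (ratr p) w)) (le_trans (ler_normD _ _))// addrC.
  by rewrite lerD// distrC ltW.
apply/ler_addgt0Pr => c c0.
(* Rational times this close to [u] and [v] are still less than [k.+1%:R^-1] apart, and the two
   approximations of path values cost at most [c] in total. *)
pose c' := Num.min (c / 2) ((k.+1%:R^-1 - `|u - v|) / 2).
have c'0 : 0 < c' by rewrite lt_min !divr_gt0 ?subr_gt0.
have [p [p0t pu Xpu]] := approx u c' u0t c'0.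
have [q [q0t qv Xqv]] := approx v c' v0t c'0.
have [_ pq] := rat_bad p q p0t q0t.
have {}pq : `|X (ratr p) w - X (ratr q) w| <= eta.
  apply: pq; move: pu qv; rewrite /c' !lt_min => /andP[_ pu] /andP[_ qv].
  have pq1 := ler_distD u (ratr p) (ratr q).
  have := ler_distD v u (ratr q); rewrite [`|v - _|]distrC => pq2.
  by move: pu qv pq1 pq2; move: (k.+1%:R^-1 : R) => K *; lra.
move: Xpu Xqv; rewrite /c' !lt_min => /andP[Xpu _] /andP[Xqv _].
have pq1 := ler_distD (X (ratr p) w) (X u w) (X v w).
have := ler_distD (X (ratr q) w) (X (ratr p) w) (X v w).
rewrite [`|X u w - X (ratr p) w|]distrC in pq1 => pq2.
by lra.
Qed.

End path_regularity.

Section covers.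
Context {d : measure_display} {T : measurableType d} {R : realType}.
Variable P : probability T R.

(** The sets arising from [cvg0_in_probability] are controlled in outer measure only; a measurable
    cover can be put into the exceptional event. *)
Definition covered_by (e : R) (A : set T) : Prop :=
  exists B, [/\ measurable B, (P B <= e%:E)%E & A `<=` B].

Lemma outer_measure_covered (e : R) (A : set T) :
  ((P^*)%mu A < e%:E)%E -> covered_by e A.
Proof.
move=> /ereal_inf_lt[_ [F [mF AF] <-] Fe].
exists (\bigcup_k F k); split => //; first exact: bigcupT_measurable.
apply: le_trans (ltW Fe); apply: generalized_Boole_inequality => //.
exact: bigcupT_measurable.
Qed.

Lemma cvg0_in_probability_covered (Z : nat -> T -> \bar R) (c e : R) :
  cvg0_in_probability P Z -> 0 < c -> 0 < e ->
  \forall n \near \oo, covered_by e [set w | (c%:E <= Z n w)%E].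
Proof.
move=> cvgZ c0 e0; have /fine_cvgP[fin /cvgrPdist_lt/(_ e e0)] := cvgZ c c0.
apply: filterS2 fin => n fin; rewrite /= sub0r normrN => Zn.
apply: outer_measure_covered; rewrite -(fineK fin) lte_fin.
exact: le_lt_trans (ler_norm _) Zn.
Qed.

Lemma covered_by_set0 (e : R) : 0 <= e -> covered_by e set0.
Proof. by move=> e0; exists set0; split => //; rewrite measure0. Qed.

Lemma covered_byU (e1 e2 : R) (A B : set T) :
  covered_by e1 A -> covered_by e2 B -> covered_by (e1 + e2) (A `|` B).
Proof.
move=> [C [mC PC AC]] [D [mD PD BD]]; exists (C `|` D); split.
- exact: measurableU.
- by apply: le_trans (measureU2 _ mC mD) _; rewrite EFinD leeD.
- exact: setUSS.
Qed.

(** A single index [n] of the approximating sequence must serve all grid points at once; as there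
    are finitely many, [e] is shared out by repeated halving. *)
Lemma near_covered_bigcup (m : nat) (A : nat -> nat -> set T) :
  (forall j (e : R), (j < m)%N -> 0 < e ->
    \forall n \near \oo, covered_by e (A j n)) ->
  forall e : R, 0 < e ->
    \forall n \near \oo, covered_by e (\bigcup_(j < m) A j n).
Proof.
elim: m => [_ e e0|m IHm Am e e0].
  apply: nearW => n; rewrite bigcup_mkord big_ord0.
  by apply: covered_by_set0; exact: ltW.
have e20 : 0 < e / 2 by rewrite divr_gt0.
have := Am m (e / 2) (ltnSn m) e20.
apply: filterS2 (IHm _ (e / 2) e20) => [n An Amn|j c jm].
  have := covered_byU An Amn; rewrite -splitr => -[B [mB PB AB]].
  exists B; split=> // w [j /=]; rewrite ltnS leq_eqVlt => /orP[/eqP -> Ajw|jm Ajw].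
    by apply: AB; right.
  by apply: AB; left; exists j.
by apply: Am; exact: ltnW.
Qed.

End covers.

(** * The Riccati equation *)

(* The Laplace exponent of the CIR process: [riccati] solves
   psi' = - b psi - c psi^2, psi(0) = l, and c psi is the logarithmic derivative
   of [riccati_den]. The parameter c stands for sigma^2 / 2. *)
Section riccati.
Context {R : realType}.
Variables (b c l : R).
Hypotheses (b0 : 0 <= b) (c0 : 0 < c) (l0 : 0 <= l).

(** The integral of [expR (- b * s)] over s in [0, r]. The case b = 0 is separate, as division by 0
    would return 0. *)
Definition decay_integral (r : R) : R :=
  if b == 0 then r else (1 - expR (- b * r)) / b.

(** The substitution c psi = D' / D linearises the Riccati equation into D'' = - b D' with D(0) = 1
    and D'(0) = l c; this is its solution D. *)
Definition riccati_den (r : R) : R := 1 + l * c * decay_integral r.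

Definition riccati (r : R) : R := l * expR (- b * r) / riccati_den r.

Let is_derive_decay (r : R) :
  is_derive r 1 (fun s : R => expR (- b * s)) (- b * expR (- b * r)).
Proof.
rewrite mulrC; apply: (is_derive1_comp (f := expR) (g := fun s => - b * s)).
have -> : (fun s : R => - b * s) = (- b) *: (id : R -> R^o) by [].
by apply: is_derive_eq; rewrite /GRing.scale/= mulr1.
Qed.

Let is_derive_decay_integral (r : R) :
  is_derive r 1 decay_integral (expR (- b * r)).
Proof.
rewrite /decay_integral; case: eqP => [->|/eqP bn0].
  rewrite oppr0 mul0r expR0; exact: is_derive_id.
have -> : (fun s : R => (1 - expR (- b * s)) / b) =
    b^-1 *: ((cst 1 : R -> R^o) - (fun s : R => expR (- b * s))).
  by apply/funext => s; rewrite /GRing.scale/= mulrC.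
apply: is_derive_eq; rewrite /GRing.scale/=.
by field.
Qed.

Lemma decay_integral_ge0 r : 0 <= r -> 0 <= decay_integral r.
Proof.
move=> r0; rewrite /decay_integral; case: eqP => // /eqP bn0.
rewrite divr_ge0// subr_ge0 -expR0 ler_expR mulNr oppr_le0 mulr_ge0//.
Qed.

Lemma riccati_den_ge1 r : 0 <= r -> 1 <= riccati_den r.
Proof.
by move=> r0; rewrite lerDl !mulr_ge0// ?decay_integral_ge0// ltW.
Qed.

Let den_gt0 r : 0 <= r -> 0 < riccati_den r.
Proof. by move=> /riccati_den_ge1; exact: lt_le_trans. Qed.

Let is_derive_den (r : R) :
  is_derive r 1 riccati_den (l * c * expR (- b * r)).
Proof.
have dI := is_derive_decay_integral r.
have dZ := is_deriveZ (l * c : R) dI.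
apply: is_derive_eq (is_deriveD (is_derive_cst (1 : R^o) r 1) dZ) _.
by rewrite /GRing.scale/= add0r.
Qed.

Lemma is_derive_ln_riccati_den (r : R) : 0 <= r ->
  is_derive r 1 (fun s => ln (riccati_den s)) (c * riccati r).
Proof.
move=> r0; have d0 := den_gt0 r0.
have -> : c * riccati r = (riccati_den r)^-1 * (l * c * expR (- b * r)).
  by rewrite /riccati; field; rewrite gt_eqF.
exact: is_derive1_comp (is_derive1_ln d0) (is_derive_den r).
Qed.

Lemma is_derive_riccati (r : R) : 0 <= r ->
  is_derive r 1 riccati (- (b * riccati r + c * riccati r ^+ 2)).
Proof.
move=> r0; have d0 := den_gt0 r0; have dn0 : riccati_den r != 0 by rewrite gt_eqF.
have dV := is_deriveV dn0 (is_derive_den r).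
have dE := is_derive_decay r.
have dM := is_deriveZ (l : R) (is_deriveM dE dV).
have E : riccati = l \*: ((fun s : R => expR (- b * s)) *
    (fun s => (riccati_den s)^-1)).
  by apply/funext => s; exact: (esym (mulrA _ _ _)).
rewrite [X in is_derive _ _ X]E; apply: is_derive_eq dM _; rewrite /GRing.scale/=.
by rewrite /riccati; field.
Qed.

Lemma riccati_ge0 r : 0 <= r -> 0 <= riccati r.
Proof.
by move=> r0; rewrite divr_ge0 ?mulr_ge0 ?expR_ge0// ltW// den_gt0.
Qed.

Lemma riccati_le r : 0 <= r -> riccati r <= l.
Proof.
move=> r0; rewrite ler_pdivrMr ?den_gt0// ler_wpM2l//.
rewrite (le_trans _ (riccati_den_ge1 r0))// -expR0 ler_expR.
by rewrite mulNr oppr_le0 mulr_ge0.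
Qed.

Let mvt (f df : R -> R) (r h : R) : 0 <= r -> 0 <= h ->
  (forall s : R, 0 <= s -> is_derive s 1 f (df s)) ->
  exists2 s, r <= s <= r + h & f (r + h) - f r = df s * h.
Proof.
move=> r0 h0 fdf.
have rh : r <= r + h by rewrite lerDl.
have cf : {within `[r, r + h], continuous f}.
  apply: derivable_within_continuous => s; rewrite in_itv/= => /andP[rs _].
  by have [] := fdf s (le_trans r0 rs).
have dfI s : s \in `]r, (r + h)[ -> is_derive s 1 f (df s).
  by rewrite in_itv/= => /andP[rs _]; apply: fdf; rewrite (le_trans r0)// ltW.
have [s] := MVT_segment rh dfI cf.
by rewrite in_itv/= (addrC r) addrK => rsh ->; exists s.
Qed.

Let lip := b * l + c * l ^+ 2.

Let rate_bound s : 0 <= s ->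
  0 <= b * riccati s + c * riccati s ^+ 2 <= lip.
Proof.
move=> s0; have p0 := riccati_ge0 s0; have pl := riccati_le s0.
have C0 := ltW c0; have p20 := exprn_ge0 2 p0.
apply/andP; split; first by apply: addr_ge0; exact: mulr_ge0.
by rewrite lerD ?ler_wpM2l// ler_pXn2r// nnegrE.
Qed.

Lemma riccati_lipschitz r h : 0 <= r -> 0 <= h ->
  `|riccati (r + h) - riccati r| <= lip * h.
Proof.
move=> r0 h0; have [s /andP[rs _] ->] := mvt r0 h0 is_derive_riccati.
have /andP[p0 p1] := rate_bound (le_trans r0 rs).
by rewrite mulNr normrN ger0_norm ?mulr_ge0// ler_wpM2r.
Qed.

Let mean_lip r s h : 0 <= r -> r <= s <= r + h ->
  `|riccati s - riccati (r + h)| <= lip * h.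
Proof.
move=> r0 /andP[rs sh]; rewrite distrC.
have -> : r + h = s + (r + h - s) by ring.
apply: le_trans (riccati_lipschitz _ _) _; rewrite ?subr_ge0//.
  exact: le_trans rs.
apply: ler_wpM2l; last by rewrite lerBlDr (addrC r) lerD2l.
have /andP[] := rate_bound (lexx 0); exact: le_trans.
Qed.

(** The derivative is taken at [r + h] because the argument will be the remaining time, which
    decreases along the grid: [r + h] belongs to the left end of a cell and [r] to its right end. *)
Lemma ln_riccati_den_step r h : 0 <= r -> 0 <= h ->
  `|ln (riccati_den (r + h)) - ln (riccati_den r) - c * riccati (r + h) * h|
    <= c * lip * h ^+ 2.
Proof.
move=> r0 h0; have [s rsh ->] := mvt r0 h0 is_derive_ln_riccati_den.
rewrite -mulrBl -mulrBr 2!normrM (ger0_norm h0) (gtr0_norm c0).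
have -> : c * lip * h ^+ 2 = c * (lip * h) * h by ring.
by apply: ler_wpM2r => //; apply: ler_wpM2l; [exact: ltW|exact: mean_lip].
Qed.

(** On [0, l] the map p -> b p + c p^2 has Lipschitz constant [b + 2 * c * l], and [riccati] moves
    by at most [lip * h] over the step. *)
Lemma riccati_step r h : 0 <= r -> 0 <= h ->
  `|riccati r - riccati (r + h)
    - (b * riccati (r + h) + c * riccati (r + h) ^+ 2) * h|
    <= (b + 2 * c * l) * lip * h ^+ 2.
Proof.
move=> r0 h0; have [s rsh E] := mvt r0 h0 is_derive_riccati.
have -> : riccati r - riccati (r + h) =
    (b * riccati s + c * riccati s ^+ 2) * h by rewrite -opprB E; ring.
rewrite -mulrBl normrM (ger0_norm h0) [h ^+ 2]expr2 [leRHS]mulrA.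
apply: ler_wpM2r => //.
have -> : b * riccati s + c * riccati s ^+ 2 -
    (b * riccati (r + h) + c * riccati (r + h) ^+ 2) =
    (b + c * (riccati s + riccati (r + h))) * (riccati s - riccati (r + h)).
  by ring.
have /andP[rs sh] := rsh.
have rh0 : 0 <= r + h by rewrite addr_ge0.
have s0 : 0 <= s by exact: le_trans rs.
have p0 := riccati_ge0 s0; have pl := riccati_le s0.
have q0 := riccati_ge0 rh0; have ql := riccati_le rh0.
rewrite normrM -[leRHS]mulrA.
apply: ler_pM => //; last exact: mean_lip.
have C0 := ltW c0; have pq := addr_ge0 p0 q0; have cpq := mulr_ge0 C0 pq.
rewrite ger0_norm; last exact: addr_ge0.
rewrite lerD2l -mulrA mulrCA; apply: ler_wpM2l => //.
by rewrite mulr_natl mulr2n lerD.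
Qed.

Lemma riccati0 : riccati 0 = l.
Proof.
by rewrite /riccati /riccati_den /decay_integral; case: eqP => _;
  rewrite !(mulr0, expR0, subrr, mul0r, addr0, divr1, mulr1).
Qed.

Lemma riccati_den0 : riccati_den 0 = 1.
Proof.
by rewrite /riccati_den /decay_integral; case: eqP => _;
  rewrite !(mulr0, expR0, subrr, mul0r, addr0).
Qed.

End riccati.

(** * Truncated exponential martingales along a grid *)

Section clamp.
Context {R : realType}.
Implicit Types u v s : R.

Definition clamp u v s := Num.min (Num.max s u) v.

Lemma clamp_ge u v s : u <= v -> u <= clamp u v s.
Proof. by move=> uv; rewrite le_min uv le_max lexx orbT. Qed.

Lemma clamp_le u v s : clamp u v s <= v.
Proof. by rewrite ge_min lexx orbT. Qed.

Lemma clamp_small u v s : u <= v -> s <= u -> clamp u v s = u.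
Proof. by move=> uv su; rewrite /clamp max_r// min_l. Qed.

Lemma clamp_mid u v s : u <= s -> s <= v -> clamp u v s = s.
Proof. by move=> us sv; rewrite /clamp max_l// min_l. Qed.

Lemma clamp_big u v s : u <= v -> v <= s -> clamp u v s = v.
Proof. by move=> uv vs; rewrite /clamp max_l ?min_r// (le_trans uv). Qed.

Lemma clampP u v s : u <= v ->
  [\/ s <= u /\ clamp u v s = u, [/\ u <= s, s <= v & clamp u v s = s] |
      v <= s /\ clamp u v s = v].
Proof.
move=> uv; have [su|us] := leP s u.
  by apply: Or31; split=> //; exact: clamp_small.
have [sv|vs] := leP s v.
  by apply: Or32; split=> //; [exact: ltW|apply: clamp_mid => //; exact: ltW].
by apply: Or33; split; [exact: ltW|apply: clamp_big => //; exact: ltW].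
Qed.

Lemma clamp_nd u v : u <= v -> {homo clamp u v : s s' / s <= s'}.
Proof.
move=> uv s s' ss'.
case: (clampP s uv) => [[su ->]|[us sv ->]|[vs ->]];
case: (clampP s' uv) => [[s'u ->]|[us' s'v ->]|[vs' ->]]; lra.
Qed.

Lemma lebesgue_measure_itv_clamp u v s s' : u <= v -> s <= s' ->
  lebesgue_measure (`]u, v] `&` `]s, s']) =
    (clamp u v s' - clamp u v s)%:E.
Proof.
move=> uv ss'.
have -> : `]u, v] `&` `]s, s'] = `]clamp u v s, clamp u v s']%classic.
  apply/seteqP; split=> x /=; rewrite !in_itv/=.
    move=> [/andP[ux xv] /andP[sx xs']].
    rewrite /clamp le_min le_max xs' xv/= andbT.
    by rewrite gt_min gt_max sx ux.
  case: (clampP s uv) => [[su ->]|[us sv ->]|[vs ->]];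
  case: (clampP s' uv) => [[s'u ->]|[us' s'v ->]|[vs' ->]] => /andP[x1 x2];
  by split; apply/andP; split; lra.
rewrite lebesgue_measure_itv/= lte_fin lt_neqAle clamp_nd// andbT.
by case: eqP => [->|_]; rewrite ?subrr// EFinB.
Qed.

End clamp.

Lemma sum_flatten (V : nmodType) (m n : nat) (f : nat -> V) :
  \sum_(k < m * n) f k = \sum_(j < m) \sum_(i < n) f (j * n + i)%N.
Proof.
elim: m => [|m IHm]; first by rewrite mul0n !big_ord0.
by rewrite big_ord_recr/= -IHm mulSnr big_split_ord.
Qed.

Lemma truncated_sum_le (R : realDomainType) (a : nat -> R) (C : R) n :
  (forall k, 0 <= a k) -> 0 <= C ->
  \sum_(k < n) (if \sum_(l < k.+1) a l <= C then a k else 0) <= C.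
Proof.
move=> a0 C0.
pose S k := \sum_(l < k) a l.
have SS k : S k.+1 = S k + a k by rewrite /S big_ord_recr.
(* The bound by [S n] feeds the induction: when [a n] is kept, the new sum is at most
   [S n + a n = S n.+1], which is at most [C]. *)
suff: \sum_(k < n) (if S k.+1 <= C then a k else 0) <= C /\
    \sum_(k < n) (if S k.+1 <= C then a k else 0) <= S n by case.
elim: n => [|n [IH1 IH2]]; first by rewrite /S !big_ord0.
have IHS := IH2; rewrite -(lerD2r (a n)) -SS in IHS.
rewrite big_ord_recr/=; case: ifPn => [SC|_].
  by split=> //; exact: le_trans SC.
by rewrite addr0; split=> //; apply: le_trans IH2 _; rewrite SS lerDl.
Qed.

Section truncated_exponential_martingale.
Context {d : measure_display} {T : measurableType d} {R : realType}.
Variables (P : probability T R) (W : R -> {RV P >-> R}).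
Hypothesis hW : wiener_process W.
Local Notation F := (augmented_filtration W).

(** [G k] is cut to 0 once the quadratic variation, interval [k] included, exceeds [C]. It involves
    only [G] up to index [k], known at time [lo k], so the cut integrand is still adapted; on paths
    of total variation at most [C] nothing is cut. *)
Lemma truncated_exp_mart (lo hi : nat -> R) (G : nat -> T -> R) (n : nat)
    (C : R) :
  0 <= lo 0%N -> (forall k, lo k <= hi k) -> (forall k, hi k <= lo k.+1) ->
  (forall k, measurable_wrt (F (lo k)) (G k)) -> 0 <= C ->
  exists V : T -> R, [/\ measurable_fun setT V, (forall w, 0 <= V w),
    (\int[P]_w (V w)%:E = 1)%E, (\int[P]_w (V w ^+ 2)%:E <= (expR C)%:E)%E &
    forall w, \sum_(k < n) G k w ^+ 2 * (hi k - lo k) <= C ->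
      V w = expR (\sum_(k < n) (G k w * (W (hi k) w - W (lo k) w)
                                - G k w ^+ 2 / 2 * (hi k - lo k)))].
Proof.
move=> lo0 lohi hilo mG C0.
pose q k w := G k w ^+ 2 * (hi k - lo k).
have q0 k w : 0 <= q k w by rewrite mulr_ge0 ?sqr_ge0// subr_ge0.
pose G' k w := if \sum_(l < k.+1) q l w <= C then G k w else 0.
have lo_nd : {homo lo : i j / (i <= j)%N >-> i <= j}.
  apply: homo_leq => //; first by move=> x y z; exact: le_trans.
  by move=> k; exact: le_trans (hilo k).
have mG' k : measurable_wrt (F (lo k)) (G' k).
  apply/measurable_wrtP; apply: measurable_fun_if => //.
  - have msum : measurable_fun setT ((fun w => \sum_(l < k.+1) q l w) :
        g_sigma_algebraType (F (lo k)) -> R).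
      apply: measurable_sum => l; apply: measurable_funM => //.
      apply: measurable_funX; apply/measurable_wrtP.
      by apply: measurable_wrt_mono (mG l); apply: lo_nd; rewrite -ltnS.
    exact: measurable_fun_ler.
  - by apply: measurable_funTS; exact/measurable_wrtP.
have G'C w : \sum_(k < n) G' k w ^+ 2 * (hi k - lo k) <= C.
  apply: le_trans (truncated_sum_le n (fun k => q0 k w) C0).
  apply: ler_sum => k _; rewrite /G'; case: ifP => // _.
  by rewrite expr0n mul0r.
exists (fun w => expR (log_exp_mart W lo hi G' n w)); split.
- by apply: measurableT_comp => //; exact: measurable_log_exp_mart.
- by move=> w; exact: expR_ge0.
- exact: expectation_exp_mart.
- exact: second_moment_exp_mart.
move=> w qC; congr expR; apply: eq_bigr => k _.
suff -> : G' k w = G k w by [].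
rewrite /G'; case: ifPn => // /negP[].
apply: le_trans qC; rewrite -(big_mkord xpredT (fun l => q l w)).
rewrite -(big_mkord xpredT (fun l => q l w)).
rewrite [leRHS](big_cat_nat (n := k.+1))//= lerDl.
by apply: sumr_ge0 => l _; exact: q0.
Qed.

End truncated_exponential_martingale.

(** * Simple processes cut along a grid *)

Section simple_processes.
Context {d : measure_display} {T : measurableType d} {R : realType}.
Variables (P : probability T R) (W : R -> {RV P >-> R}).
Local Notation F := (augmented_filtration W).
Variable K : simple_process F.

Let s_nd i : sp_time K i <= sp_time K i.+1.
Proof. exact: sp_time_nd. Qed.

Lemma simple_integral_increment (u v : R) w : u <= v ->
  simple_integral W K v w - simple_integral W K u w =
  \sum_(i < sp_size K) sp_val K i w *
    (W (clamp u v (sp_time K i.+1)) w - W (clamp u v (sp_time K i)) w).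
Proof.
move=> uv; rewrite /simple_integral -sumrB; apply: eq_bigr => i _.
rewrite -mulrBr; congr (_ * _).
have key s : W (Num.min s v) w - W (Num.min s u) w = W (clamp u v s) w - W u w.
  case: (clampP s uv) => [[su ->]|[us sv ->]|[vs ->]].
  - by rewrite !min_l ?subrr// (le_trans su).
  - by rewrite min_l// min_r.
  - by rewrite !min_r// (le_trans uv).
have := key (sp_time K i.+1); have := key (sp_time K i).
by lra.
Qed.

Definition simple_qv (u v : R) w : R :=
  \sum_(i < sp_size K) sp_val K i w ^+ 2 *
    (clamp u v (sp_time K i.+1) - clamp u v (sp_time K i)).

(** At most one of the intervals contains [s], so the cross terms vanish. *)
Lemma simple_fun_sqr s w : simple_fun K s w ^+ 2 =
  \sum_(i < sp_size K) sp_val K i w ^+ 2 *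
    \1_(`]sp_time K i, sp_time K i.+1]%classic : set R) s.
Proof.
rewrite /simple_fun.
have [[i si]|nsi] := pselect (exists i : 'I_(sp_size K),
    (`]sp_time K i, sp_time K i.+1]%classic : set R) s); last first.
  rewrite !big1 ?expr0n// => i _; rewrite indicE memNset ?mulr0// => si;
  by apply: nsi; exists i.
have other (j : 'I_(sp_size K)) : j != i ->
    \1_(`]sp_time K j, sp_time K j.+1]%classic : set R) s = 0 :> R.
  move=> ji; rewrite indicE memNset//= in_itv/= => /andP[sj sj1].
  move: si; rewrite /= in_itv/= => /andP[si si1].
  move: ji; rewrite neq_lt => /orP[ij|ij].
    have := le_trans sj1 (sp_time_nd K ij); rewrite leNgt si//.
  have := le_trans si1 (sp_time_nd K ij); rewrite leNgt sj//.
rewrite (bigD1 i)//= [in RHS](bigD1 i)//=.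
rewrite big1 => [|j ji]; last by rewrite other ?mulr0.
rewrite big1 => [|j ji]; last by rewrite other ?mulr0.
by rewrite !addr0 indicE mem_set// !mulr1.
Qed.

Lemma integral_simple_fun_sqr (u v : R) w : u <= v ->
  (\int[lebesgue_measure]_(s in `]u, v]) (simple_fun K s w ^+ 2)%:E =
   (simple_qv u v w)%:E)%E.
Proof.
move=> uv; under eq_integral do rewrite simple_fun_sqr -sumEFin.
rewrite ge0_integral_sum//; last 2 first.
- move=> i; apply/measurable_EFinP; apply: measurable_funM => //.
- by move=> i s _; rewrite lee_fin mulr_ge0// sqr_ge0.
rewrite -sumEFin; apply: eq_bigr => i _.
under eq_integral do rewrite EFinM.
rewrite ge0_integralZl//; last 2 first.
- by apply/measurable_EFinP.
- by rewrite lee_fin sqr_ge0.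
rewrite integral_indic// [RHS]EFinM; congr (_ * _)%E.
by rewrite setIC; exact: lebesgue_measure_itv_clamp.
Qed.

Lemma measurable_simple_fun w : measurable_fun setT (fun s => simple_fun K s w).
Proof.
by apply: measurable_sum => i; apply: measurable_funM.
Qed.

Hypothesis hW : wiener_process W.

(** The integrand is [c j] times [K] on the j-th cell. Refining the grid by the times of [K] turns
    it into a step integrand with a single index, to which [truncated_exp_mart] applies. *)
Lemma simple_exp_mart (h C : R) (m : nat) (c : nat -> T -> R) :
  0 <= h -> 0 <= C ->
  (forall j, measurable_wrt (F (j%:R * h)) (c j)) ->
  exists V : T -> R, [/\ measurable_fun setT V, (forall w, 0 <= V w),
    (\int[P]_w (V w)%:E = 1)%E, (\int[P]_w (V w ^+ 2)%:E <= (expR C)%:E)%E &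
    forall w,
      \sum_(j < m) c j w ^+ 2 * simple_qv (j%:R * h) (j.+1%:R * h) w <= C ->
      V w = expR (\sum_(j < m) (c j w *
        (simple_integral W K (j.+1%:R * h) w - simple_integral W K (j%:R * h) w)
         - c j w ^+ 2 / 2 * simple_qv (j%:R * h) (j.+1%:R * h) w))].
Proof.
move=> h0 C0 mc; pose n := sp_size K.
pose u j : R := j%:R * h.
have u_nd j : u j <= u j.+1 by rewrite ler_wpM2r// ler_nat.
have u_ge0 j : 0 <= u j by rewrite mulr_ge0.
(* [k] encodes the cell [k %/ n.+1] and the piece [k %% n.+1] of [K]. Each cell has [n.+1] slots,
   the last one inactive, so that the divisor is positive even if [K] has no piece. *)
pose lo k := clamp (u (k %/ n.+1)%N) (u (k %/ n.+1).+1) (sp_time K (k %% n.+1)%N).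
pose hi k := clamp (u (k %/ n.+1)%N) (u (k %/ n.+1).+1) (sp_time K (k %% n.+1).+1).
(* A value of [K] is known only from its own starting time on. If that time lies after the cell, the
   clamped piece is empty, and the value 0 keeps [G k] measurable at time [lo k]. *)
pose act k := ((k %% n.+1)%N < n)%N &&
  (sp_time K (k %% n.+1)%N <= u (k %/ n.+1).+1).
pose G k w := if act k
  then c (k %/ n.+1)%N w * sp_val K (k %% n.+1)%N w else 0.
have lo0 : 0 <= lo 0%N by rewrite (le_trans (u_ge0 _) (clamp_ge _ _)).
have lohi k : lo k <= hi k by apply: clamp_nd.
have hilo k : hi k <= lo k.+1.
  rewrite /hi /lo divnS// modnS; case: ifPn => kn.
    by rewrite add1n (le_trans (clamp_le _ _ _))// clamp_ge.
  by rewrite add0n.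
have mG k : measurable_wrt (F (lo k)) (G k).
  rewrite /G; have [/andP[kn sk]|_] := boolP (act k); last first.
    by apply/measurable_wrtP.
  apply/measurable_wrtP; apply: measurable_funM; apply/measurable_wrtP.
    by apply: measurable_wrt_mono (mc _); apply: clamp_ge; exact: u_nd.
  apply: measurable_wrt_mono (sp_adapted _ _).
  by rewrite le_min sk le_max lexx.
have [V [mV V0 V1 V2 VE]] := truncated_exp_mart hW (m * n.+1) lo0 lohi hilo mG C0.
have kj j i : (i < n.+1)%N -> ((j * n.+1 + i) %/ n.+1)%N = j.
  by move=> i_n; rewrite divnMDl// divn_small ?addn0.
have ki j i : (i < n.+1)%N -> ((j * n.+1 + i) %% n.+1)%N = i.
  by move=> i_n; rewrite modnMDl modn_small.
have flat w (f : R -> R -> R -> R) : (forall y z, f 0 y z = 0) ->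
    (forall x y, f x y y = 0) ->
    \sum_(k < m * n.+1) f (G k w) (hi k) (lo k) =
    \sum_(j < m) \sum_(i < n) f (c j w * sp_val K i w)
      (clamp (u j) (u j.+1) (sp_time K i.+1))
      (clamp (u j) (u j.+1) (sp_time K i)).
  move=> f0 fxx.
  rewrite (sum_flatten m n.+1 (fun k => f (G k w) (hi k) (lo k))).
  apply: eq_bigr => j _; rewrite big_ord_recr/= {2}/G /act ki// ltnn f0 addr0.
  apply: eq_bigr => i _; have i_n : (i < n.+1)%N by rewrite ltnW// ltnS.
  rewrite /G /act /hi /lo !kj// !ki// ltn_ord/=.
  case: ifPn => //; rewrite -ltNge => us.
  rewrite f0 !clamp_big ?fxx//; first exact: ltW.
  by rewrite (le_trans (ltW us)).
exists V; split => // w qC; rewrite VE.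
  congr expR; rewrite (flat w (fun x y z => x * (W y w - W z w) - x ^+ 2 / 2 * (y - z))).
  - apply: eq_bigr => j _; rewrite (simple_integral_increment _ (u_nd j)) /simple_qv.
    rewrite !mulr_sumr -sumrB; apply: eq_bigr => i _.
    by rewrite /u; field.
  - by move=> y z; rewrite expr0n !mul0r subrr.
  - by move=> x y; rewrite !subrr !mulr0 subrr.
rewrite (flat w (fun x y z => x ^+ 2 * (y - z))).
- apply: le_trans qC; rewrite le_eqVlt; apply/orP; left; apply/eqP.
  apply: eq_bigr => j _; rewrite /simple_qv mulr_sumr; apply: eq_bigr => i _.
  by rewrite exprMn mulrA.
- by move=> y z; rewrite expr0n mul0r.
- by move=> x y; rewrite subrr mulr0.
Qed.

End simple_processes.

(** * Estimates on one grid cell *)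

Section integral_estimates.
Context {R : realType}.
Local Notation mu := (@lebesgue_measure R).

Let mu_itv (u v : R) : u <= v -> mu `]u, v] = (v - u)%:E.
Proof.
move=> uv; rewrite lebesgue_measure_itv/= lte_fin lt_neqAle uv andbT.
by case: eqP => [->|_]; rewrite ?subrr// EFinB.
Qed.

Lemma Rintegral_increment_near (f : R -> R) (t u v k eta : R) :
  {within `[0, t], continuous f} -> 0 <= u -> u <= v -> v <= t ->
  (forall s, u < s <= v -> `|f s - k| <= eta) ->
  `|\int[mu]_(s in `[0, v]) f s - \int[mu]_(s in `[0, u]) f s - k * (v - u)|
    <= eta * (v - u).
Proof.
move=> cf u0 uv vt fk.
have if0v : mu.-integrable `[0, v] (EFin \o f).
  apply: continuous_compact_integrable; first exact: segment_compact.
  apply: continuous_subspaceW cf => s /=; rewrite !in_itv/= => /andP[-> sv].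
  exact: le_trans vt.
have ifuv : mu.-integrable `]u, v] (EFin \o f).
  apply: integrableS if0v => // s /=; rewrite !in_itv/= => /andP[us ->].
  by rewrite (le_trans u0)// ltW.
rewrite Rintegral_itvB// ?bnd_simp//.
have icst (r : R) : mu.-integrable `]u, v] (EFin \o cst r).
  have icuv : mu.-integrable `[u, v] (EFin \o cst r).
    apply: continuous_compact_integrable; first exact: segment_compact.
    by apply: continuous_subspaceT => x; exact: cvg_cst.
  apply: integrableS icuv => // s /=; rewrite !in_itv/= => /andP[us ->].
  by rewrite ltW.
have Icst r : \int[mu]_(s in `]u, v]) cst r s = r * (v - u).
  by rewrite Rintegral_cst//= mu_itv.
rewrite ler_norml; apply/andP; split.
  rewrite lerBrDr -mulNr -mulrDl -Icst; apply: le_Rintegral => // s /=.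
  rewrite in_itv/= => /fk; rewrite ler_norml => /andP[? _]; lra.
rewrite lerBlDr -mulrDl -Icst; apply: le_Rintegral => // s /=.
rewrite in_itv/= => /fk; rewrite ler_norml => /andP[_ ?]; lra.
Qed.

(** Young's inequality on the cross term of x^2 - y^2 = 2 y (x - y) + (x - y)^2; the free weight [r]
    serves to make the first term small. *)
Lemma sqr_perturbation (x y r : R) : 0 < r ->
  `|x ^+ 2 - y ^+ 2| <= r * y ^+ 2 + (1 + r^-1) * (x - y) ^+ 2.
Proof.
move=> r0; have ri0 : 0 < r^-1 by rewrite invr_gt0.
have e1 : r * r^-1 = 1 by rewrite mulfV// gt_eqF.
rewrite ler_norml; apply/andP; split.
  have : 0 <= r^-1 * (r * y + (x - y)) ^+ 2 by rewrite mulr_ge0 ?sqr_ge0// ltW.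
  have -> : r^-1 * (r * y + (x - y)) ^+ 2 =
      (r * r^-1) * (r * y ^+ 2) + 2 * (r * r^-1) * (y * (x - y)) + r^-1 * (x - y) ^+ 2.
    by ring.
  have := sqr_ge0 (x - y).
  rewrite e1 => *; nra.
have : 0 <= r^-1 * (r * y - (x - y)) ^+ 2 by rewrite mulr_ge0 ?sqr_ge0// ltW.
have -> : r^-1 * (r * y - (x - y)) ^+ 2 =
    (r * r^-1) * (r * y ^+ 2) - 2 * (r * r^-1) * (y * (x - y)) + r^-1 * (x - y) ^+ 2.
  by ring.
have := sqr_ge0 (x - y).
rewrite e1 => *; nra.
Qed.

(** Meant for [f] the simple process, [g] the square root of X and [k] the value of X at the left
    end: L^2 closeness of [f] and [g] lets the quadratic variation [q] be read off from X. *)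
Lemma ge0_integral_sqr_near (f g : R -> R) (u v k M eta r e q : R) : u <= v ->
  0 < r -> 0 <= M -> 0 <= eta -> 0 <= k ->
  measurable_fun `]u, v] f -> measurable_fun `]u, v] g ->
  (forall s, u < s <= v -> g s ^+ 2 <= M) ->
  (forall s, u < s <= v -> `|g s ^+ 2 - k| <= eta) ->
  (\int[mu]_(s in `]u, v]) (f s ^+ 2)%:E = q%:E)%E ->
  (\int[mu]_(s in `]u, v]) ((f s - g s) ^+ 2)%:E <= e%:E)%E ->
  `|q - k * (v - u)| <= (r * M + eta) * (v - u) + (1 + r^-1) * e.
Proof.
move=> uv r0 M0 eta0 k0 mf mg gM gk fq fge.
have ri0 : 0 < r^-1 by rewrite invr_gt0.
have r10 : 0 <= 1 + r^-1 by rewrite addr_ge0// ltW.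
have mf2 : measurable_fun `]u, v] (fun s => (f s ^+ 2)%:E).
  by apply/measurable_EFinP; exact: measurable_funX.
have mD : measurable_fun `]u, v] (fun s => ((1 + r^-1) * (f s - g s) ^+ 2)%:E).
  apply/measurable_EFinP; apply: measurable_funM => //.
  by apply: measurable_funX; exact: measurable_funB.
have ID : (\int[mu]_(s in `]u, v]) ((1 + r^-1) * (f s - g s) ^+ 2)%:E <=
    ((1 + r^-1) * e)%:E)%E.
  under eq_integral do rewrite EFinM.
  rewrite ge0_integralZl//.
  - by rewrite EFinM lee_pmul// ?lee_fin// integral_ge0// => s _;
      rewrite lee_fin sqr_ge0.
  - apply/measurable_EFinP; apply: measurable_funX; exact: measurable_funB.
  - by move=> s _; rewrite lee_fin sqr_ge0.
have D0 s : 0 <= (1 + r^-1) * (f s - g s) ^+ 2 by rewrite mulr_ge0// sqr_ge0.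
have Icst c : (\int[mu]_(s in `]u, v]) c%:E = (c * (v - u))%:E)%E.
  by rewrite integral_cst//= mu_itv// EFinM.
have key s : u < s <= v ->
    `|f s ^+ 2 - k| <= r * M + eta + (1 + r^-1) * (f s - g s) ^+ 2.
  move=> suv; have h1 := sqr_perturbation (f s) (g s) r0.
  have h2 := gk s suv; have h3 := ler_distD (g s ^+ 2) (f s ^+ 2) k.
  have h4 : r * g s ^+ 2 <= r * M by rewrite ler_pM2l// gM.
  lra.
have rM0 : 0 <= r * M by rewrite mulr_ge0// ltW.
rewrite ler_norml; apply/andP; split.
- suff : ((k * (v - u))%:E <=
      q%:E + (((r * M + eta) * (v - u))%:E + ((1 + r^-1) * e)%:E))%E.
    by rewrite -!EFinD lee_fin; lra.
  rewrite -fq -!Icst; apply: (@le_trans _ _ (\int[mu]_(s in `]u, v])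
    ((f s ^+ 2)%:E + ((r * M + eta)%:E + ((1 + r^-1) * (f s - g s) ^+ 2)%:E)))%E).
    apply: ge0_le_integral => //.
    + by apply: emeasurable_funD => //; exact: emeasurable_funD.
    + move=> s /=; rewrite in_itv/= => suv; rewrite -!EFinD lee_fin.
      by have := key s suv; rewrite ler_norml => /andP[? _]; lra.
  rewrite ge0_integralD//; last 3 first.
  + by move=> s _; rewrite lee_fin sqr_ge0.
  + by move=> s _; rewrite -EFinD lee_fin !addr_ge0.
  + exact: emeasurable_funD.
  rewrite leeD2l// ge0_integralD//.
  + by rewrite leeD2l.
  + by move=> s _; rewrite lee_fin addr_ge0.
  + by move=> s _; rewrite lee_fin.
- suff : (q%:E <= (k * (v - u))%:E +
      (((r * M + eta) * (v - u))%:E + ((1 + r^-1) * e)%:E))%E.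
    by rewrite -!EFinD lee_fin; lra.
  rewrite -fq -!Icst; apply: (@le_trans _ _ (\int[mu]_(s in `]u, v])
    (k%:E + ((r * M + eta)%:E + ((1 + r^-1) * (f s - g s) ^+ 2)%:E)))%E).
    apply: ge0_le_integral => //.
    + by move=> s _; rewrite lee_fin sqr_ge0.
    + by apply: emeasurable_funD => //; exact: emeasurable_funD.
    + move=> s /=; rewrite in_itv/= => suv; rewrite -!EFinD lee_fin.
      by have := key s suv; rewrite ler_norml => /andP[_ ?]; lra.
  rewrite ge0_integralD//; last 2 first.
  + by move=> s _; rewrite -EFinD lee_fin !addr_ge0.
  + exact: emeasurable_funD.
  rewrite leeD2l// ge0_integralD//.
  + by rewrite leeD2l.
  + by move=> s _; rewrite lee_fin addr_ge0.
  + by move=> s _; rewrite lee_fin.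
Qed.

End integral_estimates.

(** Supplies the grid index from which the integrand is switched off. *)
Lemma monotone_bool_threshold (p : nat -> bool) (m : nat) :
  (forall j, p j.+1 -> p j) ->
  exists2 n : nat, (n <= m)%N & forall j, (j < m)%N -> p j = (j < n)%N.
Proof.
move=> pS; elim: m => [|m [n nm pn]]; first by exists 0%N.
have pmono i j : (i <= j)%N -> p j -> p i.
  by move=> /subnK <-; elim: (j - i)%N => // k IHk /pS; exact: IHk.
have [pm|npm] := boolP (p m).
  exists m.+1 => // j jm; rewrite jm.
  by apply: pmono pm; rewrite -ltnS.
exists n; first by rewrite (leq_trans nm).
move=> j; rewrite ltnS leq_eqVlt => /orP[/eqP ->|]; last exact: pn.
by rewrite (negbTE npm) ltnNge nm.
Qed.

Section riccati_telescope.
Context {R : realType}.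
Variables (a b s l t h : R) (m : nat).
Hypotheses (a0 : 0 <= a) (b0 : 0 <= b) (s0 : 0 < s) (l0 : 0 <= l) (h0 : 0 <= h).
Hypothesis tmh : t = m%:R * h.

Let c := s ^+ 2 / 2.
Let psi j := riccati b c l (t - j%:R * h).
Let lnD j := ln (riccati_den b c l (t - j%:R * h)).
Let lip := b * l + c * l ^+ 2.

Let c0 : 0 < c. Proof. by rewrite divr_gt0// exprn_gt0. Qed.

(** Error of one step. The terms come, in order, from the stochastic increment, the quadratic
    variation, the product of the increments of psi and x, and the second-order errors on psi (times
    x) and on ln D. *)
Definition telescope_error (e1 e3 eta M : R) : R :=
  l * e1 + c * l ^+ 2 * e3 + lip * h * eta
  + (b + 2 * c * l) * lip * h ^+ 2 * M + a * lip * h ^+ 2.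

Let time_ge0 j : (j <= m)%N -> 0 <= t - j%:R * h.
Proof. by move=> jm; rewrite tmh -mulrBl mulr_ge0// subr_ge0 ler_nat. Qed.

Let timeS j : t - j%:R * h = (t - j.+1%:R * h) + h.
Proof. by rewrite -natr1; ring. Qed.

(** Discrete counterpart of d(psi X + (a / c) ln D). Once [s * S j] and [q j] are expressed through
    x, the Riccati equation turns the terms proportional to x into x times the increment of psi, and
    the remaining a psi h is the decrease of (a / c) ln D. The sum may end at any [n], as the
    integrand may be switched off early. *)
Lemma riccati_telescope (x S q : nat -> R) (e1 e3 eta M : R) (n : nat) :
  (n <= m)%N ->
  (forall j, (j < m)%N -> 0 <= x j <= M) ->
  (forall j, (j < m)%N -> `|x j.+1 - x j| <= eta) ->
  (forall j, (j < m)%N ->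
    `|x j.+1 - x j - (a - b * x j) * h - s * S j| <= e1) ->
  (forall j, (j < m)%N -> `|q j - x j * h| <= e3) ->
  0 <= e1 -> 0 <= e3 -> 0 <= eta -> 0 <= M ->
  `|\sum_(j < n) (- s * psi j * S j - (- s * psi j) ^+ 2 / 2 * q j)
    - (psi 0%N * x 0%N + a / c * lnD 0%N - (psi n * x n + a / c * lnD n))|
   <= m%:R * telescope_error e1 e3 eta M.
Proof.
move=> nm xM xeta xS xq e10 e30 eta0 M0.
have err0 : 0 <= telescope_error e1 e3 eta M.
  by rewrite /telescope_error !addr_ge0 ?mulr_ge0 ?exprn_ge0 ?addr_ge0// ?mulr_ge0// ?ltW.
apply: (@le_trans _ _ (n%:R * telescope_error e1 e3 eta M)); last first.
  by rewrite ler_wpM2r// ler_nat.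
elim: n nm => [|n IHn] nm.
  by rewrite big_ord0 subrr subrr normr0 mul0r.
rewrite big_ord_recr/=.
have -> : n.+1%:R * telescope_error e1 e3 eta M =
    n%:R * telescope_error e1 e3 eta M + telescope_error e1 e3 eta M.
  by rewrite -[n.+1%:R]natr1 mulrDl mul1r.
have {}IHn := IHn (ltnW nm).
set A := \sum_(j < n) _ in IHn *.
set U := psi 0%N * x 0%N + a / c * lnD 0%N in IHn *.
set Tn := (X in A + X).
suff step : `|Tn - (psi n * x n + a / c * lnD n
    - (psi n.+1 * x n.+1 + a / c * lnD n.+1))| <= telescope_error e1 e3 eta M.
  apply: le_trans (lerD IHn step); apply: le_trans (ler_normD _ _).
  by rewrite le_eqVlt; apply/orP; left; apply/eqP; congr `|_|; ring.
have r0 := time_ge0 nm.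
have psin : 0 <= psi n by apply: riccati_ge0 => //; apply: time_ge0; exact: ltnW.
have psil : psi n <= l by apply: riccati_le => //; apply: time_ge0; exact: ltnW.
have stepR := riccati_step b0 c0 l0 r0 h0.
have stepL := ln_riccati_den_step b0 c0 l0 r0 h0.
have lipR := riccati_lipschitz b0 c0 l0 r0 h0.
rewrite -timeS -/(psi n) -/(psi n.+1) -/(lnD n) -/(lnD n.+1) -/lip in stepR stepL lipR.
have ac0 : 0 <= a / c by rewrite divr_ge0// ltW.
have C0 := ltW c0; have psi20 := exprn_ge0 2 psin.
have cpsi0 := mulr_ge0 C0 psi20.
have aL : `|a * psi n * h - a / c * (lnD n - lnD n.+1)| <= a * lip * h ^+ 2.
  have -> : a * psi n * h - a / c * (lnD n - lnD n.+1) =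
      - (a / c) * (lnD n - lnD n.+1 - c * psi n * h).
    by field; rewrite gt_eqF.
  rewrite normrM normrN (ger0_norm ac0).
  have -> : a * lip * h ^+ 2 = a / c * (c * lip * h ^+ 2) by field; rewrite gt_eqF.
  exact: ler_wpM2l.
have E1 : `|- psi n * (s * S n - (x n.+1 - x n - (a - b * x n) * h))| <= l * e1.
  rewrite normrM normrN (ger0_norm psin); apply: ler_pM => //.
  by rewrite distrC; exact: xS.
have E3 : `|- (c * psi n ^+ 2) * (q n - x n * h)| <= c * l ^+ 2 * e3.
  rewrite normrM normrN (ger0_norm cpsi0).
  apply: ler_pM => //; last exact: xq.
  by apply: ler_wpM2l => //; rewrite ler_pXn2r// nnegrE.
have E2 : `|(psi n.+1 - psi n) * (x n.+1 - x n)| <= lip * h * eta.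
  by rewrite normrM; apply: ler_pM => //; [rewrite distrC|exact: xeta].
have E4 : `|(psi n.+1 - psi n - (b * psi n + c * psi n ^+ 2) * h) * x n| <=
    (b + 2 * c * l) * lip * h ^+ 2 * M.
  have /andP[xn0 xnM] := xM n nm.
  by rewrite normrM; apply: ler_pM => //; rewrite ger0_norm.
have -> : Tn - (psi n * x n + a / c * lnD n - (psi n.+1 * x n.+1 + a / c * lnD n.+1))
  = (- psi n * (s * S n - (x n.+1 - x n - (a - b * x n) * h)))
  + (- (c * psi n ^+ 2) * (q n - x n * h))
  + ((psi n.+1 - psi n) * (x n.+1 - x n))
  + ((psi n.+1 - psi n - (b * psi n + c * psi n ^+ 2) * h) * x n)
  + (a * psi n * h - a / c * (lnD n - lnD n.+1)).
  by rewrite /Tn /c; field; rewrite gt_eqF.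
by do 4 (apply: le_trans (ler_normD _ _) _; apply: lerD => //).
Qed.

End riccati_telescope.

Lemma simple_integral0 (d : measure_display) (T : measurableType d)
    (R : realType) (P : probability T R) (W : R -> {RV P >-> R})
    (K : simple_process (augmented_filtration W)) w :
  simple_integral W K 0 w = 0.
Proof.
rewrite /simple_integral big1// => i _.
have s0 j : 0 <= sp_time K j.
  exact: le_trans (sp_time_ge0 K) (sp_time_nd K (leq0n j)).
by rewrite !min_r// subrr mulr0.
Qed.

(** * Discretization of the stochastic equation *)

Section discretization.
Context {d : measure_display} {T : measurableType d} {R : realType}.
Variables (P : probability T R) (W X : R -> {RV P >-> R}).
Variables (x0 a b sigma : R).
Hypotheses (b0 : 0 <= b) (sigma0 : 0 < sigma).
Hypothesis hX : cir_process W x0 a b sigma X.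
Local Notation F := (augmented_filtration W).

(** The order of quantifiers is essential: [M] and [h0] depend on [delta] and [eta] through path
    regularity, while [e] and then [K] are chosen after the mesh. So errors [e] summed over the
    cells can still be made small, and errors in [eta * h] sum to a multiple of [t]. *)
Lemma cir_discretization (t delta eta : R) :
  0 < t -> 0 < delta -> 0 < eta ->
  exists (M h0 : R), [/\ 0 <= M, 0 < h0 & forall m : nat, (0 < m)%N ->
    t / m%:R < h0 -> forall e : R, 0 < e ->
    exists (K : simple_process F) (Bad : set T), [/\ measurable Bad,
      (P Bad <= delta%:E)%E & forall w, ~ Bad w ->
      let h := t / m%:R in let x j := X (j%:R * h) w in
      [/\ forall j, (j <= m)%N -> 0 <= x j <= M,
          `|x 0%N - x0| <= e,
          forall j, (j < m)%N -> `|x j.+1 - x j| <= eta,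
          forall j, (j < m)%N -> `|x j.+1 - x j - (a - b * x j) * h - sigma *
            (simple_integral W K (j.+1%:R * h) w -
             simple_integral W K (j%:R * h) w)| <= b * eta * h + e &
          forall j, (j < m)%N ->
            `|simple_qv K (j%:R * h) (j.+1%:R * h) w - x j * h|
              <= eta * h + e]]].
Proof.
move=> t0 delta0 eta0.
case: hX => adX cX nnX [I [[adH H2 cI [K cvgK]] eqX]].
have d20 : 0 < delta / 2 by rewrite divr_gt0.
have d40 : 0 < delta / 4 by rewrite divr_gt0.
have [k [B2 [mB2 PB2 regX]]] := path_regularity cX t0 d20 eta0.
have : {ae P, forall w, (({within `[0, +oo[, continuous (fun u => X u w)} /\
    (forall u, 0 <= u -> 0 <= X u w)) /\
    (forall u, 0 <= u -> measurable_fun (`[0, u]%classic : set R)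
      (fun s => Num.sqrt (X s w)))) /\
    (forall u, 0 <= u -> X u w = x0 +
      \int[lebesgue_measure]_(s in `[0, u]) (a - b * X s w) + sigma * I u w)}.
  apply: filterS2 eqX => [w h e|]; first by split; [exact: h|exact: e].
  apply: filterS2 H2 => [w h e|]; first by split; [exact: h|move=> u /e[]].
  by apply: filterS2 nnX => [w h e|]; [split; [exact: h|exact: e]|exact: cX].
move=> [N [mN N0 regN]].
exists k%:R, k.+1%:R^-1; split => // m m0 hk e e0.
set h := t / m%:R in hk *.
have mR0 : 0 < m%:R :> R by rewrite ltr0n.
have h0 : 0 < h by rewrite divr_gt0.
have u_le j : (j <= m)%N -> j%:R * h <= t.
  move=> jm; have -> : t = m%:R * h by rewrite /h mulrCA divff ?mulr1// gt_eqF.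
  by rewrite ler_wpM2r ?(ltW h0)// ler_nat.
have u_ge0 j : 0 <= j%:R * h by rewrite mulr_ge0// ltW.
have uS j : j.+1%:R * h = j%:R * h + h by rewrite -natr1 mulrDl mul1r.
pose M : R := k%:R; have M0 : 0 <= M by [].
(* [r] and [e1] make [r * M * h] and [(1 + r^-1) * e1], the two approximation errors of
   [ge0_integral_sqr_near], at most [e / 2] each. *)
pose r := e / 2 / (M * h + 1).
have Mh0 : 0 <= M * h by rewrite mulr_ge0// ltW.
have Mh1 : 0 < M * h + 1 by rewrite ltr_wpDl.
have r0 : 0 < r by rewrite !divr_gt0.
have rM : r * M * h <= e / 2.
  rewrite -mulrA /r mulrAC ler_pdivrMr// ler_wpM2l ?divr_ge0 ?ltW//.
  by rewrite ltrDl.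
have ri0 : 0 < 1 + r^-1 by rewrite ltr_wpDr// invr_ge0 ltW.
pose e1 := e / 2 / (1 + r^-1).
have e10 : 0 < e1 by rewrite !divr_gt0.
have e1E : (1 + r^-1) * e1 = e / 2 by rewrite /e1 mulrC divfK// gt_eqF.
pose e2 := e / (2 * sigma).
have e20 : 0 < e2 by rewrite divr_gt0// mulr_gt0.
have e2E : sigma * e2 = e / 2 by rewrite /e2; field; rewrite gt_eqF.
have near_I : \forall n \near \oo, covered_by P (delta / 4)
    (\bigcup_(j < m.+1) [set w | (e2%:E <=
      `|simple_integral W (K n) (j%:R * h) w - I (j%:R * h) w|%:E)%E]).
  apply: (near_covered_bigcup (A := fun j n => [set w | (e2%:E <=
      `|simple_integral W (K n) (j%:R * h) w - I (j%:R * h) w|%:E)%E])) => //.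
  move=> j c _ c0; apply: cvg0_in_probability_covered => //.
  by have [] := cvgK (j%:R * h) (u_ge0 j).
have near_H : \forall n \near \oo, covered_by P (delta / 4)
    [set w | (e1%:E <= \int[lebesgue_measure]_(s in `[0%R, t])
      ((simple_fun (K n) s w - Num.sqrt (X s w)) ^+ 2)%:E)%E].
  apply: (cvg0_in_probability_covered (Z := fun n w =>
    (\int[lebesgue_measure]_(s in `[0%R, t])
      ((simple_fun (K n) s w - Num.sqrt (X s w)) ^+ 2)%:E)%E)) => //.
  by have [] := cvgK t (ltW t0).
have [n [[B3 [mB3 PB3 BI]] [B4 [mB4 PB4 BH]]]] := filter_ex (filterI near_I near_H).
exists (K n), (B2 `|` B3 `|` (B4 `|` N)); split.
- by do 3 (apply: measurableU => //).
- have m23 := measurableU _ _ mB2 mB3; have m4N := measurableU _ _ mB4 mN.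
  apply: le_trans (measureU2 _ m23 m4N) _.
  have -> : delta%:E = ((delta / 2 + delta / 4)%:E + (delta / 4 + 0)%:E)%E :> \bar R.
    by rewrite -EFinD; congr EFin; field.
  apply: leeD; rewrite EFinD.
    by apply: le_trans (measureU2 _ mB2 mB3) _; exact: leeD.
  by apply: le_trans (measureU2 _ mB4 mN) _; apply: leeD => //; rewrite [X in (X <= _)%E]N0.
move=> w /not_orP[/not_orP[B2w B3w] /not_orP[B4w Nw]] /=.
have [[[cXw Xw0] mHw] Xw] : (({within `[0, +oo[, continuous (fun u => X u w)} /\
    (forall u, 0 <= u -> 0 <= X u w)) /\
    (forall u, 0 <= u -> measurable_fun (`[0, u]%classic : set R)
      (fun s => Num.sqrt (X s w)))) /\
    (forall u, 0 <= u -> X u w = x0 +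
      \int[lebesgue_measure]_(s in `[0, u]) (a - b * X s w) + sigma * I u w).
  by apply: contrapT => nw; apply: Nw; apply: regN.
have [Xk Xeta] := regX w B2w.
have SI j : (j <= m)%N ->
    `|simple_integral W (K n) (j%:R * h) w - I (j%:R * h) w| < e2.
  move=> jm; rewrite ltNge; apply/negP => ej; apply: B3w; apply: BI.
  by exists j => //=; rewrite lee_fin.
have SH : (\int[lebesgue_measure]_(s in `[0%R, t])
      ((simple_fun (K n) s w - Num.sqrt (X s w)) ^+ 2)%:E <= e1%:E)%E.
  by apply: ltW; rewrite ltNge; apply/negP => ej; apply: B4w; exact: BH.
have cXt : {within `[0, t], continuous (fun u => X u w)}.
  by apply: continuous_subspaceW cXw => u /=; rewrite !in_itv/= => /andP[->].
have Xnear j s : (j < m)%N -> j%:R * h < s <= j.+1%:R * h ->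
    `|X s w - X (j%:R * h) w| <= eta.
  rewrite uS => jm /andP[us su]; have um := u_le _ jm; rewrite uS in um.
  apply: Xeta.
  - by rewrite (le_trans (u_ge0 j) (ltW us)) (le_trans su um).
  - by rewrite u_ge0 u_le// ltnW.
  - by rewrite ger0_norm ?subr_ge0 1?ltW// (le_lt_trans _ hk)// lerBlDl.
split.
- move=> j jm; have uj0 := u_ge0 j; have ujt := u_le j jm.
  rewrite Xw0//= (le_trans (ler_norm _))//.
  by apply: Xk; rewrite uj0.
(* [I 0] is not assumed to be 0: it is compared with the simple integral, which vanishes at time 0.
   Hence an initial value that is only within [e] of [x0]. *)
- rewrite mul0r Xw// set_itv1 Rintegral_set1 addr0 addrAC subrr add0r.
  have := SI 0%N (leq0n m); rewrite mul0r simple_integral0 sub0r normrN => I0.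
  rewrite normrM gtr0_norm// (le_trans (ler_wpM2l (ltW sigma0) (ltW I0)))// e2E.
  by rewrite ler_pdivrMr// ler_pMr// ler1n.
- by move=> j jm; apply: Xnear => //; rewrite uS lexx andbT ltrDl.
- move=> j jm; have SIj := SI j (ltnW jm); have SIj1 := SI j.+1 jm.
  have drift := @Rintegral_increment_near R (fun s => a - b * X s w) t
    (j%:R * h) (j.+1%:R * h) (a - b * X (j%:R * h) w) (b * eta).
  have {}drift : `|\int[lebesgue_measure]_(s in `[0, j.+1%:R * h]) (a - b * X s w)
      - \int[lebesgue_measure]_(s in `[0, j%:R * h]) (a - b * X s w)
      - (a - b * X (j%:R * h) w) * h| <= b * eta * h.
    have -> : (a - b * X (j%:R * h) w) * h =
      (a - b * X (j%:R * h) w) * (j.+1%:R * h - j%:R * h) by rewrite uS; ring.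
    have -> : b * eta * h = b * eta * (j.+1%:R * h - j%:R * h) by rewrite uS; ring.
    apply: drift => //.
    + move=> u; apply: cvgB; first exact: cvg_cst.
      by apply: cvgM; [exact: cvg_cst|exact: cXt].
    + by rewrite uS lerDl ltW.
    + exact: u_le.
    + move=> s sj; have -> : a - b * X s w - (a - b * X (j%:R * h) w) =
        - (b * (X s w - X (j%:R * h) w)) by ring.
      by rewrite normrN normrM (ger0_norm b0) ler_wpM2l// Xnear.
  rewrite (Xw _ (u_ge0 j.+1)) [X in _ - X - _ - _](Xw _ (u_ge0 j)).
  move: drift SIj SIj1; set D1 := (X in `|X - _| <= _).
  set D2 := \int[_]_(s in _) _; set D3 := \int[_]_(s in _) _.
  set S1 := simple_integral _ _ _ _; set S2 := simple_integral _ _ _ _.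
  set I1 := I _ w; set I2 := I _ w.
  rewrite /D1 => drift SIj SIj1.
  have -> : x0 + D2 + sigma * I2 - (x0 + D3 + sigma * I1) - (a - b * X (j%:R * h) w) * h
    - sigma * (S2 - S1) = (D2 - D3 - (a - b * X (j%:R * h) w) * h)
     + sigma * ((S1 - I1) - (S2 - I2)) by ring.
  apply: le_trans (ler_normD _ _) _; apply: lerD => //.
  rewrite normrM (gtr0_norm sigma0) (splitr e) -e2E -mulrDr ler_wpM2l ?(ltW sigma0)//.
  by apply: le_trans (ler_normB _ _) _; apply: lerD; exact: ltW.
- move=> j jm; have uj1 : j%:R * h <= j.+1%:R * h by rewrite uS lerDl ltW.
  have sub0t : `]j%:R * h, j.+1%:R * h]%classic `<=` (`[0, t]%classic : set R).
    move=> s /=; rewrite !in_itv/= => /andP[us su].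
    by rewrite (le_trans (u_ge0 j) (ltW us)) (le_trans su (u_le _ jm)).
  have mH := mHw t (ltW t0).
  have mF : measurable_fun `[0, t]%classic (fun s => simple_fun (K n) s w).
    by apply: measurable_funTS; exact: measurable_simple_fun.
  have s0 s : j%:R * h < s <= j.+1%:R * h -> 0 <= s <= t.
    by move=> sj; have := @sub0t s; rewrite /= !in_itv/=; apply.
  have := @ge0_integral_sqr_near R (fun s => simple_fun (K n) s w)
    (fun s => Num.sqrt (X s w)) (j%:R * h) (j.+1%:R * h) (X (j%:R * h) w) M eta r e1
    (simple_qv (K n) (j%:R * h) (j.+1%:R * h) w) uj1 r0 M0 (ltW eta0) (Xw0 _ (u_ge0 j)).
  have -> : j.+1%:R * h - j%:R * h = h by rewrite uS; ring.
  move=> near_qv; apply: (@le_trans _ _ ((r * M + eta) * h + (1 + r^-1) * e1)).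
    apply: near_qv.
    + exact: measurable_funS mF.
    + exact: measurable_funS mH.
    + move=> s /s0 st; have /andP[s_ge0 _] := st.
      by rewrite sqr_sqrtr ?Xw0// (le_trans (ler_norm _))// Xk.
    + move=> s sj; have /andP[s_ge0 _] := s0 s sj.
      by rewrite sqr_sqrtr ?Xw0// Xnear.
    + exact: integral_simple_fun_sqr.
    + apply: le_trans SH; apply: ge0_subset_integral => //.
      * apply/measurable_EFinP; apply: measurable_funX.
        exact: measurable_funB.
      * by move=> s _; rewrite lee_fin sqr_ge0.
  by rewrite e1E mulrDl; lra.
Qed.

End discretization.

(** * The Laplace transform of the CIR process *)

Lemma small_multiplier (R : realFieldType) (A e : R) : 0 <= A -> 0 < e ->
  exists y, [/\ 0 < y, y <= 1 & A * y <= e].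
Proof.
move=> A0 e0; have A1 : 0 < A + 1 by rewrite ltr_wpDl.
exists (Num.min 1 (e / (A + 1))); split.
- by rewrite lt_min ltr01 divr_gt0.
- by rewrite ge_min lexx.
apply: (@le_trans _ _ (A * (e / (A + 1)))).
  by apply: ler_wpM2l => //; rewrite ge_min lexx orbT.
by rewrite mulrCA ger_pMr// ler_pdivrMr// mul1r lerDl.
Qed.

Section integral_combination.
Context {d : measure_display} {T : measurableType d} {R : realType}.
Variable P : probability T R.

Lemma ge0_integral_combination (f g : T -> R) (A B : set T) (p q r s : R) :
  0 <= p -> 0 <= q -> 0 <= r -> 0 <= s -> measurable A -> measurable B ->
  measurable_fun setT f -> measurable_fun setT g ->
  (forall w, 0 <= f w) -> (forall w, 0 <= g w) ->
  (\int[P]_w (p * f w + q * g w + r * \1_A w + s * \1_B w)%:E =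
   p%:E * \int[P]_w (f w)%:E + q%:E * \int[P]_w (g w)%:E
   + r%:E * P A + s%:E * P B)%E.
Proof.
move=> p0 q0 r0 s0 mA mB mf mg f0 g0.
have mZ (k : R) (h : T -> R) : measurable_fun setT h ->
    measurable_fun setT (fun w => (k * h w)%:E).
  by move=> mh; apply/measurable_EFinP; exact: measurable_funM.
have IZ (k : R) (h : T -> R) : 0 <= k -> measurable_fun setT h ->
    (forall w, 0 <= h w) ->
    (\int[P]_w (k * h w)%:E = k%:E * \int[P]_w (h w)%:E)%E.
  move=> k0 mh h0; under eq_integral do rewrite EFinM.
  rewrite ge0_integralZl//; first exact/measurable_EFinP.
  by move=> w _; rewrite lee_fin.
have m1 (S : set T) : measurable S -> measurable_fun setT (\1_S : T -> R).
  by move=> mS.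
have i0 (S : set T) w : 0 <= \1_S w :> R by [].
have ID (h k : T -> R) : measurable_fun setT (fun w => (h w)%:E) ->
    measurable_fun setT (fun w => (k w)%:E) ->
    (forall w, 0 <= h w) -> (forall w, 0 <= k w) ->
    (\int[P]_w (h w + k w)%:E = \int[P]_w (h w)%:E + \int[P]_w (k w)%:E)%E.
  move=> mh mk h0 k0; under eq_integral do rewrite EFinD.
  by rewrite ge0_integralD// => w _; rewrite lee_fin.
have mD (h k : T -> R) : measurable_fun setT (fun w => (h w)%:E) ->
    measurable_fun setT (fun w => (k w)%:E) ->
    measurable_fun setT (fun w => (h w + k w)%:E).
  by move=> /measurable_EFinP mh /measurable_EFinP mk;
    apply/measurable_EFinP; exact: measurable_funD.
have mf' := mZ p f mf; have mg' := mZ q g mg.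
have mA' := mZ r _ (m1 A mA); have mB' := mZ s _ (m1 B mB).
have f0' w := mulr_ge0 p0 (f0 w); have g0' w := mulr_ge0 q0 (g0 w).
have A0' w := mulr_ge0 r0 (i0 A w); have B0' w := mulr_ge0 s0 (i0 B w).
have fg0 w := addr_ge0 (f0' w) (g0' w); have fgA0 w := addr_ge0 (fg0 w) (A0' w).
rewrite (ID (fun w => p * f w + q * g w + r * \1_A w))//; last first.
  exact: (mD _ _ (mD _ _ mf' mg') mA').
rewrite (ID (fun w => p * f w + q * g w))//; last exact: (mD _ _ mf' mg').
rewrite (ID (fun w => p * f w))// !IZ//.
by rewrite !integral_indic// !setIT.
Qed.

End integral_combination.

Section laplace_transform.
Context {d : measure_display} {T : measurableType d} {R : realType}.
Variables (P : probability T R) (W X : R -> {RV P >-> R}).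
Variables (x0 a b sigma t l : R).
Hypotheses (a0 : 0 <= a) (b0 : 0 <= b) (sigma0 : 0 < sigma).
Hypotheses (t0 : 0 < t) (l0 : 0 <= l).
Hypothesis hW : wiener_process W.
Hypothesis hX : cir_process W x0 a b sigma X.
Local Notation F := (augmented_filtration W).

Let c := sigma ^+ 2 / 2.
Let c0 : 0 < c. Proof. by rewrite divr_gt0// exprn_gt0. Qed.
(** Minus the logarithm of the target, so that the claim becomes that [Z] has expectation 1. The
    absolute value in [Z] gives [Z w <= expR L] at every point, X being nonnegative only almost
    surely. *)
Let L := riccati b c l t * x0 + a / c * ln (riccati_den b c l t).
Let Z w := expR (L - l * `|X t w|).

Let Z0 w : 0 <= Z w. Proof. exact: expR_ge0. Qed.

Let ZL w : Z w <= expR L.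
Proof. by rewrite ler_expR gerBl mulr_ge0. Qed.

Let mZ : measurable_fun setT Z.
Proof.
apply: measurableT_comp => //; apply: measurable_funB => //.
by apply: measurable_funM => //; exact: measurableT_comp.
Qed.

(* B1 is the event that the path is large, B2 a much smaller exceptional event
   on which only the second moment of V is controlled. *)
Lemma exp_mart_comparison (e : R) : 0 < e -> e <= 1 ->
  exists (V : T -> R) (B1 B2 : set T) (C : R),
  [/\ (measurable_fun setT V /\ (forall w, 0 <= V w)),
      (measurable B1 /\ (P B1 <= (e * expR (- (L + 1)))%:E)%E),
      (measurable B2 /\ (P B2 <= (Num.min (e * expR (- L))
                                    (e * (e * expR (- C))))%:E)%E),
      ((\int[P]_w (V w)%:E = 1)%E /\
       (\int[P]_w (V w ^+ 2)%:E <= (expR C)%:E)%E) &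
      forall w, ~ B2 w ->
        V w <= expR (L + e) /\
        (~ B1 w -> V w <= expR e * Z w /\ Z w <= expR e * V w)].
Proof.
move=> e0 e1.
have [adX cX _ _] := hX.
have del1 : 0 < e * expR (- (L + 1)) by rewrite mulr_gt0 ?expR_gt0.
have [k [B1 [mB1 PB1 regX]]] := path_regularity cX t0 del1 ltr01.
(* Bound on the quadratic variation, anticipating that X is at most [k] on active cells and that the
   later choices satisfy eta <= 1 and m z <= 1. *)
pose C := sigma ^+ 2 * l ^+ 2 * (k%:R * t + t + 1).
have s2l2 : 0 <= sigma ^+ 2 * l ^+ 2 by rewrite mulr_ge0 ?exprn_ge0// ltW.
have C_ge0 : 0 <= C by rewrite mulr_ge0// !addr_ge0// ?mulr_ge0// ltW.
(* The first bound serves for [Z], which is at most exp(L); the second makes [P B2] small against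
   the second moment exp(C) of [V]. *)
pose del2 := Num.min (e * expR (- L)) (e * (e * expR (- C))).
have del20 : 0 < del2 by rewrite lt_min !mulr_gt0 ?expR_gt0.
have cge := ltW c0; have tge := ltW t0.
have l2 : 0 <= l ^+ 2 by rewrite exprn_ge0.
have cl2 : 0 <= c * l ^+ 2 by rewrite mulr_ge0.
have bl0 : 0 <= b * l by rewrite mulr_ge0.
pose lip := b * l + c * l ^+ 2.
have lip0 : 0 <= lip by rewrite addr_ge0.
have e4 : 0 < e / 4 by rewrite divr_gt0.
(* With m h = t, the total telescoping error has parts linear in eta, in h and in z. Each is brought
   below [e / 4], by choosing eta, then [y] as a bound on h, then [z]. *)
have [|eta [eta0 eta1 etaE]] := small_multiplier (A := l * (b * t) + c * l ^+ 2 * t + lip * t) _ e4.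
  have bt0 := mulr_ge0 b0 tge; have lt0 := mulr_ge0 lip0 tge.
  by apply: addr_ge0 => //; apply: addr_ge0; exact: mulr_ge0.
have [M [h0 [M0 h00 disc]]] := cir_discretization b0 sigma0 hX t0 del20 eta0.
pose K0 := (b + 2 * c * l) * lip.
have cl0 : 0 <= 2 * c * l by rewrite -mulrA; do 2 apply: mulr_ge0 => //.
have K00 : 0 <= K0 by apply: mulr_ge0 => //; exact: addr_ge0.
have [|y [y0 _ yE]] := small_multiplier (A := (K0 * M + a * lip) * t) _ e4.
  by apply: mulr_ge0 => //; apply: addr_ge0; exact: mulr_ge0.
have my : 0 < Num.min h0 y by rewrite lt_min h00.
pose m := (Num.trunc (t / Num.min h0 y)).+1.
have m0 : (0 < m)%N by [].
have hm : t / m%:R < Num.min h0 y.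
  by rewrite ltr_pdivrMr// mulrC -ltr_pdivrMr// truncnS_gt.
have [hh0 hy] : t / m%:R < h0 /\ t / m%:R < y by apply/andP; rewrite -lt_min.
(* [z] is an error per cell and so is chosen after [m]. The summand [l] accounts for the initial
   value, and the last [m] for m z <= 1 in the bound by [C]. *)
have [|z [z0 z1 zE]] := small_multiplier (A := (l + c * l ^+ 2) * m%:R + l + m%:R) _ e4.
  by do 2 (apply: addr_ge0 => //); apply: mulr_ge0 => //; exact: addr_ge0.
have [K [B2 [mB2 PB2 regK]]] := disc m m0 hh0 z z0.
set h := t / m%:R in hm hh0 hy regK.
have hgt0 : 0 < h by rewrite divr_gt0.
have hge0 := ltW hgt0.
have tmh : t = m%:R * h by rewrite /h mulrCA divff ?mulr1// gt_eqF.
pose psi j := riccati b c l (t - j%:R * h).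
pose lnD j := ln (riccati_den b c l (t - j%:R * h)).
(* All grid points up to [j] are tested, so [act j] is known at time [j%:R * h] and, once false,
   stays false. *)
pose act j w := all (fun i : nat => X (i%:R * h) w <= k%:R) (iota 0 j.+1).
pose cf j w := if act j w then - sigma * psi j else 0.
have u_ge0 j : 0 <= j%:R * h by rewrite mulr_ge0.
have mcf j : measurable_wrt (F (j%:R * h)) (cf j).
  apply/measurable_wrtP; apply: measurable_fun_if => //.
  have mact s : (forall i, i \in s -> (i <= j)%N) -> measurable_fun setT
     ((fun w => all (fun i : nat => X (i%:R * h) w <= k%:R) s) :
        g_sigma_algebraType (F (j%:R * h)) -> bool).
    elim: s => [//|i s IHs] sj /=.
    apply: measurable_and.
      apply: measurable_fun_ler => //; apply/measurable_wrtP.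
      have ij : (i <= j)%N by apply: sj; rewrite inE eqxx.
      apply: measurable_wrt_mono (adX _ (u_ge0 i)).
      by apply: ler_wpM2r => //; rewrite ler_nat.
    by apply: IHs => i' i's; apply: sj; rewrite inE i's orbT.
  by apply: mact => i; rewrite mem_iota add0n ltnS.
have [V [mV V0 V1 V2 VE]] := simple_exp_mart K hW m hge0 C_ge0 mcf.
exists V, B1, B2, C; split => //.
move=> w B2w; have [xM x00 xeta xS xq] := regK w B2w.
pose x j := X (j%:R * h) w.
have time_ge0 j : (j <= m)%N -> 0 <= t - j%:R * h.
  by move=> jm; rewrite [in X in X - _]tmh -mulrBl mulr_ge0// subr_ge0 ler_nat.
have psi0 j : (j <= m)%N -> 0 <= psi j by move=> jm; apply: riccati_ge0 => //; exact: time_ge0.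
have psil j : (j <= m)%N -> psi j <= l by move=> jm; apply: riccati_le => //; exact: time_ge0.
have lnD0 j : (j <= m)%N -> 0 <= lnD j.
  by move=> jm; apply: ln_ge0; apply: riccati_den_ge1 => //; exact: time_ge0.
have actS j : act j.+1 w -> act j w.
  by rewrite /act -[j.+2]addn1 iotaD all_cat => /andP[].
have [n nm actn] := monotone_bool_threshold (p := fun j => act j w) m actS.
have q_small : \sum_(j < m) cf j w ^+ 2 * simple_qv K (j%:R * h) (j.+1%:R * h) w <= C.
  apply: (@le_trans _ _ (\sum_(j < m) (sigma ^+ 2 * l ^+ 2 * (k%:R * h + eta * h + z)))).
    apply: ler_sum => j _; rewrite /cf; case: ifPn => [jact|_]; last first.
      rewrite expr0n mul0r mulr_ge0// !addr_ge0 ?mulr_ge0//; exact: ltW.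
    have jm := ltn_ord j; have := xq j jm; rewrite ler_norml => /andP[_ qj].
    have xk : x j <= k%:R by move/allP: jact; apply; rewrite mem_iota/= add0n ltnS.
    have xkh : x j * h <= k%:R * h by rewrite ler_wpM2r.
    rewrite exprMn sqrrN.
    apply: (@le_trans _ _ (sigma ^+ 2 * psi j ^+ 2 * (k%:R * h + eta * h + z))).
      apply: ler_wpM2l; first by rewrite mulr_ge0 ?sqr_ge0.
      move: qj; rewrite -/(x j); lra.
    apply: ler_wpM2r; first by rewrite !addr_ge0 ?mulr_ge0// ltW.
    apply: ler_wpM2l; first by rewrite sqr_ge0.
    by rewrite ler_pXn2r ?nnegrE ?psi0 ?psil// ltnW.
  rewrite sumr_const card_ord -[X in X <= _]mulr_natl mulrCA /C.
  apply: ler_wpM2l => //.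
  have -> : m%:R * (k%:R * h + eta * h + z) = k%:R * t + eta * t + m%:R * z.
    by rewrite [in RHS]tmh; ring.
  have eta_t : eta * t <= t by rewrite ger_pMl.
  have mz : m%:R * z <= 1.
    have : 0 <= ((l + c * l ^+ 2) * m%:R + l) * z.
      by rewrite mulr_ge0 ?(ltW z0)// addr_ge0// mulr_ge0// addr_ge0.
    by move: zE; rewrite mulrDl; lra.
  lra.
have VwE := VE w q_small.
have tel := riccati_telescope a0 b0 sigma0 l0 hge0 tmh
  (x := x) (S := fun j => simple_integral W K (j.+1%:R * h) w - simple_integral W K (j%:R * h) w)
  (q := fun j => simple_qv K (j%:R * h) (j.+1%:R * h) w)
  (e1 := b * eta * h + z) (e3 := eta * h + z) (eta := eta) (M := M) nm
  (fun j jm => xM j (ltnW jm)) xeta xS xq.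
have sumE : \sum_(j < m) (cf j w *
        (simple_integral W K (j.+1%:R * h) w - simple_integral W K (j%:R * h) w)
         - cf j w ^+ 2 / 2 * simple_qv K (j%:R * h) (j.+1%:R * h) w) =
    \sum_(j < n) (- sigma * psi j * (simple_integral W K (j.+1%:R * h) w -
         simple_integral W K (j%:R * h) w)
      - (- sigma * psi j) ^+ 2 / 2 * simple_qv K (j%:R * h) (j.+1%:R * h) w).
  pose f j := cf j w *
        (simple_integral W K (j.+1%:R * h) w - simple_integral W K (j%:R * h) w)
         - cf j w ^+ 2 / 2 * simple_qv K (j%:R * h) (j.+1%:R * h) w.
  rewrite -(big_mkord xpredT f) (big_cat_nat (n := n))//= [X in _ + X]big1_seq ?addr0.
    rewrite big_mkord; apply: eq_bigr => j _.
    by rewrite /f /cf actn ?ltn_ord// (leq_trans (ltn_ord j)).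
  move=> j; rewrite mem_index_iota => /andP[_ /andP[nj jm]].
  by rewrite /f /cf actn// ltnNge nj/= expr0n !mul0r subrr.
(* Nonnegativity of [U] at the stopping index is what bounds [V] by exp(L + e), also on [B1]. *)
pose U := psi n * x n + a / c * lnD n.
have U0 : 0 <= U.
  have /andP[xn0 _] := xM n nm.
  by rewrite addr_ge0// mulr_ge0 ?psi0 ?lnD0// divr_ge0.
pose LV := \sum_(j < n) (- sigma * psi j * (simple_integral W K (j.+1%:R * h) w -
         simple_integral W K (j%:R * h) w)
      - (- sigma * psi j) ^+ 2 / 2 * simple_qv K (j%:R * h) (j.+1%:R * h) w).
have near_LV : `|LV - (L - U)| <= e.
  have eh0 := mulr_ge0 (ltW eta0) hge0; have beh0 := mulr_ge0 b0 eh0.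
  have E1 : 0 <= b * eta * h + z.
    by rewrite -mulrA; apply: addr_ge0 => //; exact: ltW.
  have E3 : 0 <= eta * h + z by apply: addr_ge0 => //; exact: ltW.
  have {}tel : `|LV - (psi 0%N * x 0%N + a / c * lnD 0%N - U)| <= m%:R *
      telescope_error a b sigma l h (b * eta * h + z) (eta * h + z) eta M.
    exact: tel E1 E3 (ltW eta0) M0.
  have psi0E : psi 0%N = riccati b c l t by rewrite /psi mul0r subr0.
  have lnD0E : lnD 0%N = ln (riccati_den b c l t) by rewrite /lnD mul0r subr0.
  have x0near : `|psi 0%N * x 0%N - riccati b c l t * x0| <= l * z.
    rewrite -psi0E -mulrBr normrM (ger0_norm (psi0 0%N (leq0n m))).
    by apply: ler_pM => //; [exact: psi0|exact: psil].
  have zle : ((l + c * l ^+ 2) * m%:R) * z + l * z <= e / 4.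
    have : 0 <= m%:R * z by rewrite mulr_ge0// ltW.
    by move: zE; rewrite !mulrDl; lra.
  have hle : (K0 * M + a * lip) * t * h <= e / 4.
    apply: le_trans yE; apply: ler_wpM2l; last exact: ltW.
    by apply: mulr_ge0 => //; apply: addr_ge0; exact: mulr_ge0.
  have errE : m%:R * telescope_error a b sigma l h (b * eta * h + z) (eta * h + z) eta M =
      (l * (b * t) + c * l ^+ 2 * t + lip * t) * eta + (l + c * l ^+ 2) * m%:R * z
      + (K0 * M + a * lip) * t * h.
    by rewrite /telescope_error -/c -/lip -/K0 [in RHS]tmh; ring.
  rewrite errE psi0E lnD0E in tel; rewrite psi0E in x0near.
  rewrite /L; move: tel x0near zle hle etaE; rewrite !ler_norml.
  clear -e0; move=> /andP[? ?] /andP[? ?] ? ? ?; apply/andP; split; lra.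
have {}VwE : V w = expR LV by rewrite VwE sumE.
move: near_LV; rewrite ler_norml => /andP[LV1 LV2].
split; first by rewrite VwE ler_expR; lra.
move=> B1w.
(* Off [B1] the path stays below [k] and the integrand is never switched off. At the final time psi
   = l and D = 1, so that [U] is l X_t. *)
have nm_eq : n = m.
  apply/eqP; rewrite eqn_leq nm/= leqNgt; apply/negP => ltnm.
  have := actn n ltnm; rewrite ltnn => /negP; apply; apply/allP => i.
  rewrite mem_iota/= add0n ltnS => i_n; apply: le_trans (ler_norm _) _.
  have [Xk _] := regX w B1w; apply: Xk; rewrite u_ge0/= [leRHS]tmh.
  by apply: ler_wpM2r => //; rewrite ler_nat (leq_trans i_n nm).
have UE : U = l * `|X t w|.
  rewrite /U /psi /lnD nm_eq {1 2}tmh subrr riccati0 riccati_den0 ln1 mulr0 addr0.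
  have /andP[xm0 _] := xM m (leqnn m).
  by rewrite /x -tmh ger0_norm// tmh.
by split; rewrite VwE /Z -expRD ler_expR; lra.
Qed.

(** Integrating the comparison of [Z] and [V] in both directions shows that E Z is 1 up to errors
    vanishing with e. On the two exceptional events [Z] is at most exp(L); [V] is at most exp(L + 1)
    on [B1] outside [B2], and its second moment handles [B2]. *)
Lemma cir_laplace_transform :
  (\int[P]_w (expR (- l * `|X t w|))%:E = (expR (- L))%:E)%E.
Proof.
have mZE : measurable_fun setT (fun w => (Z w)%:E) by exact/measurable_EFinP.
suff EZ : (\int[P]_w (Z w)%:E = 1)%E.
  rewrite -[RHS]mule1 -EZ -ge0_integralZl//; last first.
    by move=> w _; rewrite lee_fin.
  by apply: eq_integral => w _; rewrite -EFinM /Z -expRD; congr (expR _)%:E; ring.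
have Zfin : (\int[P]_w (Z w)%:E)%E \is a fin_num.
  rewrite ge0_fin_numE; last by apply: integral_ge0 => w _; rewrite lee_fin.
  apply: (@le_lt_trans _ _ (\int[P]_w (expR L)%:E)%E); last first.
    by rewrite integral_cst//= [X in (_ * X)%E]probability_setT mule1 ltry.
  by apply: ge0_le_integral => // w _; rewrite lee_fin.
pose z := fine (\int[P]_w (Z w)%:E)%E.
have zE : (\int[P]_w (Z w)%:E)%E = z%:E by rewrite fineK.
have z0 : 0 <= z by apply: fine_ge0; apply: integral_ge0 => w _; rewrite lee_fin.
suff bounds (e : R) : 0 < e -> e <= 1 ->
    z <= expR e + 2 * e /\ 1 <= expR e * z + 2 * e.
  rewrite zE; congr EFin; apply/eqP; rewrite eq_le; apply/andP.
  have exp_le (e : R) : 0 < e -> e <= 1 / 2 -> expR e <= 1 + 2 * e.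
    move=> e0 e2; have := expR_ge1Dx (- e).
    rewrite expRN => h; have E0 := expR_gt0 e.
    rewrite -(ler_pV2 _ _) ?inE ?unitfE ?gt_eqF//=; last 2 first.
    - by rewrite addr_gt0// mulr_gt0.
    - by rewrite addr_gt0// mulr_gt0.
    apply: le_trans h; rewrite -div1r ler_pdivrMr; last by rewrite addr_gt0// mulr_gt0.
    by nra.
  split; apply/ler_addgt0Pr => y y0.
    pose e := Num.min (1 / 2) (y / 4).
    have e0 : 0 < e by rewrite lt_min !divr_gt0.
    have e2 : e <= 1 / 2 by rewrite ge_min lexx.
    have ey : e <= y / 4 by rewrite ge_min lexx orbT.
    have e1 : e <= 1 by lra.
    have [h _] := bounds e e0 e1.
    by have := exp_le e e0 e2; lra.
  pose e := Num.min (1 / 2) (y / (2 * z + 2)).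
  have e0 : 0 < e by rewrite lt_min !divr_gt0// ltr_wpDl// mulr_ge0.
  have e2 : e <= 1 / 2 by rewrite ge_min lexx.
  have ey : e * (2 * z + 2) <= y.
    by rewrite -ler_pdivlMr ?ltr_wpDl ?mulr_ge0// ge_min lexx orbT.
  have e1 : e <= 1 by lra.
  have [_ h] := bounds e e0 e1.
  have := ler_wpM2r z0 (exp_le e e0 e2); lra.
move=> e0 e1.
have [V [B1 [B2 [C [[mV V0] [mB1 PB1] [mB2 PB2] [EV EV2] VZ]]]]] :=
  exp_mart_comparison e0 e1.
have PB2L : (P B2 <= (e * expR (- L))%:E)%E.
  by apply: le_trans PB2 _; rewrite lee_fin ge_min lexx.
have PB2C : (P B2 <= (e * (e * expR (- C)))%:E)%E.
  by apply: le_trans PB2 _; rewrite lee_fin ge_min lexx orbT.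
have mV2 : measurable_fun setT (fun w => V w ^+ 2) by exact: measurable_funX.
have V20 w : 0 <= V w ^+ 2 by rewrite sqr_ge0.
have expLe (x y : R) (A : set T) : 0 <= y ->
    (P A <= (e * y)%:E)%E -> 0 <= x -> x * y <= 1 -> (x%:E * P A <= e%:E)%E.
  move=> y0 PA x0' xy.
  apply: (@le_trans _ _ (x%:E * (e * y)%:E)%E).
    by apply: lee_wpmul2l => //; rewrite lee_fin.
  rewrite -EFinM lee_fin mulrCA ger_pMr//.
have LN x : expR x * expR (- x) = 1 :> R by rewrite -expRD subrr expR0.
have comb1 := ge0_integral_combination P (expR_ge0 e) (lexx 0) (expR_ge0 L) (expR_ge0 L)
   mB1 mB2 mV mV2 V0 V20.
have r0 : 0 < e * expR (- C) by rewrite mulr_gt0// expR_gt0.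
have r20 : 0 <= (e * expR (- C)) / 2 by rewrite divr_ge0// ltW.
have ri0 : 0 <= ((e * expR (- C)) * 2)^-1 by rewrite invr_ge0 mulr_ge0// ltW.
have comb2 := ge0_integral_combination P (expR_ge0 e) r20 (expR_ge0 (L + 1)) ri0
   mB1 mB2 mZ mV2 Z0 V20.
have e2 : e / 2 + e / 2 = e by rewrite -splitr.
split.
- rewrite -lee_fin -zE.
  apply: (@le_trans _ _ (\int[P]_w (expR e * V w + 0 * V w ^+ 2
      + expR L * \1_B1 w + expR L * \1_B2 w)%:E)%E).
    apply: ge0_le_integral => //.
    + by move=> w _; rewrite lee_fin.
    + apply/measurable_EFinP.
      do 3 (apply: measurable_funD; last by apply: measurable_funM).
      by apply: measurable_funM.
    move=> w _; rewrite lee_fin mul0r addr0 !indicE.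
    have [B2w|B2w] := pselect (B2 w).
      rewrite (mem_set B2w) mulr1 (le_trans (ZL w))// lerDr.
      by rewrite addr_ge0// mulr_ge0// expR_ge0.
    have [B1w|B1w] := pselect (B1 w).
      rewrite (mem_set B1w) mulr1 (le_trans (ZL w))// -addrA addrCA lerDl.
      by rewrite addr_ge0// mulr_ge0// expR_ge0.
    have [_ /(_ B1w)[_ ZV]] := VZ w B2w.
    by rewrite (memNset B1w) (memNset B2w) !mulr0 !addr0.
  rewrite comb1 EV mul0e adde0 mule1 mulr_natl mulr2n addrA 2!EFinD.
  apply: leeD; first apply: leeD => //.
    apply: (expLe _ (expR (- (L + 1)))) => //; rewrite ?expR_ge0//.
    by rewrite -expRD -[leRHS]expR0 ler_expR; lra.
  by apply: (expLe _ (expR (- L))) => //; rewrite ?expR_ge0// LN.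
- rewrite -lee_fin -EV.
  apply: (@le_trans _ _ (\int[P]_w (expR e * Z w + (e * expR (- C)) / 2 * V w ^+ 2
      + expR (L + 1) * \1_B1 w + ((e * expR (- C)) * 2)^-1 * \1_B2 w)%:E)%E).
    apply: ge0_le_integral => //.
    + by move=> w _; rewrite lee_fin.
    + exact/measurable_EFinP.
    + apply/measurable_EFinP.
      do 3 (apply: measurable_funD; last by apply: measurable_funM).
      by apply: measurable_funM.
    move=> w _; rewrite lee_fin !indicE.
    have eZ0 : 0 <= expR e * Z w by rewrite mulr_ge0 ?expR_ge0.
    have rV0 := mulr_ge0 r20 (V20 w).
    have [B2w|B2w] := pselect (B2 w).
      rewrite (mem_set B2w) mulr1.
      have i0 : 0 <= expR (L + 1) * (w \in B1)%:R by rewrite mulr_ge0.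
      (* Cauchy-Schwarz in the form of Young's inequality with weight [r = e * expR (- C)]: the
         square integrates to at most [e / 2], and so does the constant over [B2], as [P B2] is at
         most [e * r]. *)
      suff : V w <= (e * expR (- C)) / 2 * V w ^+ 2 + ((e * expR (- C)) * 2)^-1.
        by lra.
      move: r0; set r := e * expR (- C) => r0.
      have -> : r / 2 * V w ^+ 2 + (r * 2)^-1 = V w + (r * V w - 1) ^+ 2 / (2 * r).
        by field; rewrite gt_eqF.
      by rewrite lerDl divr_ge0 ?sqr_ge0// mulr_ge0// ltW.
    have [Ve VZw] := VZ w B2w; rewrite (memNset B2w) mulr0 addr0.
    have [B1w|B1w] := pselect (B1 w).
      rewrite (mem_set B1w) mulr1.
      have : expR (L + e) <= expR (L + 1) by rewrite ler_expR lerD2l.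
      by lra.
    have [VZ1 _] := VZw B1w; rewrite (memNset B1w) mulr0 addr0.
    by apply: le_trans VZ1 _; rewrite lerDl.
  rewrite comb2 zE mulr_natl mulr2n -[X in _ + (X + _)]e2 -EFinM.
  have -> : (expR e * z + (e / 2 + e / 2 + e))%:E =
      ((expR e * z)%:E + (e / 2)%:E + e%:E + (e / 2)%:E)%E :> \bar R.
    by rewrite -!EFinD; congr EFin; ring.
  apply: leeD; first apply: leeD; first apply: leeD => //.
  + apply: (@le_trans _ _ (((e * expR (- C)) / 2)%:E * (expR C)%:E)%E).
      by apply: lee_wpmul2l => //; rewrite lee_fin.
    rewrite -EFinM lee_fin; have := LN C => LC.
    have -> : e * expR (- C) / 2 * expR C = e / 2 * (expR C * expR (- C)) by ring.
    by rewrite LC mulr1.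
  + apply: (expLe _ (expR (- (L + 1)))) => //; rewrite ?expR_ge0//.
    by rewrite LN.
  + apply: (@le_trans _ _ (((e * expR (- C)) * 2)^-1%:E * (e * (e * expR (- C)))%:E)%E).
      by apply: lee_wpmul2l => //; rewrite lee_fin.
    rewrite -EFinM lee_fin le_eqVlt; apply/orP; left; apply/eqP.
    by field; rewrite !gt_eqF ?expR_gt0.
Qed.

End laplace_transform.

(** * Time averages and long-time limits *)

(** The integral of a nonnegative function is a supremum over the simple functions below it, which
    is monotone without any measurability. It thus applies to s -> P(X_s < N) with no study of its
    dependence on s. *)
Lemma ge0_le_integral_nonmeasurable (d : measure_display)
    (T : measurableType d) (R : realType) (mu : {measure set T -> \bar R})
    (D : set T) (f g : T -> \bar R) :
  (forall x, D x -> (0 <= f x)%E) -> (forall x, D x -> (f x <= g x)%E) ->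
  (\int[mu]_(x in D) f x <= \int[mu]_(x in D) g x)%E.
Proof.
move=> f0 fg; rewrite !ge0_integralE//; last first.
  by move=> x Dx; exact: le_trans (f0 x Dx) (fg x Dx).
apply: ereal_sup_le => _ [h hf <-]; exists h => // x.
apply: le_trans (hf x) _; rewrite !patchE; case: ifPn => // xD.
by apply: fg; rewrite inE in xD.
Qed.

Section time_average.
Context {R : realType}.
Local Notation mu := (@lebesgue_measure R).

(** Cesaro averaging. [f] is squeezed between step functions: beyond [S] it is within [e / 2] of
    [L], and before [S] only 0 <= f <= 1 is used. *)
Lemma time_average_cvg (f : R -> R) (L : R) : 0 <= L ->
  (forall s, 0 <= f s <= 1) -> f s @[s --> +oo] --> L ->
  t^-1 * \int[mu]_(s in `[0, t]) f s @[t --> +oo] --> L.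
Proof.
move=> L0 f01 /cvgrPdist_le fL; apply/cvgrPdist_le => e e0.
have e20 : 0 < e / 2 by rewrite divr_gt0.
have [S0 [S0r SfL]] := fL _ e20.
pose S := Num.max 0 S0.
have S_ge0 : 0 <= S by rewrite le_max lexx.
have {}SfL s : S < s -> `|L - f s| <= e / 2.
  by rewrite gt_max => /andP[_ /SfL].
have ev1 : \forall t \near +oo, S < t.
  by apply: nbhs_pinfty_gt; exact: num_real.
(* The segment [0, S] costs at most [S] in the upper bound and [S * L] in the lower one; for such t
   both are at most [t * (e / 2)]. *)
have ev2 : \forall t \near +oo, S * (L + 1) / (e / 2) <= t.
  by apply: nbhs_pinfty_ge; exact: num_real.
apply: filterS2 ev1 ev2 => t St tS.
have t0 : 0 < t by exact: le_lt_trans St.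
rewrite ler_pdivrMr// in tS.
have mI (u : R) : 0 <= u -> mu `[0, u] = u%:E.
  move=> u0; rewrite lebesgue_measure_itv/= lte_fin lt_neqAle u0 andbT.
  by case: eqP => [<-|_]; rewrite ?oppr0 ?adde0.
have muSt : mu `]S, t] = (t - S)%:E.
  by rewrite lebesgue_measure_itv/= lte_fin St EFinB.
pose I := (\int[mu]_(s in `[0%R, t]) (f s)%:E)%E.
have I0 : (0 <= I)%E.
  by apply: integral_ge0 => s _; rewrite lee_fin; case/andP: (f01 s).
have Iub : (I <= (S + (L + e / 2) * t)%:E)%E.
  apply: (@le_trans _ _ (\int[mu]_(s in `[0%R, t])
      (\1_(`[0, S]%classic : set R) s + (L + e / 2))%:E)%E).
    apply: ge0_le_integral_nonmeasurable => s /=; rewrite in_itv/= => /andP[s0 st].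
      by rewrite lee_fin; case/andP: (f01 s).
    rewrite lee_fin indicE; have [sS|Ss] := leP s S.
      rewrite mem_set/= ?in_itv/= ?s0//; have /andP[_ f1] := f01 s.
      by rewrite (le_trans f1)// lerDl addr_ge0// ltW.
    rewrite memNset/= ?in_itv/= ?s0//=; last by apply/negP; rewrite -ltNge.
    by have := SfL s Ss; rewrite ler_norml => /andP[? ?]; lra.
  under eq_integral do rewrite EFinD.
  rewrite ge0_integralD//=; last 2 first.
  - exact/measurable_EFinP.
  - by move=> s _; rewrite lee_fin addr_ge0// ltW.
  rewrite integral_indic// integral_cst//= mI ?(ltW t0)//.
  rewrite (_ : `[0, S] `&` `[0, t] = `[0, S])%classic.
    by rewrite mI// -EFinM -EFinD.
  by apply/setIidPl => s /=; rewrite !in_itv/= => /andP[-> /le_trans]; apply; exact: ltW.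
have Ilb : (((L - e / 2) * (t - S))%:E <= I)%E.
  have [Le|Le] := leP (L - e / 2) 0.
    apply: le_trans I0; rewrite lee_fin mulr_le0_ge0// subr_ge0; exact: ltW.
  apply: (@le_trans _ _ (\int[mu]_(s in `[0%R, t])
      ((L - e / 2) * \1_(`]S, t]%classic : set R) s)%:E)%E).
    under eq_integral do rewrite EFinM.
    rewrite ge0_integralZl//=; last 2 first.
    - exact/measurable_EFinP.
    - by rewrite lee_fin ltW.
    rewrite integral_indic// (_ : `]S, t] `&` `[0, t] = `]S, t])%classic; last first.
      by apply/setIidPl => s /=; rewrite !in_itv/= => /andP[Ss ->];
        rewrite andbT ltW// (le_lt_trans S_ge0).
    by rewrite [X in (_ <= _ * X)%E]muSt -EFinM.
  apply: ge0_le_integral_nonmeasurable => s /=; rewrite in_itv/= => /andP[s0 st].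
    by rewrite lee_fin mulr_ge0// ltW.
  rewrite lee_fin indicE; have [sS|Ss] := leP s S.
    rewrite memNset/= ?mulr0; first by case/andP: (f01 s).
    by rewrite in_itv/= st andbT; apply/negP; rewrite -leNgt.
  rewrite mem_set/= ?in_itv/= ?Ss ?st// mulr1.
  by have := SfL s Ss; rewrite ler_norml => /andP[? ?]; lra.
have Ifin : I \is a fin_num.
  by rewrite ge0_fin_numE//; exact: le_lt_trans Iub (ltry _).
have [J IJ] : exists J : R, I = J%:E by exists (fine I); rewrite fineK.
have -> : \int[mu]_(s in `[0, t]) f s = J by rewrite /Rintegral -/I IJ.
rewrite IJ !lee_fin in Iub Ilb.
rewrite distrC ler_norml.
rewrite -(ler_pM2l t0) -[X in _ && X](ler_pM2l t0).
rewrite mulrBr mulVKf ?gt_eqF//.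
apply/andP; split; nra.
Qed.

End time_average.

Lemma expR_decay_cvg0 (R : realType) (b : R) : 0 < b ->
  expR (- b * t) @[t --> +oo] --> 0.
Proof.
move=> b0; apply/cvgrPdist_le => e e0; near=> t.
have te : (e * b)^-1 <= t by near: t; apply: nbhs_pinfty_ge; exact: num_real.
rewrite sub0r normrN ger0_norm ?expR_ge0// mulNr expRN.
have bt : b * t <= expR (b * t).
  by rewrite (le_trans _ (expR_ge1Dx _))// lerDr.
have bt0 : 0 < b * t by rewrite mulr_gt0.
apply: (@le_trans _ _ (b * t)^-1); first by rewrite lef_pV2 ?posrE ?expR_gt0.
rewrite -[e]invrK lef_pV2 ?posrE ?invr_gt0//.
by move: te; rewrite invfM ler_pdivrMr// mulrC.
Unshelve. all: by end_near.
Qed.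

Section riccati_limits.
Context {R : realType}.
Variables (b c l : R).
Hypotheses (c0 : 0 < c) (l0 : 0 <= l).

Lemma riccati_den_cvg : 0 < b ->
  riccati_den b c l t @[t --> +oo] --> 1 + l * (c / b).
Proof.
move=> b0; rewrite /riccati_den /decay_integral gt_eqF//.
apply: cvgD; first exact: cvg_cst.
have -> : l * (c / b) = l * c * ((1 - 0) / b) by rewrite subr0 div1r mulrA.
apply: cvgM; first exact: cvg_cst.
apply: cvgM; last exact: cvg_cst.
by apply: cvgB; [exact: cvg_cst|exact: expR_decay_cvg0].
Qed.

Lemma riccati_cvg0 : 0 < b -> riccati b c l t @[t --> +oo] --> 0.
Proof.
move=> b0; have d0 : 1 + l * (c / b) != 0.
  by rewrite gt_eqF// ltr_pwDl// mulr_ge0// divr_ge0// ltW.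
have -> : 0 = l * 0 / (1 + l * (c / b)) by rewrite mulr0 mul0r.
apply: cvgM; last by apply: cvgV => //; exact: riccati_den_cvg.
by apply: cvgM; [exact: cvg_cst|exact: expR_decay_cvg0].
Qed.

End riccati_limits.

(** The polynomial 1 - (1 - y^n)^(2^n) is that of the Brosowski-Deutsch proof of the
    Stone-Weierstrass theorem. Bernoulli's inequality gives (1 - y^n)^(2^n) >= 1 - (2 y)^n and, as
    (1 - y^n) (1 + y^n) <= 1, also (1 - y^n)^(2^n) <= (2 y)^(- n); hence the threshold 1/2. *)
Lemma step_poly (R : realType) (y1 y2 e : R) :
  0 <= y1 -> y1 < 1 / 2 -> 1 / 2 < y2 -> 0 < e ->
  exists p : {poly R}, [/\ forall y, 0 <= y <= 1 -> 0 <= p.[y] <= 1,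
    forall y, 0 <= y <= y1 -> p.[y] <= e &
    forall y, y2 <= y <= 1 -> 1 - e <= p.[y]].
Proof.
move=> y10 y11 y21 e0.
have Y1 : `|2 * y1| < 1 by rewrite ger0_norm ?mulr_ge0//; lra.
have y20 : 0 < y2 by lra.
have Y2 : `|(2 * y2)^-1| < 1.
  rewrite ger0_norm ?invr_ge0 ?mulr_ge0 ?(ltW y20)// invf_lt1; last by lra.
  by lra.
have [n _ [n1 n2]] : exists2 n : nat, True & (2 * y1) ^+ n <= e /\ (2 * y2)^-1 ^+ n <= e.
  have /cvgrPdist_le/(_ e e0) := cvg_expr Y1.
  have /cvgrPdist_le/(_ e e0) := cvg_expr Y2 => h2 h1.
  have [n [g1 g2]] := filter_ex (filterI h1 h2).
  exists n => //; rewrite !sub0r !normrN in g1 g2.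
  by split; [exact: le_trans (ler_norm _) g1|exact: le_trans (ler_norm _) g2].
exists (1 - (1 - 'X^n) ^+ (2 ^ n)).
have pE y : (1 - (1 - 'X^n) ^+ (2 ^ n) : {poly R}).[y] = 1 - (1 - y ^+ n) ^+ (2 ^ n).
  by rewrite !(hornerE, horner_exp).
have yn (y : R) : 0 <= y <= 1 -> 0 <= y ^+ n <= 1.
  by move=> /andP[yy0 yy1]; rewrite exprn_ge0//= exprn_ile1.
have bern (z : R) k : 0 <= z <= 1 -> 1 - k%:R * z <= (1 - z) ^+ k.
  move=> /andP[z0 z1]; elim: k => [|k IHk]; first by rewrite mul0r subr0.
  have : (1 - k%:R * z) * (1 - z) <= (1 - z) ^+ k * (1 - z).
    by rewrite ler_wpM2r// subr_ge0.
  rewrite -exprSr; apply: le_trans; rewrite -natr1.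
  have : 0 <= k%:R * z * z by rewrite !mulr_ge0.
  by lra.
have bern' (z : R) k : 0 <= z -> 1 + k%:R * z <= (1 + z) ^+ k.
  move=> z0; elim: k => [|k IHk]; first by rewrite mul0r addr0.
  have : (1 + k%:R * z) * (1 + z) <= (1 + z) ^+ k * (1 + z).
    by rewrite ler_wpM2r// addr_ge0.
  rewrite -exprSr; apply: le_trans; rewrite -natr1.
  have : 0 <= k%:R * z * z by rewrite !mulr_ge0.
  by lra.
split=> y.
- move=> y01; rewrite pE; have /andP[yn0 yn1] := yn y y01.
  have z0 : 0 <= 1 - y ^+ n by rewrite subr_ge0.
  rewrite subr_ge0 exprn_ile1//=; last by rewrite lerBlDr lerDl.
  by rewrite lerBlDr lerDl exprn_ge0.
- move=> /andP[yy0 yy1]; have y01 : 0 <= y <= 1 by rewrite yy0; lra.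
  rewrite pE; have := bern _ (2 ^ n)%N (yn y y01); rewrite natrX -exprMn.
  have : (2 * y) ^+ n <= (2 * y1) ^+ n.
    by rewrite lerXn2r ?nnegrE ?mulr_ge0// ler_pM2l.
  by lra.
move=> /andP[yy2 yy1]; have yy0 : 0 < y by lra.
have y01 : 0 <= y <= 1 by rewrite yy1 ltW.
have /andP[yn0 yn1] := yn y y01.
rewrite pE lerD2l lerN2.
have Yn0 : 0 < (2 * y) ^+ n by rewrite exprn_gt0// mulr_gt0.
apply: (@le_trans _ _ ((2 * y) ^- n)).
  rewrite -div1r ler_pdivlMr//.
  have h := bern' _ (2 ^ n)%N yn0; rewrite natrX -exprMn in h.
  have z0 : 0 <= (1 - y ^+ n) ^+ (2 ^ n) by rewrite exprn_ge0// subr_ge0.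
  have : (1 - y ^+ n) ^+ (2 ^ n) * (1 + (2 * y) ^+ n) <=
      (1 - y ^+ n) ^+ (2 ^ n) * (1 + y ^+ n) ^+ (2 ^ n) by rewrite ler_wpM2l.
  rewrite -exprMn.
  have -> : (1 - y ^+ n) * (1 + y ^+ n) = 1 - (y ^+ n) ^+ 2 by ring.
  have : (1 - (y ^+ n) ^+ 2) ^+ (2 ^ n) <= 1.
    apply: exprn_ile1; last by rewrite lerBlDr lerDl sqr_ge0.
    by rewrite subr_ge0 exprn_ile1.
  by rewrite mulrDr mulr1; lra.
have P1 : 0 < 2 * y by rewrite mulr_gt0.
have P2 : 0 < 2 * y2 by rewrite mulr_gt0.
apply: le_trans n2; rewrite -exprVn; apply: lerXn2r.
- by rewrite nnegrE invr_ge0 ltW.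
- by rewrite nnegrE invr_ge0 ltW.
by rewrite lef_pV2 ?posrE// ler_pM2l.
Qed.

(** * The Gamma law *)

Section gamma.
Context {R : realType}.
Variable alpha : R.
Hypothesis alpha1 : 1 <= alpha.
Local Notation mu := (@lebesgue_measure R).
Local Notation gi := (gamma_integrand alpha).

Lemma gamma_integrand_ge0 (u : R) : 0 <= gi u.
Proof. by rewrite mulr_ge0 ?powR_ge0 ?expR_ge0. Qed.

Lemma measurable_gamma_integrand : measurable_fun setT gi.
Proof.
apply: measurable_funM; first exact: measurable_powR.
by apply: measurableT_comp => //; exact: measurableT_comp.
Qed.

(** There is no singularity at 0 since alpha >= 1. The value there is 1 for alpha = 1, by the
    convention on the power 0 of 0, and 0 otherwise, hence the two cases. *)
Lemma continuous_gamma_integrand : {within `[0, +oo[, continuous gi}.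
Proof.
have cexp : continuous (fun u : R => expR (- u)).
  by move=> u; apply: continuous_comp; [exact: oppr_continuous|exact: continuous_expR].
have [a1|a1] := eqVneq alpha 1.
  have -> : gi = (fun u => expR (- u)).
    by apply/funext => u; rewrite /gamma_integrand a1 subrr powRr0 mul1r.
  exact: continuous_subspaceT.
have a10 : 0 < alpha - 1 by rewrite subr_gt0 lt_neqAle eq_sym a1.
apply/continuous_within_itvcyP; split.
  move=> u u0; apply: cvgM; last exact: cexp.
  have /derivable1_diffP/differentiable_continuous := @derivable_powR R 1 (alpha - 1) u u0.
  exact.
rewrite /gamma_integrand powR0 ?gt_eqF// mul0r.
rewrite -[X in _ --> X](mul0r (expR (- 0))); apply: cvgM.
  exact: powR_cvg0.
by apply: cvg_at_right_filter; exact: cexp.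
Qed.

(** u^(alpha - 1) exp(- u / 2) is maximal at u = 2 (alpha - 1); the inequality ln x <= x - 1 at u /
    (2 (alpha - 1)) gives the constant. The summand 1 covers u = 0 and alpha = 1. *)
Lemma gamma_integrand_le (u : R) : 0 <= u ->
  gi u <= (1 + expR ((alpha - 1) * ln (2 * (alpha - 1)))) * expR (- (u / 2)).
Proof.
rewrite le_eqVlt => /predU1P[<-|u0].
  rewrite /gamma_integrand mul0r oppr0 expR0 !mulr1.
  have := expR_ge0 ((alpha - 1) * ln (2 * (alpha - 1))).
  by rewrite /powR eqxx; case: eqP => _ /=; lra.
have -> : gi u = u `^ (alpha - 1) * expR (- (u / 2)) * expR (- (u / 2)).
  by rewrite /gamma_integrand -mulrA -expRD; congr (_ * expR _); field.
rewrite ler_wpM2r ?expR_ge0// /powR gt_eqF// -expRD.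
have [b0|b0] := eqVneq (alpha - 1) 0.
  rewrite b0 !mul0r add0r expR0 (@le_trans _ _ 1)//; last by rewrite lerDl.
  by rewrite -[leRHS]expR0 ler_expR oppr_le0 divr_ge0// ltW.
have b1 : 0 < alpha - 1 by rewrite lt_neqAle eq_sym b0 subr_ge0.
rewrite ler_wpDl// ler_expR lerBlDr.
have := expR_ge1Dx (ln (u / (2 * (alpha - 1)))).
rewrite lnK ?posrE ?divr_gt0 ?mulr_gt0// lnM ?posrE ?invr_gt0 ?mulr_gt0//.
rewrite lnV ?posrE ?mulr_gt0// => h.
have -> : (alpha - 1) * ln (2 * (alpha - 1)) + u / 2 =
    (alpha - 1) * (ln (2 * (alpha - 1)) + u / (2 * (alpha - 1))).
  by field.
by apply: ler_wpM2l; [exact: ltW|lra].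
Qed.

Lemma integrable_gamma_integrand :
  mu.-integrable `[0, +oo[ (EFin \o gi).
Proof.
set C := 1 + expR ((alpha - 1) * ln (2 * (alpha - 1))).
have C0 : 0 <= C by rewrite addr_ge0 ?expR_ge0.
have ipdf := integrable_exponential_pdf (rate := 1 / 2 : R) (ltac:(lra)).
have ipdf0 : mu.-integrable `[0, +oo[ (EFin \o exponential_pdf (1 / 2 : R)).
  exact: integrableS ipdf.
have iC : mu.-integrable `[0, +oo[
    (fun u => ((2 * C)%:E * (EFin \o exponential_pdf (1 / 2 : R)) u)%E).
  exact: integrableZl.
apply: le_integrable iC => //.
  by apply/measurable_EFinP; apply: measurable_funTS; exact: measurable_gamma_integrand.
move=> u /=; rewrite in_itv/= andbT => u0.
rewrite /= exponential_pdfE// lee_fin ger0_norm ?gamma_integrand_ge0//.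
rewrite ger0_norm; last first.
  by rewrite !mulr_ge0 ?expR_ge0//.
apply: le_trans (gamma_integrand_le u0) _; rewrite -/C le_eqVlt; apply/orP; left.
have -> : - (u / 2) = - (1 / 2) * u by field.
by apply/eqP; field.
Qed.

Lemma gamma_integral_gt0 : (0 < \int[mu]_(u in `[0%R, +oo[) (gi u)%:E)%E.
Proof.
have gipos (u : R) : 0 < u -> 0 < gi u.
  by move=> u0; rewrite mulr_gt0 ?powR_gt0 ?expR_gt0.
have m12 : (expR (-2))%:E = (\int[mu]_(u in `[1%R, 2%R]) (expR (-2))%:E)%E.
  rewrite integral_cst//= lebesgue_measure_itv/= lte_fin.
  rewrite ifT ?ltr1n// -EFinB (_ : 2 - 1 = 1 :> R) ?mule1//; ring.
apply: (@lt_le_trans _ _ (expR (-2))%:E); first by rewrite lte_fin expR_gt0.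
rewrite m12; apply: (@le_trans _ _ (\int[mu]_(u in `[1%R, 2%R]) (gi u)%:E)%E).
  apply: ge0_le_integral => //.
  - by apply/measurable_EFinP; apply: measurable_funTS; exact: measurable_gamma_integrand.
  move=> u /=; rewrite in_itv/= => /andP[u1 u2]; rewrite lee_fin.
  have p1 : 1 <= (u : R) `^ (alpha - 1).
    have p11 : 1 `^ (alpha - 1) = 1 :> R by rewrite powR1.
    rewrite -[leLHS]p11; apply: ge0_ler_powR.
    + by rewrite subr_ge0.
    + by rewrite nnegrE.
    + by rewrite nnegrE (le_trans ler01 u1).
    + exact: u1.
  by rewrite -[leLHS]mul1r ler_pM ?expR_ge0// ler_expR lerN2.
apply: ge0_subset_integral => //.
- by apply/measurable_EFinP; apply: measurable_funTS; exact: measurable_gamma_integrand.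
- by move=> u _; rewrite lee_fin gamma_integrand_ge0.
- by move=> u /=; rewrite !in_itv/= andbT => /andP[u1 _]; rewrite (le_trans _ u1).
Qed.

Lemma Gamma_gt0 : 0 < Gamma alpha.
Proof.
rewrite /Gamma /Rintegral fine_gt0// gamma_integral_gt0/=.
have := integrable_gamma_integrand => /integrableP[_].
by under eq_integral do rewrite /= ger0_norm ?gamma_integrand_ge0//.
Qed.

(** The substitution u -> (1 + m) u in the integral defining [Gamma alpha] produces the factor (1 +
    m)^alpha. *)
Lemma gamma_laplace (m : R) : 0 <= m ->
  \int[mu]_(u in `[0, +oo[) (expR (- m * u) * gi u) =
  expR (- alpha * ln (1 + m)) * Gamma alpha.
Proof.
move=> m0; set k := 1 + m.
have k0 : 0 < k by rewrite ltr_pwDl.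
have dF : (( *%R k)^`())%classic = cst k :> (R -> R).
  by apply/funext => x; rewrite derive1Ml// derive1_id mulr1.
have := @increasing_ge0_integration_by_substitutiony R ( *%R k) gi 0.
rewrite mulr0 dF => sub.
have {}sub : (\int[mu]_(x in `[0%R, +oo[) (gi x)%:E =
    \int[mu]_(x in `[0%R, +oo[) (((gi \o *%R k) * cst k) x)%:E)%E.
  apply: sub.
  - by move=> x y _ _ xy; rewrite ltr_pM2l.
  - by move=> x _; exact: cvg_cst.
  - exact: is_cvg_cst.
  - exact: is_cvg_cst.
  - split; first by move=> x _; exact: derivableM.
    by apply: cvg_at_right_filter; apply: mulrl_continuous.
  - exact: gt0_cvgMry.
  - exact: continuous_gamma_integrand.
  - by move=> x _; exact: gamma_integrand_ge0.
rewrite /Gamma /Rintegral sub.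
under [X in _ = _ * fine X]eq_integral.
  move=> u; rewrite inE/= in_itv/= andbT => u0.
  have -> : ((gi \o *%R k) * cst k) u =
      expR (alpha * ln k) * (expR (- m * u) * gi u).
    have -> : ((gi \o *%R k) * cst k) u = gi (k * u) * k by [].
    rewrite /gamma_integrand powRM// ?(ltW k0)//.
    have -> : k `^ (alpha - 1) = expR (alpha * ln k) / k.
      rewrite /powR gt_eqF// mulrBl mul1r expRD expRN lnK//.
    have -> : expR (- (k * u)) = expR (- m * u) * expR (- u).
      by rewrite -expRD /k; congr expR; ring.
    by field; rewrite gt_eqF.
  rewrite EFinM; over.
have lap0 u : (0 <= (expR (- m * u) * gi u)%:E)%E.
  by rewrite lee_fin mulr_ge0 ?expR_ge0 ?gamma_integrand_ge0.
have mlap : measurable_fun (`[0%R, +oo[%classic : set R)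
    (fun u : R => (expR (- m * u) * gi u)%:E).
  apply/measurable_EFinP; apply: measurable_funTS; apply: measurable_funM.
    by apply: measurableT_comp => //; exact: measurable_funM.
  exact: measurable_gamma_integrand.
rewrite ge0_integralZl ?lee_fin ?expR_ge0//.
have ilap : mu.-integrable `[0, +oo[ (EFin \o (fun u => expR (- m * u) * gi u)).
  apply: le_integrable integrable_gamma_integrand => //.
  move=> u /=; rewrite in_itv/= andbT => u0; rewrite lee_fin.
  rewrite normrM ler_piMl// ger0_norm ?expR_ge0// -expR0 ler_expR.
  by rewrite mulNr oppr_le0 mulr_ge0.
rewrite fineM//; last exact: integrable_fin_num.
by rewrite /= mulrA -expRD mulNr addNr expR0 mul1r.
Qed.

End gamma.

(* With beta = ln 2 / ((N1 + N2) / 2), the threshold 1/2 of [step_poly] separates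
   exp(- beta N1) from exp(- beta N2). *)
Lemma exp_poly_sandwich (R : realType) (N1 N2 e : R) : 0 < N1 -> N1 < N2 -> 0 < e ->
  exists (beta : R) (p : {poly R}), 0 < beta /\
  forall y : R, 0 <= y -> [/\ 0 <= p.[expR (- beta * y)] <= 1,
    (y <= N1 -> 1 - e <= p.[expR (- beta * y)]) &
    (N2 <= y -> p.[expR (- beta * y)] <= e)].
Proof.
move=> N10 N12 e0; pose M := (N1 + N2) / 2.
have M0 : 0 < M by rewrite divr_gt0// addr_gt0// (lt_trans N10).
have ln20 : 0 < ln 2 :> R by rewrite ln_gt0// ltr1n.
pose beta : R := ln 2 / M; have beta0 : 0 < beta by rewrite divr_gt0.
have half : expR (- beta * M) = 1 / 2.
  by rewrite mulNr /beta divfK ?gt_eqF// expRN lnK ?posrE// div1r.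
have [|||p [p01 pe p1e]] := @step_poly R (expR (- beta * N2)) (expR (- beta * N1)) e _ _ _ e0.
- exact: expR_ge0.
- by rewrite -half ltr_expR ltr_nM2l ?oppr_lt0// /M; lra.
- by rewrite -half ltr_expR ltr_nM2l ?oppr_lt0// /M; lra.
exists beta, p; split=> // y y0.
have ey : 0 <= expR (- beta * y) <= 1.
  by rewrite expR_ge0/= -[leRHS]expR0 ler_expR mulNr oppr_le0 mulr_ge0// ltW.
have /andP[ey0 ey1] := ey.
split; first exact: p01.
- by move=> yN; apply: p1e; rewrite ey1 andbT ler_expR ler_nM2l ?oppr_lt0.
- by move=> yN; apply: pe; rewrite ey0/= ler_expR ler_nM2l ?oppr_lt0.
Qed.

(** * Integrals of polynomials in exp(- beta z) *)

Section exponential_polynomials.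
Context {d : measure_display} {T : measurableType d} {R : realType}.
Variables (mu : {measure set T -> \bar R}) (D : set T) (g z : T -> R).
Hypotheses (mD : measurable D) (ig : mu.-integrable D (EFin \o g)).
Hypotheses (g0 : forall x, D x -> 0 <= g x) (z0 : forall x, D x -> 0 <= z x).
Hypothesis mz : measurable_fun D z.

Let integrable_mul (f : T -> R) (B : R) : measurable_fun D f ->
  (forall x, D x -> `|f x| <= B) ->
  mu.-integrable D (EFin \o (fun x => f x * g x)).
Proof.
move=> mf fB; have [mg _] := integrableP _ _ _ ig.
have iBg : mu.-integrable D (fun x => (`|B|%:E * (EFin \o g) x)%E).
  exact: integrableZl.
apply: le_integrable iBg => //.
  by apply/measurable_EFinP; apply: measurable_funM => //; exact/measurable_EFinP.
move=> x Dx /=; rewrite lee_fin !normrM normr_id ler_wpM2r//.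
exact: le_trans (fB x Dx) (ler_norm B).
Qed.

Let integrable_scale (c : R) (f : T -> R) : mu.-integrable D (EFin \o f) ->
  mu.-integrable D (EFin \o (fun x => c * f x)).
Proof. by move=> fi; have := integrableZl mD c fi. Qed.

Let measurable_exp (l : R) : measurable_fun D (fun x => expR (- l * z x)).
Proof.
by apply: measurableT_comp => //; exact: measurable_funM.
Qed.

Let exp_le1 (l : R) x : 0 <= l -> D x -> `|expR (- l * z x)| <= 1.
Proof.
move=> l0 Dx; rewrite ger0_norm ?expR_ge0// -expR0 ler_expR mulNr oppr_le0.
by rewrite mulr_ge0// z0.
Qed.

Lemma integrable_exp_mul (l : R) : 0 <= l ->
  mu.-integrable D (EFin \o (fun x => expR (- l * z x) * g x)).
Proof. by move=> l0; apply: integrable_mul => // x; exact: exp_le1. Qed.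

(** Powers of exp(- beta z) are again exponentials, so only Laplace transforms enter. The setting is
    used twice: for [P] with weight 1 and z the process at time t, and for the Lebesgue measure on
    [0, +oo[ with the Gamma integrand as weight and z = k u. *)
Lemma Rintegral_exp_poly (beta : R) (p : {poly R}) : 0 <= beta ->
  \int[mu]_(x in D) (p.[expR (- beta * z x)] * g x) =
  \sum_(i < size p) p`_i * \int[mu]_(x in D) (expR (- (i%:R * beta) * z x) * g x).
Proof.
move=> beta0.
have ib (i : nat) : 0 <= i%:R * beta by rewrite mulr_ge0.
pose f i x := p`_i * (expR (- (i%:R * beta) * z x) * g x).
have fi i : mu.-integrable D (EFin \o f i).
  by apply: integrable_scale; exact: integrable_exp_mul.
transitivity (\int[mu]_(x in D) \sum_(i < size p) f i x).
  apply: eq_Rintegral => x _; rewrite horner_coef mulr_suml.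
  apply: eq_bigr => i _; rewrite /f -mulrA -expRM_natl.
  by congr (_ * (expR _ * _)); ring.
elim: (size p) => [|n IHn].
  by rewrite big_ord0; under eq_Rintegral do rewrite big_ord0; rewrite Rintegral_cst// mul0r.
have isum : mu.-integrable D (EFin \o (fun x => \sum_(i < n) f i x)).
  rewrite (_ : _ \o _ = (fun x => \sum_(i < n) (EFin \o f i) x)%E); last first.
    by apply/funext => x; rewrite /= sumEFin.
  exact: integrable_sum.
rewrite big_ord_recr/= -IHn; under eq_Rintegral do rewrite big_ord_recr/=.
rewrite RintegralD//; congr (_ + _).
by rewrite RintegralZl//; exact: integrable_exp_mul.
Qed.

Variables (N1 N2 e beta : R) (p : {poly R}).
Hypotheses (e0 : 0 < e) (beta0 : 0 < beta).
Hypothesis sandwich : forall y : R, 0 <= y -> [/\ 0 <= p.[expR (- beta * y)] <= 1,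
    (y <= N1 -> 1 - e <= p.[expR (- beta * y)]) &
    (N2 <= y -> p.[expR (- beta * y)] <= e)].

Let measurable_poly : measurable_fun D (fun x => p.[expR (- beta * z x)]).
Proof.
rewrite (_ : (fun x => _) = (fun x => \sum_(i < size p) p`_i * expR (- beta * z x) ^+ i)).
  apply: measurable_sum => i; apply: measurable_funM => //.
  by apply: measurable_funX; exact: measurable_exp.
by apply/funext => x; rewrite horner_coef.
Qed.

Let ip : mu.-integrable D (EFin \o (fun x => p.[expR (- beta * z x)] * g x)).
Proof.
apply: (integrable_mul (B := 1)) => // x Dx.
by have [/andP[p0 p1] _ _] := sandwich (z0 Dx); rewrite ger0_norm.
Qed.

Lemma Rintegral_exp_poly_le (S : set T) : measurable S -> S `<=` D ->
  (forall x, D x -> z x < N2 -> S x) ->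
  \int[mu]_(x in D) (p.[expR (- beta * z x)] * g x) <=
  \int[mu]_(x in S) g x + e * \int[mu]_(x in D) g x.
Proof.
move=> mS SD DS.
have iS : mu.-integrable D (EFin \o (fun x => \1_S x * g x)).
  by apply: (integrable_mul (B := 1)) => // x _; rewrite indicE normr_nat; case: (_ \in _).
have -> : \int[mu]_(x in S) g x = \int[mu]_(x in D) (\1_S x * g x).
  rewrite [RHS](_ : _ = \int[mu]_(x in D) ((g \_ S) x)); last first.
    apply: eq_Rintegral => x _; rewrite patchE indicE; case: (x \in S).
      by rewrite mul1r.
    by rewrite mul0r.
  by rewrite -Rintegral_mkcondr setIidr.
rewrite -RintegralZl// -RintegralD//; last first.
  exact: integrable_scale.
apply: le_Rintegral => //.
  by have := integrableD mD iS (integrable_scale e ig).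
move=> x Dx; rewrite -mulrDl ler_wpM2r ?g0// indicE.
have [/andP[p0 p1] _ pe] := sandwich (z0 Dx).
have [xS|xS] := boolP (x \in S); first by rewrite (le_trans p1)// lerDl ltW.
rewrite add0r; apply: pe; rewrite leNgt; apply/negP => /(DS x Dx).
by move: xS; rewrite notin_setE.
Qed.

Lemma Rintegral_exp_poly_ge (S : set T) : measurable S -> S `<=` D ->
  (forall x, S x -> z x <= N1) ->
  \int[mu]_(x in S) g x - e * \int[mu]_(x in D) g x <=
  \int[mu]_(x in D) (p.[expR (- beta * z x)] * g x).
Proof.
move=> mS SD SN.
have iS : mu.-integrable D (EFin \o (fun x => \1_S x * g x)).
  by apply: (integrable_mul (B := 1)) => // x _; rewrite indicE normr_nat; case: (_ \in _).
have -> : \int[mu]_(x in S) g x = \int[mu]_(x in D) (\1_S x * g x).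
  rewrite [RHS](_ : _ = \int[mu]_(x in D) ((g \_ S) x)); last first.
    apply: eq_Rintegral => x _; rewrite patchE indicE; case: (x \in S).
      by rewrite mul1r.
    by rewrite mul0r.
  by rewrite -Rintegral_mkcondr setIidr.
have ieg : mu.-integrable D (EFin \o (fun x => e * g x)).
  exact: integrable_scale.
rewrite lerBlDr -RintegralZl// -RintegralD//.
apply: le_Rintegral => //.
  by have := integrableD mD ip ieg.
move=> x Dx; rewrite -mulrDl ler_wpM2r ?g0// indicE.
have [/andP[p0 p1] p1e _] := sandwich (z0 Dx).
have [xS|xS] := boolP (x \in S); last by rewrite addr_ge0// ltW.
have {}xS : S x by rewrite inE in xS.
by have := p1e (SN x xS); rewrite lerBlDr.
Qed.

End exponential_polynomials.

(** * Convergence of distribution functions *)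

(** The Gamma density is bounded. This is what allows the threshold to be moved slightly in
    [cdf_cvg]. *)
Lemma lower_gamma_lipschitz (R : realType) (alpha : R) : 1 <= alpha ->
  exists2 C, 0 < C & forall x y : R, 0 <= x -> x <= y ->
    lower_gamma alpha y - lower_gamma alpha x <= C * (y - x).
Proof.
move=> alpha1.
pose C : R := 1 + expR ((alpha - 1) * ln (2 * (alpha - 1))).
have C0 : 0 < C by rewrite addr_gt0 ?expR_gt0.
exists C => // x y x0 xy.
have ig (A : set R) : measurable A -> A `<=` `[0, +oo[ ->
    (@lebesgue_measure R).-integrable A (EFin \o gamma_integrand alpha).
  by move=> mA A0; apply: integrableS (integrable_gamma_integrand alpha1).
have xyS : `]x, y] `<=` (`[0, +oo[ : set R).
  by move=> u /=; rewrite !in_itv/= andbT => /andP[xu _]; exact: le_trans x0 (ltW xu).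
have muxy : lebesgue_measure (`]x, y] : set R) = (y - x)%:E.
  rewrite lebesgue_measure_itv/= lte_fin; case: ltP => //.
  by move=> yx; rewrite (@le_anti _ _ x y) ?xy// subrr.
have -> : lower_gamma alpha y - lower_gamma alpha x =
    \int[lebesgue_measure]_(u in `]x, y]) gamma_integrand alpha u.
  rewrite /lower_gamma Rintegral_itvB ?bnd_simp//.
  by apply: ig => // u /=; rewrite !in_itv/= andbT => /andP[].
have -> : C * (y - x) = \int[lebesgue_measure]_(u in `]x, y]) C.
  by rewrite Rintegral_cst//= muxy.
apply: le_Rintegral => //; first exact: ig.
  have : (@lebesgue_measure R).-integrable `]x, y] (EFin \o cst C).
    apply/integrableP; split; first exact/measurable_EFinP.
    by rewrite [ltLHS](integral_cst _ _ `|C|%:E)//= muxy -EFinM ltry.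
  exact.
move=> u xyu; have := xyS u xyu; rewrite /= in_itv/= andbT => u0.
apply: le_trans (gamma_integrand_le alpha1 u0) _.
rewrite -/C ger_pMr// -[leRHS]expR0 ler_expR oppr_le0 divr_ge0//.
Qed.

Lemma measurable_sublevel (d : measure_display) (T : measurableType d)
    (R : realType) (f : T -> R) (y : R) :
  measurable_fun setT f -> measurable [set x | f x < y].
Proof.
move=> mf; rewrite (_ : [set x | _] = setT `&` f @^-1` `]-oo, y[); first exact: mf.
by rewrite setTI; apply/seteqP; split => x /=; rewrite in_itv.
Qed.

Section laplace_continuity.
Context {d : measure_display} {T : measurableType d} {R : realType}.
Variables (P : probability T R) (Z : R -> T -> R) (alpha k : R).
Hypotheses (alpha1 : 1 <= alpha) (k0 : 0 < k).
Hypotheses (mZ : forall t, measurable_fun setT (Z t)) (Z0 : forall t w, 0 <= Z t w).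
Hypothesis laplaceZ : forall l, 0 <= l ->
  \int[P]_w expR (- l * Z t w) @[t --> +oo] --> expR (- alpha * ln (1 + l * k)).

Local Notation gi := (gamma_integrand alpha).
Local Notation mu := (@lebesgue_measure R).
Let Gamma0 := Gamma_gt0 alpha1.
Let ig := integrable_gamma_integrand alpha1.

Let one_integrable : P.-integrable setT (EFin \o (cst 1 : T -> R)).
Proof. exact: finite_measure_integrable_cst. Qed.

Let ku_ge0 (u : R) : (`[0, +oo[%classic : set R) u -> 0 <= k * u.
Proof. by rewrite /= in_itv/= andbT => u0; rewrite mulr_ge0// ltW. Qed.

Let measurable_ku : measurable_fun (`[0, +oo[%classic : set R) (fun u => k * u).
Proof. exact: measurable_funM. Qed.

Let exp_poly_cvg (beta : R) (p : {poly R}) : 0 <= beta ->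
  \int[P]_w (p.[expR (- beta * Z t w)] * cst 1 w) @[t --> +oo] -->
  \int[mu]_(u in `[0, +oo[) (p.[expR (- beta * (k * u))] * gi u) / Gamma alpha.
Proof.
move=> beta0; have ib (i : nat) : 0 <= i%:R * beta by rewrite mulr_ge0.
rewrite (Rintegral_exp_poly _ ig ku_ge0 measurable_ku)//.
under eq_cvg => t do rewrite (Rintegral_exp_poly _ one_integrable (fun w _ => Z0 t w) (mZ t))//.
rewrite mulr_suml; apply: cvg_big => [|i _]; first exact: add_continuous.
rewrite -mulrA; apply: cvgM; first exact: cvg_cst.
have -> : \int[mu]_(u in `[0, +oo[) (expR (- (i%:R * beta) * (k * u)) * gi u) / Gamma alpha
    = expR (- alpha * ln (1 + i%:R * beta * k)).
  have E u : - (i%:R * beta) * (k * u) = - (i%:R * beta * k) * u by ring.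
  under eq_Rintegral do rewrite E.
  rewrite gamma_laplace//; last by rewrite mulr_ge0// ltW.
  by rewrite mulfK// gt_eqF.
under eq_cvg => t do under eq_Rintegral do rewrite mulr1.
exact: laplaceZ.
Qed.

(** A polynomial stepping down between [N - dl] and [N] bounds the probability from below, another
    between [N] and [N + dl] from above. Each side costs four errors [e]: polynomial against
    indicator under [P] and under the Gamma law, convergence, and the shift of the threshold. *)
Lemma cdf_cvg (N : R) : 0 < N ->
  fine (P [set w | Z t w < N]) @[t --> +oo] --> lower_gamma alpha (N / k) / Gamma alpha.
Proof.
move=> N0; have [C C0 lipC] := lower_gamma_lipschitz alpha1.
apply/cvgrPdist_le => eta eta0; pose e := eta / 4.
have e0 : 0 < e by rewrite divr_gt0.
(* [N / 2] keeps [N - dl] positive; the other bound makes the Gamma distribution function vary by at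
   most [e] over a length [dl]. *)
pose dl := Num.min (N / 2) (e * (k * Gamma alpha) / C).
have dl0 : 0 < dl by rewrite lt_min !divr_gt0// !mulr_gt0.
have dlN : dl <= N / 2 by rewrite ge_min lexx.
have dlC : C * (dl / k) / Gamma alpha <= e.
  rewrite ler_pdivrMr// mulrA ler_pdivrMr// mulrC -ler_pdivlMr//.
  by rewrite -(mulrA e) (mulrC (Gamma alpha)) ge_min lexx orbT.
have mS t : measurable [set w | Z t w < N] by exact: measurable_sublevel.
have intS t : \int[P]_(w in [set w | Z t w < N]) (cst 1 w) = fine (P [set w | Z t w < N]) :> R.
  by rewrite Rintegral_cst//= mul1r.
have int1 : \int[P]_w (cst 1 w) = 1 :> R.
  by rewrite Rintegral_cst//= probability_setT mul1r.
have GE : \int[mu]_(u in `[0, +oo[) gi u = Gamma alpha by [].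
have itv_sub y : `[0, y] `<=` (`[0, +oo[ : set R).
  by move=> u /=; rewrite !in_itv/= andbT => /andP[].
have N1 : 0 < N - dl by lra.
have N1N : N - dl < N by lra.
have N2 : N < N + dl by rewrite ltrDl.
have [beta1 [p1 [beta10 sw1]]] := exp_poly_sandwich N1 N1N e0.
have [beta2 [p2 [beta20 sw2]]] := exp_poly_sandwich N0 N2 e0.
have /cvgrPdist_le/(_ e e0) cv1 := exp_poly_cvg (p := p1) (ltW beta10).
have /cvgrPdist_le/(_ e e0) cv2 := exp_poly_cvg (p := p2) (ltW beta20).
apply: filterS2 cv1 cv2 => t cv1 cv2.
have up : fine (P [set w | Z t w < N]) - e <=
    \int[P]_w (p2.[expR (- beta2 * Z t w)] * cst 1 w).
  rewrite -intS -[X in _ - X]mulr1 -[X in _ - _ * X]int1.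
  by apply: (Rintegral_exp_poly_ge _ one_integrable (fun _ _ => ler01) (fun w _ => Z0 t w) (mZ t) e0 sw2) => //= w /ltW.
have lo : \int[P]_w (p1.[expR (- beta1 * Z t w)] * cst 1 w) <=
    fine (P [set w | Z t w < N]) + e.
  rewrite -intS -[X in _ + X]mulr1 -[X in _ + _ * X]int1.
  by apply: (Rintegral_exp_poly_le _ one_integrable (fun _ _ => ler01) (fun w _ => Z0 t w) (mZ t) e0 sw1).
have gup : \int[mu]_(u in `[0, +oo[) (p2.[expR (- beta2 * (k * u))] * gi u) / Gamma alpha
    <= lower_gamma alpha ((N + dl) / k) / Gamma alpha + e.
  rewrite ler_pdivrMr// mulrDl divfK ?gt_eqF// -GE.
  apply: (Rintegral_exp_poly_le _ ig (fun u _ => gamma_integrand_ge0 alpha u) ku_ge0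
    measurable_ku e0 sw2) => //.
  move=> u /=; rewrite !in_itv/= andbT => -> /= h.
  by rewrite ler_pdivlMr// mulrC ltW.
have glo : lower_gamma alpha ((N - dl) / k) / Gamma alpha - e <=
    \int[mu]_(u in `[0, +oo[) (p1.[expR (- beta1 * (k * u))] * gi u) / Gamma alpha.
  rewrite ler_pdivlMr// mulrBl divfK ?gt_eqF// -GE.
  apply: (Rintegral_exp_poly_ge _ ig (fun u _ => gamma_integrand_ge0 alpha u) ku_ge0
    measurable_ku e0 sw1) => //.
  by move=> u /=; rewrite !in_itv/= => /andP[_]; rewrite ler_pdivlMr// mulrC.
have lip x y : 0 <= x -> x <= y -> y - x = dl / k ->
    lower_gamma alpha y / Gamma alpha <= lower_gamma alpha x / Gamma alpha + e.
  move=> x0 xy yx; rewrite -lerBlDl -mulrBl; apply: le_trans dlC.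
  by rewrite ler_wpM2r ?invr_ge0 ?(ltW Gamma0)// -yx lipC.
have k_le (x y : R) : x <= y -> x / k <= y / k.
  by move=> xy; rewrite ler_wpM2r// invr_ge0 ltW.
have l1 : lower_gamma alpha (N / k) / Gamma alpha <=
    lower_gamma alpha ((N - dl) / k) / Gamma alpha + e.
  apply: lip; [by rewrite divr_ge0// ltW|exact/k_le/ltW|].
  by rewrite -mulrBl; congr (_ / k); ring.
have l2 : lower_gamma alpha ((N + dl) / k) / Gamma alpha <=
    lower_gamma alpha (N / k) / Gamma alpha + e.
  apply: lip; [by rewrite divr_ge0// ltW|exact/k_le/ltW|].
  by rewrite -mulrBl; congr (_ / k); ring.
have eE : eta = 4 * e by rewrite /e; field.
move: cv1 cv2; rewrite !ler_norml eE.
move: up lo gup glo l1 l2.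
move: (fine _) (\int[P]_w _) (\int[P]_w _) (_ / Gamma alpha) (_ / Gamma alpha)
  (_ / Gamma alpha) (_ / Gamma alpha) (_ / Gamma alpha).
clear; move=> x1 x2 x3 x4 x5 x6 x7 x8 ? ? ? ? ? ? /andP[? ?] /andP[? ?].
by apply/andP; split; lra.
Qed.

End laplace_continuity.

(** * Limits of the one-dimensional laws *)

Section long_time_behaviour.
Context {d : measure_display} {T : measurableType d} {R : realType}.
Variables (P : probability T R) (W X : R -> {RV P >-> R}).
Variables (x0 a sigma N : R).
Hypotheses (hx0 : 0 < x0) (ha : 0 < a) (hsigma : 0 < sigma).
Hypotheses (hfeller : sigma ^+ 2 <= 2 * a) (hN : 0 < N).
Hypothesis hW : wiener_process W.

Let mabs t : measurable_fun setT (fun w => `|X t w|).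
Proof. exact: measurableT_comp. Qed.

Let c := sigma ^+ 2 / 2.
Let c0 : 0 < c. Proof. by rewrite divr_gt0// exprn_gt0. Qed.
Let ac1 : 1 <= a / c.
Proof. by rewrite ler_pdivlMr// mul1r /c ler_pdivrMr// mulrC. Qed.

(** The two events differ by a null set only. With the absolute value, the limit theorem for
    distribution functions applies to a process that is nonnegative everywhere. *)
Lemma prob_abs_lt (A : R -> T -> R) (s : R) :
  nonneg_strong_solution W sigma A X -> 0 <= s ->
  P [set w | X s w < N] = P [set w | `|X s w| < N].
Proof.
move=> [_ _ [B [mB B0 XB]] _] s0; apply/eqP; rewrite eq_le; apply/andP; split; last first.
  apply: le_measure; rewrite ?inE; [exact: measurable_sublevel|exact: measurable_sublevel|].
  by move=> w /=; exact: le_lt_trans (ler_norm _).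
have mN := measurable_sublevel N (mabs s).
rewrite -[leRHS]adde0 -[X in (_ + X)%E]B0.
apply: le_trans (measureU2 _ mN mB); apply: le_measure; rewrite ?inE.
- exact: measurable_sublevel.
- exact: measurableU.
move=> w /= XN; have [Bw|Bw] := pselect (B w); first by right.
left; rewrite ger0_norm//; apply: contrapT => Xs; apply: Bw; apply: XB => /= h.
exact: Xs (h s s0).
Qed.

(** The limit belongs to the Gamma law of shape a / c and scale c / b: psi tends to 0, which removes
    the initial value, and D tends to 1 + l c / b. *)
Let laplace_cvg (b l : R) : 0 < b -> 0 <= l -> cir_process W x0 a b sigma X ->
  \int[P]_w expR (- l * `|X t w|) @[t --> +oo] -->
  expR (- (a / c) * ln (1 + l * (c / b))).
Proof.
move=> b0 l0 hX.
have dl : 0 < 1 + l * (c / b) by rewrite ltr_pwDl// mulr_ge0// divr_ge0// ltW.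
apply: (@cvg_trans _ (expR (- (riccati b c l t * x0 +
    a / c * ln (riccati_den b c l t))) @[t --> +oo])).
  apply: near_eq_cvg; have := nbhs_pinfty_gt (num_real (0 : R)).
  apply: filterS => t t0; rewrite /Rintegral.
  by rewrite (cir_laplace_transform (ltW ha) (ltW b0) hsigma t0 l0 hW hX).
have -> : - (a / c) * ln (1 + l * (c / b)) =
    - (0 * x0 + a / c * ln (1 + l * (c / b))) by rewrite mul0r add0r mulNr.
apply: continuous_cvg; first exact: continuous_expR.
apply: cvgN; apply: cvgD.
  by apply: cvgM; [exact: riccati_cvg0|exact: cvg_cst].
apply: cvgM; first exact: cvg_cst.
by apply: continuous_cvg; [exact: continuous_ln|exact: riccati_den_cvg].
Qed.

Lemma cir_no_drift_prob_cvg0 : cir_process W x0 a 0 sigma X ->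
  fine (P [set w | `|X t w| < N]) @[t --> +oo] --> 0.
Proof.
move=> hX; apply/cvgrPdist_le => e e0.
(* From this time on the final bound exp(N) / (c t) is at most [e]. *)
have := nbhs_pinfty_ge (num_real (expR N / (c * e))).
apply: filterS2 (nbhs_pinfty_gt (num_real (0 : R))) => t t0 te.
rewrite sub0r normrN ger0_norm ?fine_ge0//.
have mA := measurable_sublevel N (mabs t).
rewrite -lee_fin fineK ?fin_num_measure//.
have mE : measurable_fun setT (fun w => (expR (- 1 * `|X t w|))%:E).
  by apply/measurable_EFinP; apply: measurableT_comp => //; exact: measurable_funM.
have -> : P [set w | `|X t w| < N] = (\int[P]_w (\1_[set w | `|X t w| < N] w)%:E)%E.
  by rewrite integral_indic// setIT.
apply: (@le_trans _ _ (\int[P]_w ((expR N)%:E * (expR (- 1 * `|X t w|))%:E))%E).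
  apply: ge0_le_integral => //.
  - exact/measurable_EFinP/measurable_indic.
  - exact: measurable_funeM.
  move=> w _; rewrite -EFinM lee_fin -expRD indicE.
  have [|_] := boolP (w \in _); last exact: expR_ge0.
  rewrite inE/= => XN; rewrite -[leLHS]expR0 ler_expR mulN1r subr_ge0; exact: ltW.
rewrite ge0_integralZl//.
rewrite (cir_laplace_transform (ltW ha) (lexx 0) hsigma t0 ler01 hW hX).
rewrite -EFinM lee_fin -ler_pdivlMl ?expR_gt0//.
have -> : riccati_den 0 (sigma ^+ 2 / 2) 1 t = 1 + c * t.
  by rewrite /riccati_den /decay_integral eqxx mul1r.
have ct0 : 0 < c * t by rewrite mulr_gt0.
have ln0 : 0 <= ln (1 + c * t) by rewrite ln_ge0// lerDl ltW.
(* The term psi x0 >= 0 is dropped and, as a / c >= 1, the power D^(- a / c) is bounded by D^-1. *)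
apply: (@le_trans _ _ (expR (- ln (1 + c * t)))).
  rewrite ler_expR lerN2 ler_wpDl//; last by rewrite ler_peMl.
  by rewrite mulr_ge0// ?(ltW hx0)// riccati_ge0// ltW.
rewrite expRN lnK ?posrE ?addr_gt0//.
apply: (@le_trans _ _ (c * t)^-1).
  by rewrite lef_pV2 ?posrE ?addr_gt0// lerDr.
rewrite -[leRHS]invrK lef_pV2 ?posrE ?invr_gt0 ?mulr_gt0 ?invr_gt0 ?expR_gt0//.
rewrite invfM invrK.
by move: te; rewrite ler_pdivrMr ?mulr_gt0// mulrA (mulrC t) ler_pdivrMr.
Qed.

Lemma cir_prob_cvg (b : R) : 0 <= b -> cir_process W x0 a b sigma X ->
  fine (P [set w | `|X t w| < N]) @[t --> +oo] -->
  lower_gamma (2 * a / sigma ^+ 2) (2 * b * N / sigma ^+ 2)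
    / Gamma (2 * a / sigma ^+ 2).
Proof.
have acE : 2 * a / sigma ^+ 2 = a / c by rewrite /c; field; rewrite gt_eqF.
rewrite le_eqVlt => /predU1P[<-|b0] hX.
  (* For b = 0 the incomplete Gamma integral is over a single point, so the limit to be proved is
     0. *)
  rewrite mulr0 !mul0r /lower_gamma set_itv1 Rintegral_set1 mul0r.
  exact: cir_no_drift_prob_cvg0.
have -> : 2 * b * N / sigma ^+ 2 = N / (c / b).
  by rewrite /c; field; rewrite !gt_eqF.
rewrite acE; apply: (@cdf_cvg _ _ _ _ (fun t w => `|X t w|)) => //.
  by rewrite divr_gt0.
by move=> l l0; exact: laplace_cvg.
Qed.

End long_time_behaviour.

Lemma time_average_prob_cvg (d : measure_display) (T : measurableType d)
    (R : realType) (P : probability T R) (E E' : R -> set T) (L : R) :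
  0 <= L -> (forall s, measurable (E s)) ->
  (forall s, 0 <= s -> P (E' s) = P (E s)) ->
  fine (P (E s)) @[s --> +oo] --> L ->
  time_average_prob P E' t @[t --> +oo] --> L.
Proof.
move=> L0 mE EE' EL.
have -> : time_average_prob P E' = time_average_prob P E.
  apply/funext => t; rewrite /time_average_prob; congr (_ * _).
  apply: eq_Rintegral => s; rewrite inE/= in_itv/= => /andP[s0 _].
  by congr fine; exact: EE'.
apply: time_average_cvg => // s; rewrite fine_ge0//= -lee_fin fineK ?fin_num_measure//.
exact: probability_le1.
Qed.

Lemma cir_of_squared_bessel (d : measure_display) (T : measurableType d)
    (R : realType) (P : probability T R) (W Y : R -> {RV P >-> R}) (y0 a sigma : R) :
  squared_bessel_process W y0 a sigma Y -> cir_process W y0 a 0 sigma Y.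
Proof.
move=> [adY cY Y0 [I [II YE]]]; split => //; exists I; split => //.
apply: filterS YE => w YE t t0; rewrite YE//; congr (_ + _ + _).
under eq_Rintegral do rewrite mul0r subr0.
rewrite Rintegral_cst//= lebesgue_measure_itv/= lte_fin; case: ltP => [_|t0'].
  by rewrite -EFinB subr0.
by rewrite (@le_anti _ _ t 0) ?t0 ?t0'// !mulr0.
Qed.

Theorem proposition6p2 (R : realType) (d : measure_display)
    (T : measurableType d) (P : probability T R)
    (W X Y : R -> {RV P >-> R}) (x0 y0 a b sigma N : R)
    (hW : wiener_process W)
    (hx0 : 0 < x0) (hy0 : 0 < y0) (ha : 0 < a) (hb : 0 <= b)
    (hsigma : 0 < sigma) (hfeller : sigma ^+ 2 <= 2 * a)
    (hX : cir_process W x0 a b sigma X)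
    (hY : squared_bessel_process W y0 a sigma Y)
    (hN : 0 < N) :
  time_average_prob P (fun s => [set w | X s w < N]) t @[t --> +oo] -->
    lower_gamma (2 * a / sigma ^+ 2) (2 * b * N / sigma ^+ 2)
      / Gamma (2 * a / sigma ^+ 2)
  /\
  (stochastically_unstable Y /\
   time_average_prob P (fun s => [set w | Y s w < N]) t @[t --> +oo] --> 0).
Proof.
have hY' := cir_of_squared_bessel hY.
have mabs (Z : R -> {RV P >-> R}) (M s : R) : measurable [set w | `|Z s w| < M].
  by apply: measurable_sublevel; exact: measurableT_comp.
have alpha1 : 1 <= 2 * a / sigma ^+ 2 by rewrite ler_pdivlMr ?exprn_gt0// mul1r.
split; last split.
- apply: time_average_prob_cvg (fun s => mabs X N s) _ _.
  + rewrite divr_ge0 ?(ltW (Gamma_gt0 alpha1))//.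
    by apply: Rintegral_ge0 => u _; exact: gamma_integrand_ge0.
  + by move=> s s0; exact: prob_abs_lt hX s0.
  + exact: (cir_prob_cvg hx0 ha hsigma hfeller hN hW hb hX).
- move=> M hM; apply: time_average_prob_cvg (fun s => mabs Y M s) _ _ => //.
  exact: (cir_no_drift_prob_cvg0 M hy0 ha hsigma hfeller hW hY').
- apply: time_average_prob_cvg (fun s => mabs Y N s) _ _ => //.
  + by move=> s s0; exact: prob_abs_lt hY s0.
  + exact: (cir_no_drift_prob_cvg0 N hy0 ha hsigma hfeller hW hY').
Qed.
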